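(* Let $\Bbbk$ be an algebraically closed field of characteristic zero, let $q\in\Bbbk^\times$ be such that $q^2$ has finite (multiplicative) order $l>1$, and put $\delta=-q-q^{-1}$. Let $\mathbf{T}$ be the Temperley-Lieb category over $\Bbbk$ with parameter $\delta$. (i) $\mathbf{T}$ has exactly one tensor ideal which is neither zero nor all of $\mathbf{T}$, namely the ideal $\mathcal{J}$ of negligible morphisms. The ideal $\mathcal{J}$ is generated (as a tensor ideal) by a quasi-idempotent $f\in\mathbf{T}(l-1,l-1)=TL_{l-1}(\delta)$. (ii) The quasi-idempotent $f\in TL_{l-1}(\delta)$ satisfies $fd=0=df$ for every diagram $d\in TL_{l-1}(\delta)$ which contains a cup or a cap; in particular $f$ is central in $TL_{l-1}(\delta)$.
   Context: The Temperley-Lieb category $\mathbf{T}$ is the $\Bbbk$-linear strict monoidal category with object set $\mathbb{N}=\{0,1,2,\dots\}$, $i\otimes j=i+j$ (so the unit object is $0$), where $\mathbf{T}(i,j)$ has basis the non-crossing planar diagrams pairing up $i$ dots on a lower horizontal line and $j$ dots on an upper horizontal line. Composition is concatenation, with each closed loop replaced by the scalar $\delta$; the tensor product of diagrams is juxtaposition. $TL_n(\delta)=\mathbf{T}(n,n)$ is the Temperley-Lieb algebra. A cup is an arc connecting two dots on the upper line, a cap an arc connecting two dots on the lower line. $\mathbf{T}$ is rigid (each object is self-dual) and admits a braiding. An element $f$ of a $\Bbbk$-algebra is a quasi-idempotent if $f^2=\alpha f$ for some $\alpha\in\Bbbk$. A tensor ideal $\mathcal{J}$ consists of subgroups $\mathcal{J}(X,Y)\subset\mathbf{T}(X,Y)$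 for all objects $X,Y$, closed under pre- and post-composition with arbitrary morphisms and such that $f\in\mathcal{J}(X,Y)$ implies $1_Z\otimes f\in\mathcal{J}(Z\otimes X,Z\otimes Y)$ for all $Z$. In a right rigid monoidal category with braiding $\gamma$, the trace of $f\in\mathrm{End}(X)$ is the composite $\mathrm{tr}(f)=\mathrm{ev}_X\circ\gamma_{X^\vee,X}\circ(1_{X^\vee}\otimes f)\circ\mathrm{co}_X\in\mathrm{End}(\mathbf 1)$, where $\mathrm{ev}_X:X\otimes X^\vee\to\mathbf{1}$ and $\mathrm{co}_X:\mathbf{1}\to X^\vee\otimes X$ are the duality morphisms. A morphism $f:X\to Y$ is negligible if $\mathrm{tr}(g\circ f)=0$ for all $g:Y\to X$ (when $\mathrm{End}(\mathbf 1)$ is a field this notion does not depend on the choice of braiding). *)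

(* Defs.v *)
From HB Require Import structures.
From mathcomp Require Import all_boot all_order all_algebra.

Set Implicit Arguments.
Unset Strict Implicit.
Unset Printing Implicit Defensive.

Import GRing.Theory.
Local Open Scope ring_scope.

(* [inl a] is the [a]-th dot of the lower line and [inr b] the [b]-th dot of  *)
(* the upper line, both counted from left to right starting at 0.             *)
Definition dots (i j : nat) : finType := ('I_i + 'I_j)%type.

Definition pairing (i j : nat) := {ffun dots i j -> dots i j}.

(* Rank of a dot when the boundary of the strip is read once around: the      *)
(* lower line from left to right, then the upper line from right to left.     *)
(* A pairing can be drawn in the strip without crossings iff no two of its    *)
(* arcs interleave in this order.                                             *)
Definition rank (i j : nat) (x : dots i j) : nat :=
  match x with
  | inl a => a
  | inr b => i + rev_ord b
  end%N.

Definition planar (i j : nat) (p : pairing i j) : bool :=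
  [&& [forall x, p x != x],
      [forall x, p (p x) == x] &
      [forall x, forall y,
         ~~ [&& rank x < rank y, rank y < rank (p x)
              & rank (p x) < rank (p y)]]]%N.

Definition diagram (i j : nat) := {p : pairing i j | planar p}.

Definition has_cup (i j : nat) (d : diagram i j) : bool :=
  [exists b, exists b', val d (inr b) == inr b'].

Definition has_cap (i j : nat) (d : diagram i j) : bool :=
  [exists a, exists a', val d (inl a) == inl a'].

(* T(i, j): a linear combination of diagrams is its family of coefficients.   *)
Definition TLhom (K : fieldType) (i j : nat) := {ffun diagram i j -> K^o}.

(* The basis vector of the diagram whose underlying pairing is [p] (0 if [p]  *)
(* is not planar, a case that does not arise in the operations below).        *)
Definition dvec (K : fieldType) (i j : nat) (p : pairing i j) : TLhom K i j :=
  [ffun d => (val d == p)%:R].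

Definition id_pairing (n : nat) : pairing n n :=
  [ffun x => match x with inl a => inr a | inr b => inl b end].

Definition idT (K : fieldType) (n : nat) : TLhom K n n := dvec K (id_pairing n).

(* Stacking [p2 : pairing j m] on top of [p1 : pairing i j]: a graph whose    *)
(* vertices are the dots of the lower, middle and upper lines.                *)
Definition stack_dots (i j m : nat) : finType := ('I_i + 'I_j + 'I_m)%type.

Definition stack_low (i j m : nat) (x : dots i j) : stack_dots i j m := inl x.

Definition stack_up (i j m : nat) (y : dots j m) : stack_dots i j m :=
  match y with inl b => inl (inr b) | inr c => inr c end.

Definition stack_outer (i j m : nat) (z : dots i m) : stack_dots i j m :=
  match z with inl a => inl (inl a) | inr c => inr c end.

Definition stack_edge (i j m : nat) (p2 : pairing j m) (p1 : pairing i j) :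
    rel (stack_dots i j m) :=
  fun u v =>
    [exists x, (u == stack_low m x) && (v == stack_low m (p1 x))]
    || [exists y, (u == stack_up i y) && (v == stack_up i (p2 y))].

Definition concat (i j m : nat) (p2 : pairing j m) (p1 : pairing i j) :
    pairing i m :=
  [ffun z => odflt z
     [pick t | (t != z)
        && connect (stack_edge p2 p1) (stack_outer j z) (stack_outer j t)]].

(* The closed loops are the components which avoid the two outer lines.       *)
Definition loops (i j m : nat) (p2 : pairing j m) (p1 : pairing i j) : nat :=
  n_comp (stack_edge p2 p1)
    [pred u | ~~ [exists z : dots i m,
                    connect (stack_edge p2 p1) u (stack_outer j z)]].

(* g o f: [f] is the lower and [g] the upper diagram.                         *)
Definition compT (K : fieldType) (delta : K) (i j m : nat)
    (g : TLhom K j m) (f : TLhom K i j) : TLhom K i m :=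
  \sum_(d1 : diagram i j) \sum_(d2 : diagram j m)
    (g d2 * f d1 * delta ^+ loops (val d2) (val d1))
      *: dvec K (concat (val d2) (val d1)).

Definition juxt_left (i j i' j' : nat) (x : dots i j) :
    dots (i + i') (j + j') :=
  match x with inl a => inl (lshift i' a) | inr b => inr (lshift j' b) end.

Definition juxt_right (i j i' j' : nat) (x : dots i' j') :
    dots (i + i') (j + j') :=
  match x with inl a => inl (rshift i a) | inr b => inr (rshift j b) end.

Definition juxt (i j i' j' : nat) (p : pairing i j) (p' : pairing i' j') :
    pairing (i + i') (j + j') :=
  [ffun x => match x with
   | inl a => match split a with
              | inl a1 => juxt_left i' j' (p (inl a1))
              | inr a2 => juxt_right i j (p' (inl a2))
              end
   | inr b => match split b with
              | inl b1 => juxt_left i' j' (p (inr b1))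
              | inr b2 => juxt_right i j (p' (inr b2))
              end
   end].

Definition tensT (K : fieldType) (i j i' j' : nat)
    (f : TLhom K i j) (g : TLhom K i' j') : TLhom K (i + i') (j + j') :=
  \sum_(d : diagram i j) \sum_(e : diagram i' j')
    (f d * g e) *: dvec K (juxt (val d) (val e)).

(* Reindexing along equalities of objects; it is needed because (x+y)+z and   *)
(* x+(y+z) are equal but not convertible.                                     *)
Definition castT (K : fieldType) (i i' j j' : nat) (ei : i = i') (ej : j = j')
    (f : TLhom K i j) : TLhom K i' j' :=
  let: erefl in _ = i0 := ei return TLhom K i0 j' in
  let: erefl in _ = j0 := ej return TLhom K i j0 in f.

(* Nested caps below and nested cups above.                                   *)
Definition nested (i j : nat) : pairing i j :=
  [ffun x => match x with
             | inl a => inl (rev_ord a)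
             | inr b => inr (rev_ord b)
             end].

(* Every object is its own dual, with these duality morphisms.                *)
Definition evT (K : fieldType) (n : nat) : TLhom K (n + n) 0 :=
  dvec K (nested (n + n) 0).

Definition coT (K : fieldType) (n : nat) : TLhom K 0 (n + n) :=
  dvec K (nested 0 (n + n)).

Record is_braiding (K : fieldType) (delta : K)
    (gam : forall m n : nat, TLhom K (m + n) (n + m)) : Prop := IsBraiding {
  braiding_iso : forall m n : nat,
    exists gam' : TLhom K (n + m) (m + n),
      compT delta gam' (gam m n) = idT K (m + n)
      /\ compT delta (gam m n) gam' = idT K (n + m);
  braiding_natural : forall (i i' j j' : nat)
      (f : TLhom K i i') (g : TLhom K j j'),
    compT delta (gam i' j') (tensT f g) = compT delta (tensT g f) (gam i j);
  braiding_hexagon_r : forall x y z : nat,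
    gam x (y + z)%N =
      compT delta
        (castT (erefl _) (addnA y z x) (tensT (idT K y) (gam x z)))
        (castT (esym (addnA x y z)) (esym (addnA y x z))
               (tensT (gam x y) (idT K z)));
  braiding_hexagon_l : forall x y z : nat,
    gam (x + y)%N z =
      compT delta
        (castT (erefl _) (esym (addnA z x y)) (tensT (gam x z) (idT K y)))
        (castT (addnA x y z) (addnA x z y) (tensT (idT K x) (gam y z)))
}.

Definition traceT (K : fieldType) (delta : K)
    (gam : forall m n : nat, TLhom K (m + n) (n + m))
    (n : nat) (f : TLhom K n n) : TLhom K 0 0 :=
  compT delta (evT K n)
    (compT delta (gam n n) (compT delta (tensT (idT K n) f) (coT K n))).

Definition negligible (K : fieldType) (delta : K)
    (gam : forall m n : nat, TLhom K (m + n) (n + m))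
    (i j : nat) (f : TLhom K i j) : Prop :=
  forall g : TLhom K j i, traceT delta gam (compT delta g f) = 0.

Record tensor_ideal (K : fieldType) (delta : K)
    (J : forall i j : nat, TLhom K i j -> Prop) : Prop := TensorIdeal {
  ideal_zero : forall i j : nat, J i j 0;
  ideal_sub : forall (i j : nat) (f g : TLhom K i j),
    J i j f -> J i j g -> J i j (f - g);
  ideal_postcomp : forall (i j m : nat) (f : TLhom K i j) (g : TLhom K j m),
    J i j f -> J i m (compT delta g f);
  ideal_precomp : forall (i j m : nat) (f : TLhom K j m) (g : TLhom K i j),
    J j m f -> J i m (compT delta f g);
  ideal_tensor : forall (z i j : nat) (f : TLhom K i j),
    J i j f -> J (z + i)%N (z + j)%N (tensT (idT K z) f)
}.

Definition same_ideal (K : fieldType)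
    (I J : forall i j : nat, TLhom K i j -> Prop) : Prop :=
  forall (i j : nat) (f : TLhom K i j), I i j f <-> J i j f.

Definition zero_ideal (K : fieldType) (i j : nat) (f : TLhom K i j) : Prop :=
  f = 0.

Definition full_ideal (K : fieldType) (i j : nat) (f : TLhom K i j) : Prop :=
  True.

Definition generated_ideal (K : fieldType) (delta : K)
    (n n' : nat) (f : TLhom K n n') (i j : nat) (g : TLhom K i j) : Prop :=
  forall J : forall i j : nat, TLhom K i j -> Prop,
    tensor_ideal delta J -> J n n' f -> J i j g.

Definition nontrivial_ideal (K : fieldType) (delta : K)
    (J : forall i j : nat, TLhom K i j -> Prop) : Prop :=
  [/\ tensor_ideal delta J,
      ~ same_ideal J (@zero_ideal K) & ~ same_ideal J (@full_ideal K)].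

Definition quasi_idempotent (K : fieldType) (delta : K) (n : nat)
    (f : TLhom K n n) : Prop :=
  exists alpha : K, compT delta f f = alpha *: f.

(* Main.v *)
Require Import Defs.
From mathcomp Require Import all_boot all_order all_algebra.
From mathcomp Require Import zify ring.
From Stdlib Require Import FunctionalExtensionality Classical_Prop.

Set Implicit Arguments.
Unset Strict Implicit.
Unset Printing Implicit Defensive.

Import GRing.Theory.

(** Let a = l - 1. The proof represents T faithfully by matrices, reduces ideals
    to the vectors in T(0, n), and finds by quantum sl2 the only vector killed
    by all caps.

    A diagram acts on words in two letters by a state sum: a cap sends the word
    01 to 1 and 10 to -1/q, a cup creates -q 01 + 10, and a closed loop gives
    -q - 1/q. The state sum of a composite is the product of the state sums
    (rep_comp): the lines glued in a composition are contracted one adjacent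
    pair at a time, and one contraction is a finite check (weight_contract).
    The representation is faithful (rep_inj), being triangular for the sum of
    the ranks of the right ends of the arcs. All categorical identities are then
    computed with matrices indexed by words, where the equalities
    (x + y) + z = x + (y + z) need no transport.

    Let J consist of the morphisms that give 0 whenever they are tensored with
    identities and closed up to a scalar. It is a tensor ideal, it contains all
    proper ones (proper_annihilated), and for every braiding it is the ideal of
    negligible morphisms, because evaluation followed by the braiding is again a
    perfect pairing (braided_zigzag). By duality an ideal is determined by its
    vectors, the morphisms from 0 to n.

    Let v in T(0, n) be nonzero and killed by all adjacent caps, n > 0. Its
    entries change by the factor q when two adjacent letters are sorted, so v is
    determined up to a scalar, and n = 2k. As v is invariant under quantum sl2,
    the divided powers of the lowering operator kill it (block_sum0); the first
    one gives that l divides k + 1 = ml, and the l-th one that m = 1 unless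
    m = 0 in the field, where characteristic zero enters (cap_free_degree). So
    k = a. A proper ideal thus has no nonzero vector of length less than 2a, and
    every nonzero proper ideal contains the same vector of length 2a; unbent, it
    is an endomorphism f of a.

    Such an f exists: some f nonzero is orthogonal, for the trace pairing, to
    all diagrams of T(a, a) but the identity, since these are too few
    (exists_orthogonal). Caps then send the bent f into J, hence to 0, except
    for the middle one; and the first lowering operator forces the middle one to
    kill it too (cap_free_middle). Therefore f annihilates all diagrams with a
    cup or a cap, its coefficient at the identity is not zero, and multiplying
    with f is taking the coefficient at the identity (generator_mul). Finally
    f generates J: the identity of a is congruent to a combination of diagrams
    with a cap modulo f, so modulo f every vector of J is shortened until its
    length is less than 2a (annihilated_vector_sub). *)


(** * Contracting an adjacent pair of dots *)

Section Contraction.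

Variables (X : finType) (R : X -> nat).
Hypothesis injR : injective R.

(** Pairings without crossings of a linearly ordered set of dots, in the form in
    which planarity is used: what starts below an arc stays below it. *)
Record planar_involution (a : X -> X) : Prop := PlanarInvolution {
  planar_fixfree : forall z, a z != z;
  planar_invol : involutive a;
  planar_nested : forall z u, R z < R u < R (a z) -> R z < R (a u) < R (a z)
}.

(** Joins the two arcs that end at x and y. The dots x and y remain, paired with
    each other, so that no type of remaining dots is needed. *)
Definition contract (x y : X) (a : X -> X) (z : X) : X :=
  if z == x then y else if z == y then x
  else if z == a x then a y else if z == a y then a x else a z.

Section Step.

Variables (a : X -> X) (x y : X).
Hypothesis pa : planar_involution a.
Hypothesis ltxy : R x < R y.
Hypothesis stable_between : forall z, R x < R z < R y -> R x < R (a z) < R y.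

Local Notation a' := (contract x y a).

Let neqR u v : u != v -> R u != R v.
Proof. by rewrite (inj_eq injR). Qed.

Let aK := planar_invol pa.
Let aF := planar_fixfree pa.

Lemma glued_neq : x != y.
Proof. by apply/eqP => e; move: ltxy; rewrite e ltnn. Qed.

Lemma contract_x : a' x = y.
Proof. by rewrite /contract eqxx. Qed.

Lemma contract_y : a' y = x.
Proof. by rewrite /contract eqxx eq_sym (negPf glued_neq). Qed.

Lemma contract_ax : a x != y -> a' (a x) = a y.
Proof. by move=> n; rewrite /contract (negPf (aF x)) (negPf n) eqxx. Qed.

Lemma neq_ay : a x != y -> a y != x.
Proof. by apply: contra => /eqP <-; rewrite aK. Qed.

Lemma contract_ay : a x != y -> a' (a y) = a x.
Proof.
move=> n; rewrite /contract (negPf (neq_ay n)) (negPf (aF y)).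
by rewrite (inj_eq (inv_inj aK)) eq_sym (negPf glued_neq) eqxx.
Qed.

Lemma contract_other z :
  z != x -> z != y -> z != a x -> z != a y -> a' z = a z.
Proof. by rewrite /contract; do 4!move/negPf->. Qed.

Lemma contract_loop : a x = y -> a' =1 a.
Proof.
move=> e z; have e' : a y = x by rewrite -e aK.
rewrite /contract e e'; case: eqP => [->//|_]; case: eqP => [->//|_].
by [].
Qed.

Variant dot_spec : X -> X -> Prop :=
  | DotX : dot_spec x y
  | DotY : dot_spec y x
  | DotAX : dot_spec (a x) (a y)
  | DotAY : dot_spec (a y) (a x)
  | DotOther z of z != x & z != y & a z != x & a z != y : dot_spec z (a z).

Lemma contractP z : a x != y -> dot_spec z (a' z).
Proof.
move=> n.
have [->|zx] := eqVneq z x; first by rewrite contract_x; constructor.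
have [->|zy] := eqVneq z y; first by rewrite contract_y; constructor.
have [->|zax] := eqVneq z (a x); first by rewrite contract_ax //; constructor.
have [->|zay] := eqVneq z (a y); first by rewrite contract_ay //; constructor.
rewrite contract_other //; constructor=> //.
  by apply: contra zax => /eqP <-; rewrite aK.
by apply: contra zay => /eqP <-; rewrite aK.
Qed.

(** An arc leaving a stable interval from an endpoint does not come back into it.
    Of the four positions left for the two other ends, one is a crossing. *)
Lemma glued_ends : a x != y ->
  [\/ R (a x) < R x /\ R y < R (a y),
      R (a y) < R (a x) /\ R (a x) < R x |
      R y < R (a y) /\ R (a y) < R (a x)].
Proof.
move=> n.
have h1 := stable_between (z := a x); have h2 := stable_between (z := a y).
rewrite !aK in h1 h2.
have n1 := neqR (aF x); have n2 := neqR (aF y); have n3 := neqR n.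
have n4 := neqR (neq_ay n).
have n5 : R (a x) != R (a y).
  by rewrite (inj_eq injR) (inj_eq (inv_inj aK)) glued_neq.
have c1 := planar_nested pa (z := x) (u := y).
have c2 := planar_nested pa (z := a y) (u := a x).
have c3 := planar_nested pa (z := a y) (u := x).
have c4 := planar_nested pa (z := a x) (u := a y).
rewrite !aK in c1 c2 c3 c4.
have [d|d] := ltnP (R (a x)) (R x); have [d'|d'] := ltnP (R (a y)) (R y).
- by apply: Or32; lia.
- by apply: Or31; lia.
- by exfalso; lia.
- by apply: Or33; lia.
Qed.

Lemma contract_planar : planar_involution a'.
Proof.
have [e|n] := eqVneq (a x) y.
  split=> [z|z|z u]; rewrite ?contract_loop //; exact: planar_nested.
split=> [z|z|z u].
- case: (contractP z n) => [||||u *]; rewrite ?aF //.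
  + by rewrite eq_sym glued_neq.
  + by rewrite glued_neq.
  + by rewrite (inj_eq (inv_inj aK)) eq_sym glued_neq.
  + by rewrite (inj_eq (inv_inj aK)) glued_neq.
- case: (contractP z n) => [||||u ux uy aux auy].
  + exact: contract_y.
  + exact: contract_x.
  + exact: contract_ay.
  + exact: contract_ax.
  rewrite contract_other ?aK //.
    by rewrite (inj_eq (inv_inj aK)).
  by rewrite (inj_eq (inv_inj aK)).
have ge := glued_ends n.
have sx := stable_between (z := a x); have sy := stable_between (z := a y).
rewrite !aK in sx sy.
case: (contractP z n) => [||||{}z zx zy azx azy];
  case: (contractP u n) => [||||{}u ux uy aux auy]; try (by lia);
  try (move/neqR in ux; move/neqR in uy; move/neqR in aux; move/neqR in auy);
  try (move/neqR in zx; move/neqR in zy; move/neqR in azx; move/neqR in azy).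
- exact: stable_between.
- by case: ge => -[]; lia.
- by case: ge => -[]; lia.
- have s1 := stable_between (z := u); have s2 := stable_between (z := a u).
  have c1 := planar_nested pa (z := x) (u := u).
  have c2 := planar_nested pa (z := a x) (u := u).
  have c3 := planar_nested pa (z := y) (u := u).
  have c4 := planar_nested pa (z := a y) (u := u).
  have c5 := planar_nested pa (z := x) (u := a u).
  have c6 := planar_nested pa (z := a x) (u := a u).
  have c7 := planar_nested pa (z := y) (u := a u).
  have c8 := planar_nested pa (z := a y) (u := a u).
  rewrite !aK in s1 s2 c1 c2 c3 c4 c5 c6 c7 c8.
  have e1 : R (a u) != R (a x).
    by rewrite (inj_eq injR) (inj_eq (inv_inj aK)) -(inj_eq injR).
  have e2 : R (a u) != R (a y).
    by rewrite (inj_eq injR) (inj_eq (inv_inj aK)) -(inj_eq injR).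
  by case: ge => -[]; lia.
- by case: ge => -[]; lia.
- by case: ge => -[]; lia.
- have s1 := stable_between (z := u); have s2 := stable_between (z := a u).
  have c1 := planar_nested pa (z := x) (u := u).
  have c2 := planar_nested pa (z := a x) (u := u).
  have c3 := planar_nested pa (z := y) (u := u).
  have c4 := planar_nested pa (z := a y) (u := u).
  have c5 := planar_nested pa (z := x) (u := a u).
  have c6 := planar_nested pa (z := a x) (u := a u).
  have c7 := planar_nested pa (z := y) (u := a u).
  have c8 := planar_nested pa (z := a y) (u := a u).
  rewrite !aK in s1 s2 c1 c2 c3 c4 c5 c6 c7 c8.
  have e1 : R (a u) != R (a x).
    by rewrite (inj_eq injR) (inj_eq (inv_inj aK)) -(inj_eq injR).
  have e2 : R (a u) != R (a y).
    by rewrite (inj_eq injR) (inj_eq (inv_inj aK)) -(inj_eq injR).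
  by case: ge => -[]; lia.
1-4: have s1 := stable_between (z := z); have s2 := stable_between (z := a z);
  have c1 := planar_nested pa (z := z) (u := x);
  have c2 := planar_nested pa (z := z) (u := a x);
  have c3 := planar_nested pa (z := z) (u := y);
  have c4 := planar_nested pa (z := z) (u := a y);
  rewrite !aK in s1 s2 c1 c2 c3 c4; lia.
exact: planar_nested.
Qed.

End Step.
End Contraction.

(** * Components of a glued diagram *)

Section GlueGraph.

Variables (X : finType) .

Definition glue_edge (a : X -> X) (L : seq (X * X)) : rel X :=
  fun u v => [|| v == a u, (u, v) \in L | (v, u) \in L].

Definition endpoints (L : seq (X * X)) : seq X :=
  map fst L ++ map snd L.

Lemma glue_edge_sym a L : involutive a -> symmetric (glue_edge a L).
Proof.
move=> aK u v; rewrite /glue_edge; congr (_ || _); last exact: orbC.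
by rewrite eq_sym (inv_eq aK).
Qed.

Lemma glue_connect_sym a L : involutive a -> connect_sym (glue_edge a L).
Proof. by move=> aK; apply/sym_connect_sym/glue_edge_sym. Qed.

Lemma connect_map (T T' : finType) (e : rel T) (e' : rel T') (h : T -> T') :
    (forall u v, e u v -> connect e' (h u) (h v)) ->
  forall u v, connect e u v -> connect e' (h u) (h v).
Proof.
move=> he u v /connectP[p ep ->]; elim: p u ep => //= w p IH u /andP[uw wp].
exact: connect_trans (he _ _ uw) (IH _ wp).
Qed.

(** The set D collects the dots already contracted, which form components of two
    dots that are not to be counted as loops. *)
Definition avoiding (e : rel X) (O : {pred X}) : pred X :=
  [pred u | ~~ [exists z, (z \in O) && connect e u z]].

Definition loop_count (a : X -> X) (L : seq (X * X)) (D O : {pred X}) : nat :=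
  n_comp (glue_edge a L) [predD avoiding (glue_edge a L) O & D].

Section Step.

Variables (a : X -> X) (x y : X) (L : seq (X * X)).
Hypothesis aK : involutive a.
Hypothesis a'K : involutive (contract x y a).
Hypothesis aF : forall z, a z != z.
Hypothesis xy : x != y.
Hypotheses (xL : x \notin endpoints L) (yL : y \notin endpoints L).

Local Notation a' := (contract x y a).
Local Notation e := (glue_edge a ((x, y) :: L)).
Local Notation e' := (glue_edge a' L).

Lemma endpoints_neq u v : (u, v) \in L -> [&& u != x, u != y, v != x & v != y].
Proof.
move=> uvL; have uE : u \in endpoints L.
  by rewrite mem_cat; apply/orP; left; apply/mapP; exists (u, v).
have vE : v \in endpoints L.
  by rewrite mem_cat; apply/orP; right; apply/mapP; exists (u, v).
by apply/and4P; split; apply/eqP=> E; move: xL yL; rewrite -E ?uE ?vE.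
Qed.

(** A map from the graph before the contraction to the graph after it, which
    induces a bijection on components. *)
Definition push_off (z : X) : X :=
  if z == x then a x else if z == y then a y else z.

Lemma push_off_id z : z != x -> z != y -> push_off z = z.
Proof. by rewrite /push_off => /negPf-> /negPf->. Qed.

Lemma push_off_alive z : a x != y -> (push_off z != x) && (push_off z != y).
Proof.
move=> n; rewrite /push_off; have [_|zx] := eqVneq z x; first by rewrite aF.
have [_|zy] := eqVneq z y; last by rewrite zx.
by rewrite aF andbT (inv_eq aK) eq_sym.
Qed.

Lemma connect_contract_sub u v : connect e' u v -> connect e u v.
Proof.
have xye : e x y by rewrite /glue_edge mem_head orbT.
have yxe : e y x by rewrite glue_edge_sym.
have ae z : e z (a z) by rewrite /glue_edge eqxx.
apply: (connect_sub _) => {}u {}v /orP[/eqP->|uvL]; last first.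
  by apply: connect1; rewrite /glue_edge !inE; case/orP: uvL => ->; rewrite !orbT.
rewrite /contract; case: eqP => [->|_]; first exact: connect1.
case: eqP => [->|_]; first exact: connect1.
have c2 z t s w : e z t -> e t s -> e s w -> connect e z w.
  move=> h1 h2 h3; apply: connect_trans (connect1 h1) _.
  exact: connect_trans (connect1 h2) (connect1 h3).
case: eqP => [->|_].
  by apply: (@c2 _ x y); rewrite // glue_edge_sym.
case: eqP => [->|_]; last exact: connect1.
by apply: (@c2 _ y x); rewrite // glue_edge_sym.
Qed.

Lemma connect_contract u v : a x != y ->
  connect e u v = connect e' (push_off u) (push_off v).
Proof.
move=> n; apply/idP/idP.
  apply: connect_map => {}u {}v; rewrite {1}/glue_edge !inE => H.
  have sym : connect_sym e' := glue_connect_sym L a'K.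
  have axy : connect e' (a x) (a y).
    by apply: connect1; rewrite /glue_edge /contract (negPf (aF x)) (negPf n) !eqxx.
  case/or3P: H => [/eqP->|/orP[/eqP[-> ->]|uvL]|/orP[/eqP[-> ->]|vuL]].
  - rewrite /push_off; have [->|ux] := eqVneq u x.
      by rewrite (negPf (aF _)) (negPf n).
    have [->|uy] := eqVneq u y.
      have n' : a y != x by rewrite (inv_eq aK) eq_sym.
      by rewrite (negPf (aF _)) (negPf n').
    case: eqP => [aux|/eqP aux]; first by rewrite (_ : a x = u) // -aux aK.
    case: eqP => [auy|/eqP auy]; first by rewrite (_ : a y = u) // -auy aK.
    apply: connect1; rewrite /glue_edge contract_other ?eqxx //.
      by apply: contra aux => /eqP->; rewrite aK.
    by apply: contra auy => /eqP->; rewrite aK.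
  - by rewrite /push_off eqxx [y == x]eq_sym (negPf xy) eqxx.
  - have /and4P[*] := endpoints_neq uvL; rewrite !push_off_id //.
    by apply: connect1; rewrite /glue_edge uvL orbT.
  - by rewrite /push_off eqxx [y == x]eq_sym (negPf xy) eqxx sym.
  - have /and4P[*] := endpoints_neq vuL; rewrite !push_off_id //.
    by apply: connect1; rewrite /glue_edge vuL !orbT.
move=> /connect_contract_sub H.
have sym := glue_connect_sym ((x, y) :: L) aK.
have pe z : connect e z (push_off z).
  rewrite /push_off; case: eqP => [->|_]; first by apply: connect1; rewrite /glue_edge eqxx.
  by case: eqP => [->|//]; apply: connect1; rewrite /glue_edge eqxx.
by apply: connect_trans (pe u) (connect_trans H _); rewrite sym.
Qed.

Lemma glue_edge_loop : a x = y -> e =2 e'.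
Proof.
move=> axy; have ayx : a y = x by rewrite -axy aK.
have a'a : contract x y a =1 a.
  move=> z; rewrite /contract axy ayx.
  by case: eqP => [->|_] //; case: eqP => [->|_].
move=> u v; rewrite /glue_edge a'a !inE !xpair_eqE.
have [//|nvu /=] := eqVneq v (a u).
have -> : (u == x) && (v == y) = false.
  by apply: contraNF nvu => /andP[/eqP-> /eqP->]; rewrite axy.
suff -> : (v == x) && (u == y) = false by [].
by apply: contraNF nvu => /andP[/eqP-> /eqP->]; rewrite ayx.
Qed.

Lemma connect_contract_alive u v :
    u != x -> u != y -> v != x -> v != y ->
  connect e u v = connect e' u v.
Proof.
move=> ux uy vx vy; have [axy|n] := eqVneq (a x) y.
  by rewrite (eq_connect (glue_edge_loop axy)).
by rewrite connect_contract // !push_off_id.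
Qed.

Variables (D O : {pred X}).
Hypothesis Da : forall z, (a z \in D) = (z \in D).
Hypothesis DL : forall u v, (u, v) \in L -> (u \notin D) && (v \notin D).
Hypotheses (xD : x \notin D) (yD : y \notin D).
Hypotheses (xO : x \notin O) (yO : y \notin O).

(** When x and y are already joined by an arc, gluing them closes a loop, which
    the contraction leaves as the dead component {x, y}. Otherwise push_off is
    an adjunction between the two graphs, away from {x, y}. *)
Lemma loop_count_step :
  loop_count a ((x, y) :: L) D O =
  (a x == y) + loop_count a' L [predU pred2 x y & D] O.
Proof.
have sym' : connect_sym e' := glue_connect_sym L a'K.
have sym : connect_sym e := glue_connect_sym ((x, y) :: L) aK.
have a'xy : contract x y a x = y by rewrite /contract eqxx.
have xye' : e' x y by rewrite /glue_edge a'xy eqxx.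
have clxy u v : e' u v -> (u \in pred2 x y) = (v \in pred2 x y).
  have a'y : contract x y a y = x by have := a'K x; rewrite a'xy.
  case/orP=> [/eqP->|]; rewrite !inE.
    by rewrite !(inv_eq a'K) a'xy a'y orbC.
  by case/orP=> /endpoints_neq /and4P[] /negPf-> /negPf-> /negPf-> /negPf->.
have a'D z : z \notin pred2 x y -> (contract x y a z \in D) = (z \in D).
  rewrite !inE negb_or /contract => /andP[/negPf-> /negPf->].
  case: eqP => [->|_]; first by rewrite !Da (negPf xD) (negPf yD).
  by case: eqP => [->|_]; rewrite !Da ?(negPf xD) ?(negPf yD).
have clD : closed e' [predU pred2 x y & D].
  move=> u v uv; have := clxy _ _ uv; rewrite !inE => <-.
  have [//|nu] := boolP ((u == x) || (u == y)); rewrite /=.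
  case/orP: uv => [/eqP->|]; first by rewrite a'D // inE.
  by case/orP=> /DL /andP[/negPf-> /negPf->].
have avoid_cl (f : rel X) : connect_sym f -> closed f (avoiding f O).
  move=> fsym; apply: intro_closed => // u v uv; apply: contra.
  case/existsP=> z /andP[zO vz]; apply/existsP; exists z; rewrite zO.
  exact: connect_trans (connect1 uv) vz.
have [axy|n] := eqVneq (a x) y.
  have ee' : e =2 e' := glue_edge_loop axy.
  have cx : connect e' x =i pred2 x y.
    move=> z; apply/idP/idP => [xz|].
      by rewrite -(closed_connect clxy xz) !inE eqxx.
    by rewrite !inE => /pred2P[]->; [exact: connect0 | exact: connect1].
  have er : roots e =1 roots e' by move=> z; rewrite /roots /= (eq_root ee').
  rewrite /loop_count add1n -[in RHS]addn1 addnC.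
  rewrite /n_comp_mem -(cardID (pred2 x y)); congr (_ + _).
    rewrite -(n_comp_connect sym' x); apply: eq_card => z; rewrite !inE.
    rewrite er; case: (roots e' z) => //=; have := cx z; rewrite !inE => ->.
    have [zxy|] := boolP ((z == x) || (z == y)); last by rewrite andbF.
    have -> : z \notin D by case/orP: zxy => /eqP->.
    rewrite andbT; apply/existsP => -[t /andP[tO]].
    rewrite (eq_connect ee') => zt.
    have: t \in pred2 x y by rewrite -(closed_connect clxy zt) !inE.
    by rewrite !inE => /pred2P[] E; move: tO xO yO; rewrite E => ->.
  apply: eq_card => z; rewrite !inE er negb_or.
  rewrite (_ : [exists t, _] = [exists t, (t \in O) && connect e' z t]); last first.
    by apply: eq_existsb => t; rewrite (eq_connect ee').
  by case: (z == x); case: (z == y); rewrite ?andbF.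
rewrite add0n /loop_count.
have H : rel_adjunction push_off e' e
    [predD avoiding e' O & [predU pred2 x y & D]].
  split=> [u|u v _]; last exact: connect_contract.
  rewrite !inE !negb_or -andbA => /andP[/andP[ux uy] _].
  by exists u; rewrite push_off_id.
have clA : closed e' [predD avoiding e' O & [predU pred2 x y & D]].
  by move=> u v uv; rewrite !inE; have := clD u v uv; rewrite !inE => ->;
    have := avoid_cl e' sym' u v uv; rewrite !inE => ->.
rewrite (adjunction_n_comp push_off sym' sym clA H).
apply: eq_n_comp_r => u; rewrite !inE.
have /andP[/negPf-> /negPf->] := push_off_alive u n.
congr (_ && ~~ _).
  rewrite /push_off; case: eqP => [->|_]; first by rewrite Da.
  by case: eqP => [->|_]; rewrite ?Da.
apply: eq_existsb => z; have [zO|//] := boolP (z \in O); rewrite /=.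
rewrite connect_contract // [push_off z]push_off_id //.
  by apply: contraNneq xO => <-.
by apply: contraNneq yO => <-.
Qed.

End Step.

End GlueGraph.

Local Open Scope ring_scope.

(** * State sums *)

Section ArcWeights.

Variables (K : fieldType) (q : K).
Hypothesis q0 : q != 0.

(** The matrix of a cap. The states at the two ends of an arc must differ. *)
Definition arc_weight (b c : bool) : K :=
  if b (+) c then if b then - q^-1 else 1 else 0.

Variables (X : finType) (R : X -> nat).
Hypothesis injR : injective R.

Definition weight (A : {pred X}) (a : X -> X) (s : X -> bool) : K :=
  \prod_(z in A) (if (R z < R (a z))%N then arc_weight (s z) (s (a z)) else 1).

Definition glue_state (x y : X) (b : bool) (s : X -> bool) : X -> bool :=
  fun z => if z == x then ~~ b else if z == y then b else s z.

Section Step.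

Variables (a : X -> X) (x y : X) (A : {pred X}) (s : X -> bool).
Hypothesis pa : planar_involution R a.
Hypothesis ltxy : (R x < R y)%N.
Hypothesis stable_between : forall z, (R x < R z < R y -> R x < R (a z) < R y)%N.
Hypotheses (xA : x \in A) (yA : y \in A).
Hypothesis Aa : forall z, (a z \in A) = (z \in A).

(** The isotopy invariance of the state sum: the cup glued in at x and y
    straightens two arcs into one, in each of the positions of glued_ends, or it
    closes a loop of value -q - 1/q. *)
Lemma weight_contract :
  \sum_(b : bool) (- q) ^+ b * weight A a (glue_state x y b s) =
  (- q - q^-1) ^+ (a x == y) * weight [predD A & pred2 x y] (contract x y a) s.
Proof.
have aK := planar_invol pa; have aF := planar_fixfree pa.
have xy : x != y by apply: contraTneq ltxy => ->; rewrite ltnn.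
have yx : y != x by rewrite eq_sym.
rewrite big_bool /= expr1 expr0 mul1r.
have gx b : glue_state x y b s x = ~~ b by rewrite /glue_state eqxx.
have gy b : glue_state x y b s y = b by rewrite /glue_state eqxx (negPf yx).
have gz b z : z != x -> z != y -> glue_state x y b s z = s z.
  by rewrite /glue_state => /negPf-> /negPf->.
rewrite /weight.
have [axy|n] := eqVneq (a x) y.
  have ayx : a y = x by rewrite -axy aK.
  have E b : \prod_(z in A) (if (R z < R (a z))%N then
       arc_weight (glue_state x y b s z) (glue_state x y b s (a z)) else 1) =
     arc_weight (~~ b) b * \prod_(z in [predD A & pred2 x y])
     (if (R z < R (contract x y a z))%N then
       arc_weight (s z) (s (contract x y a z)) else 1).
    rewrite (bigD1 x) //= (bigD1 y) ?yA //= axy ayx ltxy ltnNge ltnW //= mul1r.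
    rewrite gx gy; congr (_ * _); apply: eq_big => z.
      by rewrite !inE negb_or; case: (z \in A); rewrite ?andbF ?andbT.
    case/andP=> /andP[_ zx] zy; rewrite (contract_loop pa) //.
    by rewrite !gz // (inv_eq aK) ?axy ?ayx.
  by rewrite !E /= /arc_weight /= expr1; ring.
have n' : a y != x by rewrite (inv_eq aK) eq_sym.
have ayax : a y != a x by rewrite (inj_eq (inv_inj aK)).
pose rest := \prod_(z in A | [&& z != x, z != y, z != a x & z != a y])
  (if (R z < R (a z))%N then arc_weight (s z) (s (a z)) else 1).
have El b : \prod_(z in A) (if (R z < R (a z))%N then
     arc_weight (glue_state x y b s z) (glue_state x y b s (a z)) else 1) =
   (if (R x < R (a x))%N then arc_weight (~~ b) (s (a x)) else 1) *
   (if (R y < R (a y))%N then arc_weight b (s (a y)) else 1) *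
   (if (R (a x) < R x)%N then arc_weight (s (a x)) (~~ b) else 1) *
   (if (R (a y) < R y)%N then arc_weight (s (a y)) b else 1) * rest.
  rewrite (bigD1 x) //= (bigD1 y) ?yA //= (bigD1 (a x)) ?Aa ?xA ?aF //=.
  rewrite (bigD1 (a y)) ?Aa ?yA ?n' ?aF //= !aK gx gy !gz // !mulrA.
  congr (_ * _); apply: eq_big => z; first by rewrite -!andbA.
  case/andP=> /andP[/andP[/andP[_ zx] zy] zax] zay.
  by rewrite !gz // (inv_eq aK).
have Er : \prod_(z in [predD A & pred2 x y]) (if (R z < R (contract x y a z))%N
     then arc_weight (s z) (s (contract x y a z)) else 1) =
   (if (R (a x) < R (a y))%N then arc_weight (s (a x)) (s (a y)) else 1) *
   (if (R (a y) < R (a x))%N then arc_weight (s (a y)) (s (a x)) else 1) * rest.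
  rewrite (bigD1 (a x)) ?inE ?negb_or ?Aa ?xA ?aF ?n //=.
  rewrite (bigD1 (a y)) ?inE ?negb_or ?Aa ?yA ?aF ?n' ?ayax //=.
  rewrite (contract_ax pa) // (contract_ay pa ltxy) // !mulrA.
  congr (_ * _); apply: eq_big => z.
    by rewrite !inE !negb_or; case: (z \in A); rewrite /= ?andbF //= -!andbA.
  rewrite !inE !negb_or => /andP[/andP[/andP[/andP[zx zy] _] zax] zay].
  by rewrite contract_other.
rewrite Er !El expr0 mul1r [LHS](_ : _ = 
   (- q * ((if (R x < R (a x))%N then arc_weight false (s (a x)) else 1) *
   (if (R y < R (a y))%N then arc_weight true (s (a y)) else 1) *
   (if (R (a x) < R x)%N then arc_weight (s (a x)) false else 1) *
   (if (R (a y) < R y)%N then arc_weight (s (a y)) true else 1)) +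
  ((if (R x < R (a x))%N then arc_weight true (s (a x)) else 1) *
   (if (R y < R (a y))%N then arc_weight false (s (a y)) else 1) *
   (if (R (a x) < R x)%N then arc_weight (s (a x)) true else 1) *
   (if (R (a y) < R y)%N then arc_weight (s (a y)) false else 1))) * rest); last first.
  by rewrite /=; ring.
congr (_ * _).
have lt u v : (R u < R v)%N -> ((R u < R v)%N = true) * ((R v < R u)%N = false).
  by move=> uv; split=> //; rewrite ltnNge ltnW.
have [|[]|[]] := glued_ends injR pa ltxy stable_between n.
- case=> l1 l2; have l3 : (R (a x) < R (a y))%N by lia.
  rewrite !(lt _ _ l1) !(lt _ _ l2) !(lt _ _ l3) /arc_weight;
  by case: (s (a x)); case: (s (a y)) => /=; field.
- move=> l1 l2; have l3 : (R (a y) < R y)%N by lia.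
  rewrite !(lt _ _ l1) !(lt _ _ l2) !(lt _ _ l3) /arc_weight;
  by case: (s (a x)); case: (s (a y)) => /=; field.
- move=> l1 l2; have l3 : (R x < R (a x))%N by lia.
  rewrite !(lt _ _ l1) !(lt _ _ l2) !(lt _ _ l3) /arc_weight;
  by case: (s (a x)); case: (s (a y)) => /=; field.
Qed.

End Step.
End ArcWeights.

(** * Contracting nested pairs *)

Section Iterate.

Variables (K : fieldType) (q : K).
Hypothesis q0 : q != 0.
Variables (X : finType) (R : X -> nat).
Hypothesis injR : injective R.

Fixpoint contract_all (L : seq (X * X)) (a : X -> X) : X -> X :=
  if L is (x, y) :: L' then contract_all L' (contract x y a) else a.

Fixpoint closed_loops (L : seq (X * X)) (a : X -> X) : nat :=
  if L is (x, y) :: L' then ((a x == y) + closed_loops L' (contract x y a))%N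
  else 0%N.

Fixpoint glue_sum (L : seq (X * X)) (G : (X -> bool) -> K) (s : X -> bool) : K :=
  if L is (x, y) :: L' then
    glue_sum L' (fun s' => \sum_(b : bool) (- q) ^+ b * G (glue_state x y b s')) s
  else G s.

(** The pairs are listed from the inside to the outside: each encloses exactly
    the dots used before, so that it is adjacent when its turn comes. *)
Fixpoint nested_pairs (D : {pred X}) (L : seq (X * X)) : Prop :=
  if L is (x, y) :: L' then
    [/\ (R x < R y)%N, forall z, (R x < R z < R y)%N = (z \in D)
      & nested_pairs [predU pred2 x y & D] L']
  else True.

Fixpoint used (D : {pred X}) (L : seq (X * X)) : {pred X} :=
  if L is (x, y) :: L' then used [predU pred2 x y & D] L' else D.

Lemma nested_endpoints D L : nested_pairs D L ->
  forall u, u \in D -> u \notin endpoints L.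
Proof.
elim: L D => [|[x y] L IH] D //= [lxy bD nL] u uD.
have := uD; rewrite -bD => ruD.
have ux : u != x by apply: contraTneq ruD => ->; rewrite ltnn.
have uy : u != y by apply: contraTneq ruD => ->; rewrite ltnn andbF.
have := IH _ nL u; rewrite !inE uD orbT => /(_ isT).
by rewrite /endpoints !(mem_cat, inE) /= !(mem_cat, inE, negb_or) ux uy.
Qed.

Lemma used_sub D L u : u \in D -> u \in used D L.
Proof. by elim: L D => [|[x y] L IH] D //= uD; apply: IH; rewrite !inE uD orbT. Qed.

Lemma used_endpoints D L u : (u \in used D L) = (u \in D) || (u \in endpoints L).
Proof.
elim: L D => [|[x y] L IH] D /=; first by rewrite orbF.
rewrite IH /endpoints /= !(mem_cat, inE) /=.
by do ![case: (_ \in _) | case: (_ == _)].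
Qed.

Variant iterate_spec (D : {pred X}) (L : seq (X * X)) (a : X -> X) : Prop :=
  IterateSpec of
      planar_involution R (contract_all L a)
    & forall z, (contract_all L a z \in used D L) = (z \in used D L)
    & forall u v, u \notin used D L -> v \notin used D L ->
        connect (glue_edge a L) u v = (v == u) || (v == contract_all L a u)
    & loop_count a L D [predC used D L] = closed_loops L a
    & forall s, glue_sum L (weight q R [predC D] a) s =
        (- q - q^-1) ^+ closed_loops L a *
        weight q R [predC used D L] (contract_all L a) s.

Lemma eq_glue_sum L G G' s : G =1 G' -> glue_sum L G s = glue_sum L G' s.
Proof.
elim: L G G' s => [|[x y] L IH] G G' s E //=; apply: IH => s'.
by apply: eq_bigr => b _; rewrite E.
Qed.

Lemma glue_sumZ L c G s : glue_sum L (fun s' => c * G s') s = c * glue_sum L G s.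
Proof.
elim: L G s => [|[x y] L IH] G s //=; rewrite -IH; apply: eq_glue_sum => s'.
by rewrite mulr_sumr; apply: eq_bigr => b _; rewrite mulrCA.
Qed.

(** Once everything is contracted, the dots left outside are joined by arcs only,
    and these are the components of the glued graph that were not loops. *)
Lemma iterateP D L a : planar_involution R a ->
  (forall z, (a z \in D) = (z \in D)) -> nested_pairs D L -> iterate_spec D L a.
Proof.
elim: L D a => [|[x y] L IH] D a pa Da /=.
  move=> _; split=> //= [u v _ _||s]; last by rewrite expr0 mul1r.
    have cl : closed (glue_edge a [::]) (pred2 u (a u)).
      move=> z w; rewrite /glue_edge !in_nil !orbF => /eqP->; rewrite !inE.
      by rewrite !(inv_eq (planar_invol pa)) (planar_invol pa) orbC.
    apply/idP/idP => [uv|/pred2P[]->]; last 2 first.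
    - exact: connect0.
    - by apply: connect1; rewrite /glue_edge eqxx.
    by have := closed_connect cl uv; rewrite !inE eqxx => <-.
  apply: eq_card0 => z; rewrite !inE; have [//|zD] := boolP (z \in D).
    by rewrite andbF.
  rewrite andbC /=; apply/negbTE; rewrite negb_and; rewrite negbK; apply/orP; left; rewrite ?negbK.
  by apply/existsP; exists z; rewrite inE /= zD connect0.
move=> nL; have /= [lxy bD nL'] := nL.
have aK := planar_invol pa; have aF := planar_fixfree pa.
have st z : (R x < R z < R y)%N -> (R x < R (a z) < R y)%N by rewrite !bD Da.
have pa' := contract_planar injR pa lxy st.
have xD : x \notin D by rewrite -bD ltnn.
have yD : y \notin D by rewrite -bD ltnn andbF.
have xy : x != y by apply: contraTneq lxy => ->; rewrite ltnn.
have xE : x \notin endpoints L by apply: (nested_endpoints nL'); rewrite !inE eqxx.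
have yE : y \notin endpoints L.
  by apply: (nested_endpoints nL'); rewrite !inE eqxx orbT.
have Da' z : (contract x y a z \in [predU pred2 x y & D]) =
             (z \in [predU pred2 x y & D]).
  have a'K := planar_invol pa'; have a'x : contract x y a x = y by apply: contract_x.
  have a'y : contract x y a y = x by rewrite (contract_y _ lxy).
  rewrite !inE !(inv_eq a'K) a'x a'y [(z == y) || _]orbC.
  have [//|] := boolP ((z == x) || (z == y)); rewrite negb_or => /andP[zx zy] /=.
  rewrite /contract (negPf zx) (negPf zy).
  by case: eqP => [->|_]; last case: eqP => [->|_]; rewrite !Da ?(negPf xD) ?(negPf yD).
have [p1 p2 p3 p4 p5] := IH _ _ pa' Da' nL'.
have xu : x \in used [predU pred2 x y & D] L by apply: used_sub; rewrite !inE eqxx.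
have yu : y \in used [predU pred2 x y & D] L.
  by apply: used_sub; rewrite !inE eqxx orbT.
split=> //= [u v uU vU||s].
- rewrite -p3 //; apply: (connect_contract_alive aK (planar_invol pa')) => //.
  + by apply: contraNneq uU => ->.
  + by apply: contraNneq uU => ->.
  + by apply: contraNneq vU => ->.
  + by apply: contraNneq vU => ->.
- rewrite (loop_count_step aK (planar_invol pa')) ?p4 //.
  + move=> u v uvL; have nE := nested_endpoints nL'.
    have uE : u \in endpoints L.
      by rewrite mem_cat; apply/orP; left; apply/mapP; exists (u, v).
    have vE : v \in endpoints L.
      by rewrite mem_cat; apply/orP; right; apply/mapP; exists (u, v).
    apply/andP; split; [apply: contraL uE|apply: contraL vE] => uD;
    by apply: nE; rewrite !inE uD orbT.
  + by rewrite !inE negbK.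
  + by rewrite !inE negbK.
rewrite exprD -mulrA -p5 -glue_sumZ; apply: eq_glue_sum => s'.
rewrite (weight_contract q0 injR) ?inE //; last by move=> z; rewrite !inE Da.
congr (_ * _); apply: eq_bigl => z; rewrite !inE !negb_or.
by rewrite -!andbA.
Qed.

End Iterate.

(** * The composite of two diagrams *)

Lemma rank_inj i j : injective (@rank i j).
Proof.
move=> [a|b] [a'|b'] /=; have /= := ltn_ord; move=> lt.
- by move/val_inj->.
- by move=> E; have := lt _ a; lia.
- by move=> E; have := lt _ a'; lia.
move=> E; congr inr; apply/val_inj; move: (lt _ b) (lt _ b') E => /=; lia.
Qed.

Lemma planarP i j (p : pairing i j) :
  reflect (planar_involution (@rank i j) p) (planar p).
Proof.
apply: (iffP and3P) => [[/forallP pF /forallP pK /forallP pN]|pp].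
  have pK' : involutive p by move=> z; apply/eqP.
  have nq (u v : dots i j) : u != v -> rank u != rank v by rewrite (inj_eq (@rank_inj i j)).
  split=> // z u /andP[zu uz].
  have n1 : rank u != rank z by rewrite neq_ltn zu orbT.
  have n2 : u != z by apply: contraNneq n1 => ->.
  have n3 : rank (p u) != rank (p z) by apply: nq; rewrite (inj_eq (inv_inj pK')).
  have n4 : rank (p u) != rank z.
    by apply: nq; rewrite (inv_eq pK'); apply: contraTneq uz => ->; rewrite ltnn.
  have := forallP (pN z) u; rewrite zu uz /= -leqNgt => h1.
  have := forallP (pN (p u)) z; rewrite pK' zu uz /= => h2.
  rewrite andbT -leqNgt in h2; by rewrite !ltn_neqAle eq_sym n4 n3 h1 h2.
split; first by apply/forallP => z; apply: planar_fixfree pp z.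
  by apply/forallP => z; apply/eqP; apply: planar_invol pp z.
apply/forallP => z; apply/forallP => u; apply/negP => /and3P[zu uz c].
have := @planar_nested _ _ _ pp z u; rewrite zu uz => /(_ isT).
lia.
Qed.

(** A list, and not a type of tuples: words of different lengths are compared,
    split and concatenated throughout. *)
Fixpoint words (n : nat) : seq (seq bool) :=
  if n is n'.+1 then map (cons true) (words n') ++ map (cons false) (words n')
  else [:: [::]].

Lemma mem_words n u : (u \in words n) = (size u == n).
Proof.
elim: n u => [|n IH] [|b u] //=; rewrite mem_cat.
  by apply/negbTE; rewrite negb_or; apply/andP; split; apply/mapP => -[].
rewrite eqSS -IH; apply/orP/idP => [[]/mapP[v vn [_ ->]]//|un].
by case: b; [left|right]; apply: map_f.
Qed.

Lemma words_uniq n : uniq (words n).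
Proof.
elim: n => //= n IH; have inj b : injective (cons b : seq bool -> _).
  by move=> u v [].
rewrite cat_uniq !map_inj_uniq // IH andbT /=.
by apply/hasPn => u /mapP[v _ ->]; apply/mapP => -[].
Qed.

Section WordSums.
Variable K : fieldType.

Lemma sum_words0 (F : seq bool -> K) : \sum_(u <- words 0) F u = F [::].
Proof. by rewrite big_seq1. Qed.

Lemma sum_wordsS n (F : seq bool -> K) :
  \sum_(u <- words n.+1) F u = \sum_(u <- words n) \sum_(b : bool) F (b :: u).
Proof.
by rewrite big_cat /= !big_map -big_split; apply: eq_bigr => u _; rewrite big_bool.
Qed.

Lemma eq_words n (F G : seq bool -> K) :
  (forall u, size u = n -> F u = G u) ->
  \sum_(u <- words n) F u = \sum_(u <- words n) G u.
Proof.
move=> E; rewrite big_seq [RHS]big_seq; apply: eq_bigr => u.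
by rewrite mem_words => /eqP/E.
Qed.

Lemma sum_words_cat m n (F : seq bool -> K) :
  \sum_(u <- words (m + n)) F u =
  \sum_(u <- words m) \sum_(v <- words n) F (u ++ v).
Proof.
elim: m F => [|m IH] F; first by rewrite sum_words0.
rewrite addSn !sum_wordsS IH; apply: eq_bigr => u _.
by rewrite exchange_big.
Qed.

End WordSums.

Section Stack.

Variables (K : fieldType) (q : K).
Hypothesis q0 : q != 0.

Section GlueStates.
Variable X : finType.

Fixpoint glue_states (L : seq (X * X)) (u : seq bool) (s : X -> bool) : X -> bool :=
  match L, u with
  | (x, y) :: L', b :: u' => glue_state x y b (glue_states L' u' s)
  | _, _ => s
  end.

Lemma glue_sumE L G s : glue_sum q L G s =
  \sum_(u <- words (size L)) (- q) ^+ count id u * G (glue_states L u s).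
Proof.
elim: L G => [|[x y] L IH] G; first by rewrite sum_words0 /= expr0 mul1r.
rewrite sum_wordsS /= IH; apply: eq_bigr => u _; rewrite mulr_sumr.
by apply: eq_bigr => b _ /=; rewrite exprD mulrCA mulrA.
Qed.
End GlueStates.

Variables (i j m : nat).

(** Composing two diagrams glues the upper line of the lower one to the lower line
    of the upper one. Here the two copies of a middle dot are kept apart, as a
    pair to be contracted. *)
Definition half_dots : finType := (dots i j + dots j m)%type.

Definition half_rank (x : half_dots) : nat :=
  match x with inl u => rank u | inr v => (i + j + rank v)%N end.

Definition half_pairing (p2 : pairing j m) (p1 : pairing i j) (x : half_dots) :
    half_dots :=
  match x with inl u => inl (p1 u) | inr v => inr (p2 v) end.

Definition glued_pair (b : 'I_j) : half_dots * half_dots :=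
  (inl (inr b), inr (inl b)).

Definition glued_pairs : seq (half_dots * half_dots) := map glued_pair (enum 'I_j).

Definition outer (z : dots i m) : half_dots :=
  match z with inl a => inl (inl a) | inr c => inr (inr c) end.

Definition unouter (x : half_dots) : option (dots i m) :=
  match x with
  | inl (inl a) => Some (inl a) | inr (inr c) => Some (inr c) | _ => None
  end.

Lemma half_rank_inj : injective half_rank.
Proof.
move=> [u|v] [u'|v'] /=.
- by move/rank_inj->.
- by case: u => [a|b] /=; [move: (ltn_ord a)|move: (ltn_ord b)] => /=; lia.
- by case: u' => [a|b] /=; [move: (ltn_ord a)|move: (ltn_ord b)] => /=; lia.
by move/addnI/rank_inj->.
Qed.

Lemma half_planar p2 p1 : planar p2 -> planar p1 ->
  planar_involution half_rank (half_pairing p2 p1).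
Proof.
move=> /planarP pp2 /planarP pp1; split=> [[u|v]|[u|v]|] /=.
- exact: planar_fixfree pp1 u.
- exact: planar_fixfree pp2 v.
- by rewrite (planar_invol pp1).
- by rewrite (planar_invol pp2).
have lt (u : dots i j) : (rank u < i + j)%N.
  by case: u => [a|b] /=; [have := ltn_ord a|have := ltn_ord b]; lia.
move=> [u|v] [u'|v'] /=.
- exact: planar_nested pp1 u u'.
- case/andP=> _ h; have := leq_ltn_trans (leq_addr _ _) (ltn_trans h (lt _)).
  by rewrite ltnn.
- case/andP=> h _; have := leq_ltn_trans (leq_addr _ _) (ltn_trans h (lt _)).
  by rewrite ltnn.
by rewrite !ltn_add2l; exact: planar_nested pp2 v v'.
Qed.

Definition inner_below (k : nat) : pred half_dots := fun z =>
  match z with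
  | inl (inr c) => (c < k)%N | inr (inl c) => (c < k)%N | _ => false
  end.

(** The boundary of the first diagram ends with its upper line, from right to left,
    and that of the second one begins with its lower line, from left to right;
    so the copies of the leftmost middle dot are adjacent, and so on. *)
Lemma glued_nested : nested_pairs half_rank pred0 glued_pairs.
Proof.
rewrite /glued_pairs -[enum _]drop0.
have : (forall n k, k + n = j -> forall D : {pred half_dots}, D =i inner_below k ->
  nested_pairs half_rank D [seq glued_pair b | b <- drop k (enum 'I_j)])%N.
  elim=> [|n IH] k kn D Dk.
    by rewrite drop_oversize // size_enum_ord -kn addn0.
  have kj : (k < j)%N by rewrite -kn addnS ltnS leq_addr.
  rewrite (drop_nth (Ordinal kj)) ?size_enum_ord //= nth_enum_ord //.
  split=> [|z|].
  - lia.
  - rewrite Dk unfold_in /=; move: z => [[a|b]|[b|c]] /=; rewrite ?nth_enum_ord //.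
    + by have := ltn_ord a; lia.
    + by have := ltn_ord b; lia.
    + by have := ltn_ord b; lia.
    + by have := ltn_ord c; lia.
  apply: IH; first by rewrite addSn -addnS.
  move=> z; rewrite !inE Dk !unfold_in /=.
  have E (b : 'I_j) : (b == nth (Ordinal kj) (enum 'I_j) k) = (b == k :> nat).
    by rewrite -val_eqE /= nth_enum_ord.
  move: z => [[a|b]|[b|c]] //=; rewrite ?orbF ltnS [RHS]leq_eqVlt;
    by congr (_ || _); exact: E.
by apply=> // z; move: z => [[a|b]|[b|c]].
Qed.

Lemma mem_endpoints x : (x \in endpoints glued_pairs) = ~~ unouter x.
Proof.
rewrite mem_cat -!map_comp; apply/orP/idP => [[]/mapP[b _ ->]//|].
case: x => [[a|b]|[b|c]] //= _; [left|right]; apply/mapP; exists b => //;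
  by rewrite -enumT mem_enum.
Qed.

Lemma mem_used x : (x \in used pred0 glued_pairs) = ~~ unouter x.
Proof. by rewrite used_endpoints mem_endpoints. Qed.

Lemma outerK : pcancel outer unouter.
Proof. by case. Qed.

Lemma unouterK x : unouter x -> exists z, x = outer z.
Proof.
by case: x => [[a|b]|[b|c]] //= _; [exists (inl a) | exists (inr c)].
Qed.

Definition half_proj (x : half_dots) : stack_dots i j m :=
  match x with inl u => stack_low m u | inr v => stack_up i v end.

Definition half_lift (v : stack_dots i j m) : half_dots :=
  match v with
  | inl (inl a) => inl (inl a) | inl (inr b) => inl (inr b) | inr c => inr (inr c)
  end.

Lemma half_liftK : cancel half_lift half_proj.
Proof. by case=> [[a|b]|c]. Qed.

Lemma half_proj_outer z : half_proj (outer z) = stack_outer j z.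
Proof. by case: z. Qed.

Section Concat.

Variables (p2 : pairing j m) (p1 : pairing i j).
Hypotheses (pl2 : planar p2) (pl1 : planar p1).

Local Notation hp := (half_pairing p2 p1).
Local Notation L := glued_pairs.

Lemma half_iterate : iterate_spec q half_rank pred0 L hp.
Proof.
apply: (iterateP q0 half_rank_inj) => //; first exact: half_planar.
exact: glued_nested.
Qed.

Lemma stack_edgeP u v :
  reflect (exists2 x, u = half_proj x & v = half_proj (hp x)) (stack_edge p2 p1 u v).
Proof.
apply: (iffP orP).
  by case=> /existsP[x /andP[/eqP-> /eqP->]]; [exists (inl x) | exists (inr x)].
case=> -[x|x] /= -> ->; [left|right]; apply/existsP; exists x; by rewrite !eqxx.
Qed.

Lemma half_connect_sym : connect_sym (glue_edge hp L).
Proof. exact/glue_connect_sym/(planar_invol (half_planar pl2 pl1)). Qed.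

Lemma stack_connect_sym : connect_sym (stack_edge p2 p1).
Proof.
apply/sym_connect_sym => u v; have hK := planar_invol (half_planar pl2 pl1).
by apply/stack_edgeP/stack_edgeP => -[x -> ->]; exists (hp x); rewrite ?hK.
Qed.

Lemma stack_connect x y :
  connect (stack_edge p2 p1) (half_proj x) (half_proj y) = connect (glue_edge hp L) x y.
Proof.
apply/idP/idP; last first.
  apply: connect_map => {}x {}y /orP[/eqP->|H].
    by apply: connect1; apply/stack_edgeP; exists x.
  suff -> : half_proj x = half_proj y by exact: connect0.
  by case/orP: H => /mapP[b _ [-> ->]].
have lx z : connect (glue_edge hp L) (half_lift (half_proj z)) z.
  case: z => [[a|b]|[b|c]] /=; try exact: connect0.
  apply: connect1; apply/or3P/Or32; apply: (map_f glued_pair).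
  by rewrite mem_enum.
have sym := half_connect_sym.
move=> H; have : connect (glue_edge hp L) (half_lift (half_proj x)) (half_lift (half_proj y)).
  apply: connect_map H => u v /stack_edgeP[z -> ->].
  apply: connect_trans (lx _) _; rewrite sym; apply: connect_trans (lx _) _.
  by rewrite sym; apply: connect1; rewrite /glue_edge eqxx.
move=> H'; apply: connect_trans (connect_trans _ H') (lx y); by rewrite sym.
Qed.

(** The contraction finds the other end of each path, as concat does by searching
    for a connected dot. *)
Lemma outer_concat z : outer (concat p2 p1 z) = contract_all L hp (outer z).
Proof.
have [pp st co _ _] := half_iterate.
have no t : outer t \notin used pred0 L by rewrite mem_used negbK outerK.
have [t Et] : exists t, contract_all L hp (outer z) = outer t.
  by apply: unouterK; rewrite -[isSome _]negbK -mem_used st no.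
have tz : t != z.
  by apply/eqP => E; have := planar_fixfree pp (outer z); rewrite Et E eqxx.
rewrite ffunE; case: pickP => [t'|/(_ t)].
  rewrite -!half_proj_outer stack_connect co //= Et => /andP[t'z].
  by rewrite !(inj_eq (pcan_inj outerK)) (negPf t'z) => /eqP->.
by rewrite -!half_proj_outer stack_connect co // Et eqxx orbT tz.
Qed.

Lemma rank_outer (u v : dots i m) :
  (half_rank (outer u) < half_rank (outer v))%N = (rank u < rank v)%N.
Proof.
case: u => [a|c]; case: v => [a'|c'] //=; move: ltn_ord => lt.
- by have := lt _ a; have := lt _ c'; lia.
- by have := lt _ a'; have := lt _ c; lia.
by lia.
Qed.

Lemma concat_planar : planar (concat p2 p1).
Proof.
have [pp _ _ _ _] := half_iterate; have oI := pcan_inj outerK.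
apply/planarP; split=> [z|z|z u].
- by rewrite -(inj_eq oI) outer_concat (planar_fixfree pp).
- by apply: oI; rewrite !outer_concat (planar_invol pp).
by rewrite -!rank_outer !outer_concat; exact: planar_nested.
Qed.

Lemma loopsE : loops p2 p1 = closed_loops L hp.
Proof.
have [_ _ _ <- _] := half_iterate; rewrite /loops /loop_count.
have sym := half_connect_sym; have sym' := stack_connect_sym.
set a := [pred u | _].
have cla : closed (stack_edge p2 p1) a.
  apply: intro_closed => // u v uv; apply: contra => /existsP[z vz].
  apply/existsP; exists z; exact: connect_trans (connect1 uv) vz.
rewrite (adjunction_n_comp half_proj sym' sym cla); last first.
  split=> [u _|x y _]; last by rewrite stack_connect.
  by exists (half_lift u); rewrite half_liftK.
apply: eq_n_comp_r => x; rewrite !inE /=; congr (~~ _).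
apply/existsP/existsP => [[z]|[y /andP[yO]]].
  rewrite -half_proj_outer stack_connect => xz; exists (outer z).
  by rewrite xz inE /= mem_used outerK.
move: yO; rewrite inE /= mem_used negbK => /unouterK[z ->].
by rewrite -stack_connect half_proj_outer; exists z.
Qed.

Lemma weight_concat s :
  weight q half_rank [predC used pred0 L] (contract_all L hp) s =
  weight q (@rank i m) predT (concat p2 p1) (s \o outer).
Proof.
rewrite /weight (reindex_omap outer unouter) => [|x].
  apply: eq_big => [z|z _]; first by rewrite outerK eqxx !inE mem_used outerK.
  by rewrite -outer_concat rank_outer.
by rewrite inE /= mem_used negbK => /unouterK[z ->]; rewrite outerK.
Qed.

End Concat.
End Stack.

(** * The representation on words *)

Section Representation.

Variables (K : fieldType) (q : K).
Hypothesis q0 : q != 0.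

Local Notation delta := (- q - q^-1).

(** The letters of the upper word are negated, because the weight of a pairing
    treats all its arcs as caps on one line. *)
Definition dot_state (i j : nat) (s t : seq bool) (x : dots i j) : bool :=
  match x with inl a => nth false s a | inr b => ~~ nth false t b end.

(** Bending the upper dots down is compensated by the power of -q. *)
Definition pairing_entry (i j : nat) (p : pairing i j) (s t : seq bool) : K :=
  (- q) ^+ count id t * weight q (@rank i j) predT p (dot_state s t).

Definition state_sum (i j : nat) (f : TLhom K i j) (s t : seq bool) : K :=
  if (size s == i) && (size t == j) then
    \sum_d f d * pairing_entry (val d) s t
  else 0.

Lemma eq_weight (X : finType) (R : X -> nat) (A : {pred X}) a s s' :
  s =1 s' -> weight q R A a s = weight q R A a s'.
Proof. by move=> E; apply: eq_bigr => z _; rewrite !E. Qed.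

Section Concat.
Variables (i j m : nat) (p2 : pairing j m) (p1 : pairing i j).
Hypotheses (pl2 : planar p2) (pl1 : planar p1).

Lemma glue_states_inl (bs : seq 'I_j) u s b : size u = size bs ->
  glue_states (map (glued_pair i m) bs) u s (inl (inr b)) =
  if b \in bs then ~~ nth false u (index b bs) else s (inl (inr b)).
Proof.
elim: bs u => [|c bs IH] [|w u] //= [su]; rewrite /glue_state inE.
rewrite [inl _ == inl _](_ : _ = (b == c)) // eq_sym.
by have [_|cb] := eqVneq c b; rewrite /= ?IH.
Qed.

Lemma glue_states_inr (bs : seq 'I_j) u s b : size u = size bs ->
  glue_states (map (glued_pair i m) bs) u s (inr (inl b)) =
  if b \in bs then nth false u (index b bs) else s (inr (inl b)).
Proof.
elim: bs u => [|c bs IH] [|w u] //= [su]; rewrite /glue_state inE.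
rewrite /= [inr _ == inr _](_ : _ = (b == c)) // eq_sym.
by have [_|cb] := eqVneq c b; rewrite /= ?IH.
Qed.

Lemma glue_states_outer (bs : seq 'I_j) u s z :
  glue_states (map (glued_pair i m) bs) u s (outer j z) = s (outer j z).
Proof.
by elim: bs u => [|c bs IH] [|w u] //=; rewrite /glue_state; case: z IH => ? /= ->.
Qed.

(** The words u on the middle line are the states of the pairs to be contracted;
    each letter true of u has the weight -q of the cup glued in. *)
Lemma entry_concat s t :
  delta ^+ loops p2 p1 * pairing_entry (concat p2 p1) s t =
  \sum_(u <- words j) pairing_entry p1 s u * pairing_entry p2 u t.
Proof.
pose s0 (x : half_dots i j m) : bool :=
  if unouter x is Some z then dot_state s t z else false.
have [_ _ _ _ /(_ s0)] := half_iterate q0 pl2 pl1.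
rewrite (weight_concat q0) // -(loopsE q0) // glue_sumE size_map size_enum_ord => E.
rewrite /pairing_entry mulrCA (eq_weight _ _ _ (s' := s0 \o @outer i j m)); last first.
  by move=> z /=; rewrite /s0 outerK.
rewrite -E mulr_sumr; apply: eq_words => u su.
rewrite [RHS]mulrACA [_ ^+ count id u * _ ^+ count id t]mulrC -[RHS]mulrA; congr (_ * (_ * _)).
rewrite /weight big_sumType /=; congr (_ * _); apply: eq_big => // z _.
  suff E' x : glue_states (glued_pairs i j m) u s0 (inl x) =
    dot_state s u x by rewrite !E'.
  case: x => [a|b]; first exact: (glue_states_outer _ _ _ (inl a)).
  by rewrite glue_states_inl ?size_enum_ord // mem_enum index_enum_ord.
rewrite ltn_add2l; suff E' x : glue_states (glued_pairs i j m) u s0 (inr x) =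
  dot_state u t x by rewrite !E'.
case: x => [b|c]; last exact: (glue_states_outer _ _ _ (inr c)).
by rewrite glue_states_inr ?size_enum_ord // mem_enum index_enum_ord.
Qed.

End Concat.

Lemma rep_dvec i j (p : pairing i j) s t : planar p ->
  size s = i -> size t = j -> state_sum (dvec K p) s t = pairing_entry p s t.
Proof.
move=> pl si tj; rewrite /state_sum si tj !eqxx (bigD1 (Sub p pl)) //= big1 ?addr0.
  by rewrite ffunE eqxx mul1r.
move=> d dp; rewrite ffunE (_ : _ == p = false) ?mul0r //.
by apply: contraNF dp => /eqP dE; apply/eqP/val_inj.
Qed.

Lemma rep_size i j (f : TLhom K i j) s t :
  ~~ ((size s == i) && (size t == j)) -> state_sum f s t = 0.
Proof. by rewrite /state_sum => /negPf->. Qed.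

Lemma repD i j (f g : TLhom K i j) s t : state_sum (f + g) s t = state_sum f s t + state_sum g s t.
Proof.
rewrite /state_sum; case: ifP => _; rewrite ?addr0 // -big_split; apply: eq_bigr => d _.
by rewrite ffunE mulrDl.
Qed.

Lemma repZ i j c (f : TLhom K i j) s t : state_sum (c *: f) s t = c * state_sum f s t.
Proof.
rewrite /state_sum; case: ifP => _; rewrite ?mulr0 // mulr_sumr; apply: eq_bigr => d _.
by rewrite ffunE [RHS]mulrA.
Qed.

Lemma rep0 i j s t : state_sum (0 : TLhom K i j) s t = 0.
Proof. by rewrite -(scale0r 0) repZ mul0r. Qed.

Lemma rep_sum i j (I : Type) (r : seq I) (P : pred I) (f : I -> TLhom K i j) s t :
  state_sum (\sum_(x <- r | P x) f x) s t = \sum_(x <- r | P x) state_sum (f x) s t.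
Proof. by apply: (big_morph (fun f => state_sum f s t)) => [f1 f2|]; rewrite ?repD ?rep0. Qed.

Lemma rep_comp i j m (g : TLhom K j m) (f : TLhom K i j) s t :
  state_sum (compT delta g f) s t = \sum_(u <- words j) state_sum f s u * state_sum g u t.
Proof.
have [/andP[/eqP si /eqP tm]|nst] := boolP ((size s == i) && (size t == m)); last first.
  rewrite rep_size // big1 // => u _; move: nst; rewrite negb_and.
  by case/orP=> h; [rewrite (rep_size f)|rewrite (rep_size g)];
    rewrite ?mul0r ?mulr0 // negb_and h ?orbT.
have E d1 d2 : state_sum ((g d2 * f d1 * delta ^+ loops (val d2) (val d1))
      *: dvec K (concat (val d2) (val d1))) s t =
    \sum_(u <- words j) (g d2 * f d1) *
      (pairing_entry (val d1) s u * pairing_entry (val d2) u t).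
  rewrite repZ rep_dvec // ?(concat_planar q0) ?(valP d1) ?(valP d2) //.
  rewrite -[LHS]mulrA entry_concat ?(valP d1) ?(valP d2) // mulr_sumr.
  by [].
rewrite /compT rep_sum.
under eq_bigr do rewrite rep_sum; under eq_bigr do under eq_bigr do rewrite E.
under eq_bigr do rewrite exchange_big.
rewrite exchange_big; apply: eq_words => u su.
rewrite /state_sum si su tm !eqxx /= mulr_suml; apply: eq_bigr => d1 _.
by rewrite mulr_sumr; apply: eq_bigr => d2 _; ring.
Qed.

End Representation.

(** * Faithfulness *)

Section Openers.
Variables (X : finType) (R : X -> nat).
Hypothesis injR : injective R.

(** If the arc of a at x is shorter than that of b, the b-arc at its end starts
    inside it, where again the a-arc is shorter: infinite descent. *)
Lemma openers_no_shorter (a b : X -> X) :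
    planar_involution R a -> planar_involution R b ->
    (forall x, (R x < R (a x))%N = (R x < R (b x))%N) ->
  forall x, ~~ (R x < R (a x) < R (b x))%N.
Proof.
move=> pa pb ab x; move: {2}(R (a x)).+1 (ltnSn (R (a x))) => n.
elim: n x => // n IH x axn; apply/negP => /andP[xa axb].
have aK := planar_invol pa; have bK := planar_invol pb.
have := @planar_nested _ _ _ pb x (a x); rewrite xa axb => /(_ isT) /andP[xy yb].
have yay : ~~ (R (a x) < R (b (a x)))%N by rewrite -ab aK -leqNgt ltnW.
have nby : R (b (a x)) != R (a x) by rewrite (inj_eq injR) (planar_fixfree pb).
have byy : (R (b (a x)) < R (a x))%N by rewrite ltn_neqAle nby leqNgt.
have o2 : (R (b (a x)) < R (a (b (a x))))%N by rewrite ab bK.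
have := @planar_nested _ _ _ pa x (b (a x)); rewrite xy byy => /(_ isT) /andP[_ lt2].
have bd : (R (a (b (a x))) < n)%N by apply: leq_trans lt2 _; rewrite -ltnS.
by have := IH _ bd; rewrite o2 bK lt2.
Qed.

Lemma openers_inj (a b : X -> X) :
    planar_involution R a -> planar_involution R b ->
    (forall x, (R x < R (a x))%N = (R x < R (b x))%N) -> a =1 b.
Proof.
move=> pa pb ab.
have E x : (R x < R (a x))%N -> a x = b x.
  move=> xa; have xb := xa; rewrite ab in xb; apply: injR; apply/eqP.
  have := openers_no_shorter pa pb ab x.
  have := openers_no_shorter pb pa (fun x => esym (ab x)) x.
  by rewrite xa xb /= -!leqNgt => h1 h2; rewrite eqn_leq h1 h2.
move=> x; have [/E//|] := ltnP (R x) (R (a x)).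
rewrite leq_eqVlt (inj_eq injR) (negPf (planar_fixfree pa _)) /= => ax.
have := E (a x); rewrite (planar_invol pa) => /(_ ax) {2}->.
by rewrite (planar_invol pb).
Qed.

Definition closer_sum (s : X -> bool) : nat := \sum_(x | s x) R x.

Definition closer (a : X -> X) (x : X) : bool := (R (a x) < R x)%N.

Lemma closerE a x : planar_involution R a -> closer a x = ~~ (R x < R (a x))%N.
Proof.
move=> pa; rewrite /closer -leqNgt [RHS]leq_eqVlt (inj_eq injR).
by rewrite (negPf (planar_fixfree pa _)).
Qed.

(** A state that differs at the two ends of each arc selects one end of each arc,
    and the right ends have the largest ranks. *)
Lemma closer_sum_leq a s : planar_involution R a ->
    (forall x, s (a x) = ~~ s x) ->
  (closer_sum s <= closer_sum (closer a) ?= iff [forall x, s x == closer a x])%N.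
Proof.
move=> pa sa; have aK := planar_invol pa; rewrite /closer_sum.
have cl x : closer a (a x) = ~~ closer a x.
  by rewrite [in RHS]closerE // negbK /closer aK.
rewrite (bigID (closer a)) /= [X in (_ + X)%N](reindex_inj (inv_inj aK)) /=.
rewrite [X in (_ + X)%N](eq_bigl (fun x => closer a x && ~~ s x)); last first.
  by move=> x; rewrite sa cl negbK andbC.
rewrite [X in (X + _)%N](eq_bigl (fun x => closer a x && s x)); last first.
  by move=> x; rewrite andbC.
rewrite 2!big_mkcondr -big_split /=.
have := @leqif_sum X (closer a) (fun x => s x)
  (fun x => (if s x then R x else 0) + (if ~~ s x then R (a x) else 0))%N R.
have -> : [forall x, s x == closer a x] = [forall (x | closer a x), s x].
  apply/forallP/forallP => H x; first by apply/implyP => cx; rewrite (eqP (H x)).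
  have [cx|cx] := boolP (closer a x); first by have /implyP/(_ cx)-> := H x.
  by have := H (a x); rewrite cl cx sa /= => /negbTE->.
apply=> x cx; case: (s x) => /=; rewrite ?addn0 ?add0n.
  exact/leqif_refl.
by split; [exact: ltnW | apply/negbTE; rewrite neq_ltn (cx : (_ < _)%N)].
Qed.

End Openers.

Section Faithful.

Variables (K : fieldType) (q : K).
Hypothesis q0 : q != 0.

Lemma weight_neq0 (X : finType) (R : X -> nat) (a : X -> X) s :
    injective R -> planar_involution R a ->
  weight q R predT a s != 0 <-> (forall x, s (a x) = ~~ s x).
Proof.
move=> injR pa; split.
  have H x : weight q R predT a s != 0 -> (R x < R (a x))%N -> s (a x) = ~~ s x.
    rewrite /weight (bigD1 x) //= => H lt; move: H; rewrite lt mulf_eq0 negb_or.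
    by case/andP; rewrite /arc_weight; case: (s x); case: (s (a x)); rewrite /= ?eqxx.
  move=> w x; have [/H->//|] := ltnP (R x) (R (a x)).
  rewrite leq_eqVlt (inj_eq injR) (negPf (planar_fixfree pa _)) /=.
  rewrite -{2}(planar_invol pa x) => /(H _ w); rewrite (planar_invol pa) => ->.
  by rewrite negbK.
move=> sa; apply/prodf_neq0 => x _; case: ifP => _; last exact: oner_neq0.
rewrite sa /arc_weight; case: (s x); rewrite /= ?oner_neq0 // oppr_eq0 invr_eq0 //.
Qed.

Definition low_word i j (s : dots i j -> bool) : seq bool :=
  [seq s (inl a) | a <- enum 'I_i].
Definition up_word i j (s : dots i j -> bool) : seq bool :=
  [seq ~~ s (inr b) | b <- enum 'I_j].

Lemma size_low_word i j (s : dots i j -> bool) : size (low_word s) = i.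
Proof. by rewrite size_map size_enum_ord. Qed.

Lemma size_up_word i j (s : dots i j -> bool) : size (up_word s) = j.
Proof. by rewrite size_map size_enum_ord. Qed.

Lemma dot_state_words i j (s : dots i j -> bool) :
  dot_state (low_word s) (up_word s) =1 s.
Proof.
by case=> [a|b] /=; [rewrite (nth_map a)|rewrite (nth_map b)];
  rewrite ?size_enum_ord // nth_ord_enum ?negbK.
Qed.

(** Among the diagrams in the support of f, take one with the largest sum of the
    ranks of its right ends. Its own state of right ends has weight zero on all
    the others. *)
Theorem rep_inj i j (f : TLhom K i j) : (forall s t, state_sum q f s t = 0) -> f = 0.
Proof.
move=> f0; apply/eqP; apply: contraT => nf.
have [d0 fd0] : exists d, f d != 0.
  apply/existsP; apply: contraNT nf; rewrite negb_exists => /forallP H.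
  by apply/eqP/ffunP => d; rewrite ffunE; apply/eqP; rewrite -[_ == _]negbK.
pose cs (d : diagram i j) := closer_sum (@rank i j) (closer (@rank i j) (val d)).
case: (@arg_maxnP _ d0 (fun d => f d != 0) cs fd0) => d fd max.
pose s := closer (@rank i j) (val d).
have := f0 (low_word s) (up_word s); rewrite /state_sum size_low_word size_up_word !eqxx /=.
have pd (e : diagram i j) : planar_involution (@rank i j) (val e) := elimT (planarP _) (valP e).
rewrite (bigD1 d) //= big1 => [|e ed]; last first.
  have [->|fe] := eqVneq (f e) 0; first by rewrite mul0r.
  apply/eqP; rewrite mulf_eq0 (negPf fe) /pairing_entry mulf_eq0 /=.
  apply/orP; right; rewrite (eq_weight _ _ _ _ (dot_state_words s)).
  apply: contraNT ed => /(weight_neq0 _ (@rank_inj i j) (pd e)) sa.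
  have [le iff] := closer_sum_leq (@rank_inj i j) (pd e) sa.
  have : closer_sum (@rank i j) s == closer_sum (@rank i j) (closer (@rank i j) (val e)).
    by rewrite eqn_leq le; exact: max.
  rewrite iff => /forallP H; apply/eqP/val_inj/ffunP.
  apply: (openers_inj (@rank_inj i j)) => // x.
  have /eqP := H x; rewrite /s.
  by rewrite !(closerE (@rank_inj i j)) // => /negb_inj ->.
rewrite addr0 => /eqP; rewrite mulf_eq0 (negPf fd) /pairing_entry mulf_eq0 /=.
rewrite expf_eq0 oppr_eq0 (negPf q0) andbF /= (eq_weight _ _ _ _ (dot_state_words s)).
suff: weight q (@rank i j) predT (val d) s != 0 by move/negPf->.
apply/(weight_neq0 _ (@rank_inj i j) (pd d)) => x.
by rewrite /s [RHS](f_equal negb (closerE (@rank_inj i j) _ (pd d))) negbK /closer (planar_invol (pd d)).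
Qed.

End Faithful.

(** * Tensor products, identities and duality *)

Section Juxtaposition.

Variables (i j i' j' : nat) (p : pairing i j) (p' : pairing i' j').

Local Notation jl := (@juxt_left i j i' j').
Local Notation jr := (@juxt_right i j i' j').

Lemma juxt_jl x : juxt p p' (jl x) = jl (p x).
Proof.
case: x => a; rewrite ffunE /=; case: splitP => b /= E.
- by congr (jl (p (inl _))); apply/val_inj.
- by have := ltn_ord a; lia.
- by congr (jl (p (inr _))); apply/val_inj.
by have := ltn_ord a; lia.
Qed.

Lemma juxt_jr x : juxt p p' (jr x) = jr (p' x).
Proof.
case: x => a; rewrite ffunE /=; case: splitP => b /= E.
- by have := ltn_ord b; lia.
- by congr (jr (p' (inl _))); apply/val_inj/eqP; rewrite -(eqn_add2l i) E.
- by have := ltn_ord b; lia.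
by congr (jr (p' (inr _))); apply/val_inj/eqP; rewrite -(eqn_add2l j) E.
Qed.

Variant juxt_spec : dots (i + i') (j + j') -> Prop :=
  | JuxtLeft x : juxt_spec (jl x)
  | JuxtRight x : juxt_spec (jr x).

Lemma juxtP z : juxt_spec z.
Proof.
case: z => a; case: (split_ordP a) => b ->.
- exact: (JuxtLeft (inl b)).
- exact: (JuxtRight (inl b)).
- exact: (JuxtLeft (inr b)).
exact: (JuxtRight (inr b)).
Qed.

Lemma rank_jr x : rank (jr x) = (i + rank x)%N.
Proof. by case: x => a //=; have := ltn_ord a; lia. Qed.

Lemma rank_jl x : rank (jl x) = (rank x + (i <= rank x) * (i' + j'))%N.
Proof. by case: x => a //=; have := ltn_ord a; [|case: (leqP i _)]; lia. Qed.

Lemma rank_bound (x : dots i' j') : (rank x < i' + j')%N.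
Proof. by case: x => a /=; have := ltn_ord a; lia. Qed.

Lemma ltn_jl x y : (rank (jl x) < rank (jl y))%N = (rank x < rank y)%N.
Proof. by rewrite !rank_jl; case: (leqP i); case: (leqP i); lia. Qed.

Lemma ltn_jr x y : (rank (jr x) < rank (jr y))%N = (rank x < rank y)%N.
Proof. by rewrite !rank_jr ltn_add2l. Qed.

(** The dots of the right factor fill an interval of the boundary order. *)
Lemma jl_outside x y y' :
  (rank (jl x) < rank (jr y))%N = (rank (jl x) < rank (jr y'))%N.
Proof.
rewrite !rank_jr rank_jl; have := rank_bound y; have := rank_bound y'.
by case: (leqP i); lia.
Qed.

Lemma jr_outside x y y' :
  (rank (jr y) < rank (jl x))%N = (rank (jr y') < rank (jl x))%N.
Proof.
rewrite !rank_jr rank_jl; have := rank_bound y; have := rank_bound y'.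
by case: (leqP i); lia.
Qed.

Lemma juxt_planar : planar p -> planar p' -> planar (juxt p p').
Proof.
move=> /planarP pp /planarP pp'; apply/planarP.
have K := planar_invol pp; have K' := planar_invol pp'.
have jlI : injective jl.
  by case=> a [b|b] // [E]; congr (_ _); apply: val_inj.
have jrI : injective jr.
  by case=> a [b|b] // [E]; congr (_ _); apply: val_inj; apply: addnI E.
split=> [z|z|z u].
- case: (juxtP z) => x; rewrite ?juxt_jl ?juxt_jr ?(inj_eq jlI) ?(inj_eq jrI).
    exact: planar_fixfree pp x.
  exact: planar_fixfree pp' x.
- by case: (juxtP z) => x; rewrite ?juxt_jl ?juxt_jr ?K ?K'.
case: (juxtP z) => x; case: (juxtP u) => y; rewrite ?juxt_jl ?juxt_jr ?ltn_jl ?ltn_jr.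
- exact: planar_nested.
- by rewrite (jl_outside _ _ (p' y)) (jr_outside _ _ (p' y)).
- rewrite (jr_outside _ _ (p' x)) => /andP[h1 h2].
  by have := ltn_trans h1 h2; rewrite ltnn.
exact: planar_nested.
Qed.

End Juxtaposition.

Lemma id_planar n : planar (id_pairing n).
Proof.
apply/planarP; split=> [[a|a]|[a|a]|[a|a] [b|b]]; rewrite ?ffunE //=.
all: by have := ltn_ord a; have := ltn_ord b; lia.
Qed.

Lemma nested_planar_low n : planar (nested (n + n) 0).
Proof.
apply/planarP; split=> [[a|[]//]|[a|[]//]|[a|[]//] [b|[]//]]; rewrite !ffunE /=.
- by apply/eqP => -[/(f_equal val)]; move: (ltn_ord a) => /=; lia.
- by rewrite rev_ordK.
by move: (ltn_ord a) (ltn_ord b) => /= la lb; lia.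
Qed.

Lemma nested_planar_up n : planar (nested 0 (n + n)).
Proof.
apply/planarP; split=> [[[]//|a]|[[]//|a]|[[]//|a] [[]//|b]]; rewrite !ffunE /=.
- by apply/eqP => -[/(f_equal val)]; move: (ltn_ord a) => /=; lia.
- by rewrite rev_ordK.
by move: (ltn_ord a) (ltn_ord b) => /= la lb; lia.
Qed.

Section RepTensor.

Variables (K : fieldType) (q : K).
Hypothesis q0 : q != 0.

Lemma entry_juxt i j i' j' (p : pairing i j) (p' : pairing i' j') s t :
    size s = (i + i')%N -> size t = (j + j')%N ->
  pairing_entry q (juxt p p') s t =
  pairing_entry q p (take i s) (take j t) * pairing_entry q p' (drop i s) (drop j t).
Proof.
move=> ss st; rewrite /pairing_entry -{1}(cat_take_drop j t) count_cat exprD.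
rewrite mulrACA; congr (_ * _).
have sl (x : dots i j) : dot_state s t (juxt_left i' j' x) = dot_state (take i s) (take j t) x.
  by case: x => a /=; rewrite nth_take.
have sr (x : dots i' j') : dot_state s t (juxt_right i j x) = dot_state (drop i s) (drop j t) x.
  by case: x => a /=; rewrite nth_drop.
have jl x : juxt p p' (juxt_left i' j' x) = juxt_left i' j' (p x) by exact: juxt_jl.
have jr x : juxt p p' (juxt_right i j x) = juxt_right i j (p' x) by exact: juxt_jr.
pose W k k' (r : pairing k k') v w x := if (rank x < rank (r x))%N
  then arc_weight q (dot_state v w x) (dot_state v w (r x)) else 1.
have El x : W _ _ (juxt p p') s t (juxt_left i' j' x) =
    W _ _ p (take i s) (take j t) x.
  by rewrite /W jl ltn_jl !sl.
have Er x : W _ _ (juxt p p') s t (juxt_right i j x) =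
    W _ _ p' (drop i s) (drop j t) x.
  by rewrite /W jr ltn_jr !sr.
rewrite /weight !big_sumType /= !big_split_ord /= mulrACA.
congr (_ * _ * (_ * _)); apply: eq_bigr => a _.
- exact: (El (inl a)).
- exact: (El (inr a)).
- exact: (Er (inl a)).
exact: (Er (inr a)).
Qed.

Lemma rep_tens i j i' j' (f : TLhom K i j) (g : TLhom K i' j') s t :
  state_sum q (tensT f g) s t =
  state_sum q f (take i s) (take j t) * state_sum q g (drop i s) (drop j t).
Proof.
have sz n n' (w : seq bool) :
    (size w == n + n')%N = (size (take n w) == n) && (size (drop n w) == n').
  rewrite size_take size_drop; case: ltnP => h; lia.
have [/andP[/eqP ss /eqP st]|nst] :=
    boolP ((size s == i + i') && (size t == j + j'))%N; last first.
  rewrite rep_size //; move: nst; rewrite !sz => nst.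
  have [h1|h1] := boolP ((size (take i s) == i) && (size (take j t) == j));
    last by rewrite (rep_size _ _ h1) ?mul0r.
  have [h2|h2] := boolP ((size (drop i s) == i') && (size (drop j t) == j'));
    last by rewrite (rep_size _ _ h2) ?mulr0.
  by case/andP: h1 nst => -> ->; case/andP: h2 => -> ->.
have := eqxx (size s); rewrite {2}ss sz => /andP[si si'].
have := eqxx (size t); rewrite {2}st sz => /andP[tj tj'].
rewrite /tensT rep_sum; under eq_bigr do rewrite rep_sum.
rewrite {2 3}/state_sum si si' tj tj' /= mulr_suml; apply: eq_bigr => d _.
rewrite mulr_sumr; apply: eq_bigr => e _.
rewrite repZ rep_dvec ?juxt_planar ?(valP d) ?(valP e) // entry_juxt //.
by rewrite mulrACA.
Qed.

Lemma rep_cast i j i' j' (ei : i = i') (ej : j = j') (f : TLhom K i j) s t :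
  state_sum q (castT ei ej f) s t = state_sum q f s t.
Proof. by case: i' / ei; case: j' / ej. Qed.

(** Serves for identities, and for nested arcs after dualizing a word. *)
Lemma prod_arc_weight n s t : size s = n -> size t = n ->
  \prod_(a < n) arc_weight q (nth false s a) (~~ nth false t a) =
  (s == t)%:R * (- q) ^- count id s.
Proof.
elim: n s t => [|n IH] [|b s] [|c t] //= => [_ _|[ss] [st]].
  by rewrite big_ord0 expr0 invr1 mulr1.
rewrite big_ord_recl /= IH // eqseq_cons mulrCA; case: eqP => _; rewrite ?andbF ?mul0r //.
case: b; case: c; rewrite /arc_weight /= ?mul0r ?mulr0 ?mul1r //.
by rewrite add1n exprS invfM invrN.
Qed.

Lemma rep_id n s t : state_sum q (idT K n) s t = ((size s == n) && (s == t))%:R.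
Proof.
have [/andP[/eqP ss /eqP st]|nst] := boolP ((size s == n) && (size t == n)); last first.
  rewrite rep_size //; case: eqP => //= ss; case: eqP => // E.
  by move: nst; rewrite -E ss eqxx.
rewrite rep_dvec ?id_planar // /pairing_entry /weight big_sumType /=.
rewrite [X in _ * (_ * X)]big1 => [|a _]; last first.
  by rewrite ffunE /= ltnNge (leq_trans (ltnW (ltn_ord a)) (leq_addr _ _)).
rewrite mulr1 (eq_bigr (fun a : 'I_n =>
    arc_weight q (nth false s a) (~~ nth false t a))) => [|a _]; last first.
  by rewrite ffunE /= ltn_addr ?ltn_ord.
rewrite prod_arc_weight // ss eqxx /=; case: eqP => [->|_]; last by rewrite !mul0r mulr0.
by rewrite mul1r divff // expf_neq0 // oppr_eq0.
Qed.

(** Nested arcs pair the letters of a word with those of its dual. *)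
Definition dual_word (s : seq bool) : seq bool := rev (map negb s).

Lemma size_dual s : size (dual_word s) = size s.
Proof. by rewrite size_rev size_map. Qed.

Lemma dual_wordK : involutive dual_word.
Proof. by move=> s; rewrite /dual_word map_rev revK mapK //; apply: negbK. Qed.

Lemma nth_dual n s a : size s = n -> (a < n)%N ->
  nth false (dual_word s) a = ~~ nth false s (n - a.+1).
Proof.
move=> ss an; rewrite nth_rev ?size_map ss // (nth_map false) // ss.
by lia.
Qed.

Lemma rep_ev n s u : size s = n -> size u = n ->
  state_sum q (evT K n) (s ++ u) [::] = (s == dual_word u)%:R * (- q) ^- count id s.
Proof.
move=> ss su; rewrite rep_dvec ?nested_planar_low ?size_cat ?ss ?su //.
rewrite /pairing_entry /= expr0 mul1r /weight big_sumType /= [X in _ * X]big_ord0.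
rewrite mulr1 big_split_ord /= [X in _ * X]big1 => [|a _]; last first.
  rewrite ffunE /=; case: ltnP => //; have := ltn_ord a; lia.
rewrite mulr1 -(prod_arc_weight (n := n)) // ?size_dual //; apply: eq_bigr => a _.
have la := ltn_ord a; rewrite ffunE /= ifT; last by lia.
rewrite !nth_cat ss la (nth_dual su la) negbK.
by rewrite ltnNge (_ : n <= _)%N /=; [congr (arc_weight _ _ (nth _ _ _)); lia|lia].
Qed.

Lemma rep_co n s u : size s = n -> size u = n ->
  state_sum q (coT K n) [::] (s ++ u) = (s == dual_word u)%:R * (- q) ^+ count id u.
Proof.
move=> ss su; rewrite rep_dvec ?nested_planar_up ?size_cat ?ss ?su //.
rewrite /pairing_entry count_cat exprD /weight big_sumType /= big_ord0.
rewrite mul1r big_split_ord /= [X in _ * (X * _)]big1 => [|a _]; last first.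
  rewrite ffunE /=; case: ltnP => //; have := ltn_ord a; lia.
rewrite mul1r (reindex_inj rev_ord_inj) /=.
rewrite (eq_bigr (fun a : 'I_n =>
    arc_weight q (nth false (dual_word u) a) (~~ nth false s a))) => [|a _].
  rewrite prod_arc_weight ?size_dual // eq_sym mulrCA; case: eqP => [<-|_].
    by rewrite !mul1r mulrC mulrA mulVf ?mul1r // expf_neq0 // oppr_eq0.
  by rewrite !mul0r.
have la := ltn_ord a; rewrite ffunE /= ifT; last by lia.
rewrite !nth_cat ss (nth_dual su la) ltnNge leq_addr /= addKn.
by rewrite ifT; [congr (arc_weight _ _ (~~ nth _ _ _)); lia|lia].
Qed.

End RepTensor.

(** * Matrices indexed by words *)

Section Matrices.

Variable (K : fieldType).

Definition wmatrix := seq bool -> seq bool -> K.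

Implicit Types A B C : wmatrix.

Lemma wmatrixP A B : (forall s t, A s t = B s t) -> A = B.
Proof.
by move=> E; apply: functional_extensionality => s; apply: functional_extensionality.
Qed.

(** Diagrammatic order: A is the lower factor. *)
Definition mulM (n : nat) A B : wmatrix :=
  fun s t => \sum_(u <- words n) A s u * B u t.

Definition tensM (i j : nat) A B : wmatrix :=
  fun s t => A (take i s) (take j t) * B (drop i s) (drop j t).

Definition id_wmatrix (n : nat) : wmatrix := fun s t => ((size s == n) && (s == t))%:R.

Local Notation idM := id_wmatrix.

Lemma mulMA m n A B C : mulM n (mulM m A B) C = mulM m A (mulM n B C).
Proof.
apply: wmatrixP => s t; rewrite /mulM.
under eq_bigr do rewrite mulr_suml; rewrite exchange_big; apply: eq_bigr => u _.
by rewrite mulr_sumr; apply: eq_bigr => v _; rewrite mulrA.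
Qed.

Lemma tensMA i j i' j' A B C :
  tensM (i + i') (j + j') (tensM i j A B) C = tensM i j A (tensM i' j' B C).
Proof.
apply: wmatrixP => s t; rewrite /tensM mulrA !take_takel ?leq_addr //.
by rewrite !drop_drop !take_drop ![(_ + i)%N]addnC ![(_ + j)%N]addnC.
Qed.

Lemma tensM_mul i j m j' A A' B B' :
  mulM (j + j') (tensM i j A A') (tensM j m B B') =
  tensM i m (mulM j A B) (mulM j' A' B').
Proof.
apply: wmatrixP => s t; rewrite /mulM /tensM sum_words_cat mulr_suml.
apply: eq_words => u su; rewrite mulr_sumr; apply: eq_bigr => v _.
by rewrite take_size_cat // drop_size_cat // mulrACA.
Qed.

Lemma tensM_id m n : tensM m m (idM m) (idM n) = idM (m + n).
Proof.
apply: wmatrixP => s t; rewrite /tensM /id_wmatrix -natrM mulnb; congr (_%:R).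
congr (nat_of_bool _); apply/andP/andP => [[/andP[/eqP ss /eqP st] /andP[/eqP ds /eqP dt]]|].
  have <- : s = t by rewrite -(cat_take_drop m s) st dt cat_take_drop.
  by rewrite -{1}(cat_take_drop m s) size_cat ss ds !eqxx.
case=> /eqP ss /eqP <-; rewrite !eqxx !andbT size_drop ss addKn size_take ss.
by case: ltnP => //; lia.
Qed.

Lemma tensM_id0 A : tensM 0 0 (idM 0) A = A.
Proof. by apply: wmatrixP => s t; rewrite /tensM !take0 !drop0 mul1r. Qed.

End Matrices.

Section Homs.

Variables (K : fieldType) (q : K).
Hypothesis q0 : q != 0.

Local Notation delta := (- q - q^-1).
Local Notation idM := (@id_wmatrix K).
Local Notation "A *[ n ] B" := (mulM n A B) (at level 40, left associativity).
Local Notation "A *t[ i , j ] B" := (tensM i j A B) (at level 39, left associativity).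

Lemma rep_compM i j m (g : TLhom K j m) (f : TLhom K i j) :
  state_sum q (compT delta g f) = state_sum q f *[j] state_sum q g.
Proof. by apply: wmatrixP => s t; rewrite rep_comp. Qed.

Lemma rep_tensM i j i' j' (f : TLhom K i j) (g : TLhom K i' j') :
  state_sum q (tensT f g) = state_sum q f *t[i, j] state_sum q g.
Proof. by apply: wmatrixP => s t; rewrite rep_tens. Qed.

Lemma rep_castM i j i' j' (ei : i = i') (ej : j = j') (f : TLhom K i j) :
  state_sum q (castT ei ej f) = state_sum q f.
Proof. by apply: wmatrixP => s t; rewrite rep_cast. Qed.

Lemma rep_idM n : state_sum q (idT K n) = idM n.
Proof. by apply: wmatrixP => s t; rewrite rep_id. Qed.

Lemma rep_injM i j (f g : TLhom K i j) : state_sum q f = state_sum q g -> f = g.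
Proof.
move=> E; apply/eqP; rewrite -subr_eq0; apply/eqP; apply: (rep_inj q0) => s t.
by rewrite repD -scaleN1r repZ E mulN1r subrr.
Qed.

(** Equalities between objects are invisible here, since a matrix is indexed by
    words of any length; an index can be rewritten freely. *)
Definition TL_matrix (i j : nat) (A : wmatrix K) : Prop :=
  exists f : TLhom K i j, state_sum q f = A.

Lemma hom_rep i j (f : TLhom K i j) : TL_matrix i j (state_sum q f).
Proof. by exists f. Qed.

Lemma hom_mul i j m A B : TL_matrix i j A -> TL_matrix j m B -> TL_matrix i m (A *[j] B).
Proof. by case=> f <- [g <-]; exists (compT delta g f); rewrite rep_compM. Qed.

Lemma hom_tens i j i' j' A B :
  TL_matrix i j A -> TL_matrix i' j' B -> TL_matrix (i + i') (j + j') (A *t[i, j] B).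
Proof. by case=> f <- [g <-]; exists (tensT f g); rewrite rep_tensM. Qed.

Lemma hom_id n : TL_matrix n n (idM n).
Proof. by exists (idT K n); rewrite rep_idM. Qed.

Lemma hom_out i j A s t : TL_matrix i j A -> ~~ ((size s == i) && (size t == j)) -> A s t = 0.
Proof. by case=> f <-; apply: rep_size. Qed.

Lemma eq_hom i j A B : TL_matrix i j A -> TL_matrix i j B ->
  (forall s t, size s = i -> size t = j -> A s t = B s t) -> A = B.
Proof.
move=> hA hB E; apply: wmatrixP => s t.
have [/andP[/eqP ss /eqP st]|n] := boolP ((size s == i) && (size t == j)).
  exact: E.
by rewrite (hom_out hA) // (hom_out hB).
Qed.

Lemma sum_words_delta n s (F : seq bool -> K) : size s = n ->
  \sum_(u <- words n) (s == u)%:R * F u = F s.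
Proof.
move=> ss; rewrite (bigD1_seq s) ?words_uniq ?mem_words ?ss //= eqxx mul1r.
by rewrite big1 ?addr0 // => u; rewrite eq_sym => /negPf->; rewrite mul0r.
Qed.

Lemma mul_idM i j A : TL_matrix i j A -> idM i *[i] A = A.
Proof.
move=> hA; apply: (eq_hom (hom_mul (hom_id i) hA) hA) => s t ss _.
by rewrite /mulM /id_wmatrix ss eqxx /= sum_words_delta.
Qed.

Lemma mulM_id i j A : TL_matrix i j A -> A *[j] idM j = A.
Proof.
move=> hA; apply: (eq_hom (hom_mul hA (hom_id j)) hA) => s t _ st.
rewrite -[RHS](sum_words_delta _ st); apply: eq_words => u su.
by rewrite /id_wmatrix su eqxx eq_sym mulrC.
Qed.

Lemma tens_idM0 i j A : TL_matrix i j A -> A *t[i, j] idM 0 = A.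
Proof.
move=> hA; have hB := hom_tens hA (hom_id 0); rewrite !addn0 in hB.
apply: (eq_hom hB hA) => s t ss st.
by rewrite /tensM -{1}ss -{1}st !take_size -{1}ss -{1}st !drop_size mulr1.
Qed.

Local Notation ev n := (state_sum q (evT K n)).
Local Notation co n := (state_sum q (coT K n)).

Lemma zigzag_l n : (idM n *t[n, n] co n) *[n + n + n] (ev n *t[n + n, 0] idM n) = idM n.
Proof.
have h1 : TL_matrix n (n + n + n) (idM n *t[n, n] co n).
  by have := hom_tens (hom_id n) (hom_rep (coT K n)); rewrite addn0 addnA.
have h2 : TL_matrix (n + n + n) n (ev n *t[n + n, 0] idM n).
  exact: (hom_tens (hom_rep (evT K n)) (hom_id n)).
apply: (eq_hom (hom_mul h1 h2) (hom_id n)) => s t ss st.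
have ts : take n s = s by rewrite -ss take_size.
have ds : drop n s = [::] by rewrite -ss drop_size.
rewrite /mulM !sum_words_cat.
transitivity (\sum_(u <- words n) (s == u)%:R * ((-q) ^- count id u *
   \sum_(v <- words n) (dual_word u == v)%:R *
     \sum_(w <- words n) (t == w)%:R * ((v == dual_word w)%:R * (-q) ^+ count id w))).
  apply: eq_words => u su; rewrite !mulr_sumr; apply: eq_words => v sv.
  rewrite !mulr_sumr; apply: eq_words => w sw.
  rewrite /tensM ts ds -catA take_size_cat // drop_size_cat //.
  rewrite catA take_size_cat ?size_cat ?su ?sv // drop_size_cat ?size_cat ?su ?sv //.
  rewrite take0 drop0 rep_ev // rep_co // /id_wmatrix ss sw !eqxx /=.
  by rewrite [w == t]eq_sym (inv_eq dual_wordK); ring.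
rewrite sum_words_delta // sum_words_delta ?size_dual // sum_words_delta //.
rewrite /id_wmatrix ss eqxx /= (inj_eq (inv_inj dual_wordK)).
case: eqP => [->|_]; rewrite ?mul0r ?mulr0 // mul1r mulVf //.
by rewrite expf_neq0 // oppr_eq0.
Qed.

Lemma zigzag_r n : (co n *t[0, n + n] idM n) *[n + n + n] (idM n *t[n, n] ev n) = idM n.
Proof.
have h1 : TL_matrix n (n + n + n) (co n *t[0, n + n] idM n).
  exact: (hom_tens (hom_rep (coT K n)) (hom_id n)).
have h2 : TL_matrix (n + n + n) n (idM n *t[n, n] ev n).
  by have := hom_tens (hom_id n) (hom_rep (evT K n)); rewrite addn0 addnA.
apply: (eq_hom (hom_mul h1 h2) (hom_id n)) => s t ss st.
have tt : take n t = t by rewrite -st take_size.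
have dt : drop n t = [::] by rewrite -st drop_size.
rewrite /mulM !sum_words_cat.
transitivity (\sum_(u <- words n) (t == u)%:R * (
   \sum_(v <- words n) (dual_word u == v)%:R * (-q) ^+ count id v *
     \sum_(w <- words n) (s == w)%:R * ((v == dual_word w)%:R * (-q) ^- count id v))).
  apply: eq_words => u su; rewrite !mulr_sumr; apply: eq_words => v sv.
  rewrite !mulr_sumr; apply: eq_words => w sw.
  rewrite /tensM take0 drop0 take_size_cat ?size_cat ?su ?sv //.
  rewrite drop_size_cat ?size_cat ?su ?sv // -catA take_size_cat // drop_size_cat //.
  rewrite tt dt rep_ev // rep_co // /id_wmatrix ss su !eqxx /=.
  by rewrite [t == u]eq_sym (inv_eq dual_wordK); ring.
rewrite sum_words_delta //; under eq_bigr do rewrite -mulrA.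
rewrite sum_words_delta ?size_dual // sum_words_delta //.
rewrite /id_wmatrix ss eqxx /= (inj_eq (inv_inj dual_wordK)) eq_sym mulrCA divff ?mulr1 //.
by rewrite expf_neq0 // oppr_eq0.
Qed.

End Homs.

(** * The largest proper tensor ideal *)

Section Ideals.

Variables (K : fieldType) (q : K).
Hypothesis q0 : q != 0.

Local Notation delta := (- q - q^-1).
Local Notation idM := (@id_wmatrix K).
Local Notation "A *[ n ] B" := (mulM n A B) (at level 40, left associativity).
Local Notation "A *t[ i , j ] B" := (tensM i j A B) (at level 39, left associativity).
Local Notation TLmx := (@TL_matrix K q).
Local Notation rep := (@state_sum K q _ _).
Local Notation ev n := (rep (evT K n)).
Local Notation co n := (rep (coT K n)).
Implicit Types A B X Y : wmatrix K.

Let mid i j A (hA : TLmx i j A) := mul_idM q0 hA.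
Let mdi i j A (hA : TLmx i j A) := mulM_id q0 hA.
Let midid n : idM n *[n] idM n = idM n := mid (hom_id q0 n).

Lemma tens_id_mul z j A B :
  idM z *t[z, z] (A *[j] B) = (idM z *t[z, z] A) *[z + j] (idM z *t[z, z] B).
Proof. by rewrite tensM_mul midid. Qed.

Lemma tens_id_id z w A :
  idM z *t[z, z] (idM w *t[w, w] A) = idM (z + w) *t[z + w, z + w] A.
Proof. by rewrite -tensMA tensM_id. Qed.

Lemma tens_slide i j i' j' A B : TLmx i j A -> TLmx i' j' B ->
  (A *t[i, j] idM i') *[j + i'] (idM j *t[j, j] B) = A *t[i, j] B.
Proof. by move=> hA hB; rewrite tensM_mul (mdi hA) (mid hB). Qed.

Lemma tens_slide' i j i' j' A B : TLmx i j A -> TLmx i' j' B ->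
  (idM i *t[i, i] B) *[i + j'] (A *t[i, j] idM j') = A *t[i, j] B.
Proof. by move=> hA hB; rewrite tensM_mul (mid hA) (mdi hB). Qed.

(** The largest proper tensor ideal, described without a braiding. *)
Definition annihilated (i j : nat) (f : TLhom K i j) : Prop :=
  forall z X Y, TLmx (z + j) 0 X -> TLmx 0 (z + i) Y ->
    (Y *[z + i] (idM z *t[z, z] rep f) *[z + j] X) [::] [::] = 0.

Lemma annihilated_ideal : tensor_ideal delta annihilated.
Proof.
split.
- move=> i j z X Y _ _; rewrite /mulM big1 // => u _; rewrite big1 ?mul0r // => v _.
  by rewrite /tensM rep0 !mulr0.
- move=> i j f g If Ig z X Y hX hY.
  pose v (h : TLhom K i j) :=
    (Y *[z + i] (idM z *t[z, z] rep h) *[z + j] X) [::] [::].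
  suff : v (f - g) = v f - v g by rewrite /v If // Ig // subr0.
  rewrite /v /mulM -sumrB; apply: eq_bigr => u _; rewrite -mulrBl -sumrB.
  congr (_ * _); apply: eq_bigr => w _; rewrite -mulrBr; congr (_ * _).
  by rewrite /tensM repD -scaleN1r repZ mulN1r mulrBr.
- move=> i j m f g If z X Y hX hY; rewrite rep_compM // tens_id_mul -mulMA mulMA.
  by apply: If => //; apply: hom_mul hX => //; apply: hom_tens => //; [exact: hom_id|exact: hom_rep].
- move=> i j m f g If z X Y hX hY; rewrite rep_compM // tens_id_mul -mulMA.
  by apply: If => //; apply: hom_mul hY _ => //; apply: hom_tens => //; [exact: hom_id|exact: hom_rep].
move=> w i j f If z X Y hX hY; rewrite rep_tensM // rep_idM // tens_id_id.
by rewrite !addnA in hX hY *; apply: If.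
Qed.

Lemma id0_not_annihilated : ~ annihilated (idT K 0).
Proof.
move=> /(_ 0%N _ _ (hom_id q0 0) (hom_id q0 0)).
rewrite rep_idM // tensM_id !midid => /eqP.
by rewrite /id_wmatrix eqxx oner_eq0.
Qed.

Section OneIdeal.

Variable I : forall i j : nat, TLhom K i j -> Prop.
Hypothesis idI : tensor_ideal delta I.

Definition in_ideal (i j : nat) A : Prop := exists2 f : TLhom K i j, I f & rep f = A.

Lemma in_ideal_rep i j (f : TLhom K i j) : in_ideal i j (rep f) <-> I f.
Proof. by split=> [[g Ig /(rep_injM q0) <-]//|If]; exists f. Qed.

Lemma in_ideal_mulr i j m A B : in_ideal i j A -> TLmx j m B -> in_ideal i m (A *[j] B).
Proof.
case=> f If <- [g <-]; exists (compT delta g f); first exact: (ideal_postcomp idI).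
by rewrite rep_compM.
Qed.

Lemma in_ideal_mull i j m A B : TLmx i j A -> in_ideal j m B -> in_ideal i m (A *[j] B).
Proof.
case=> f <- [g Ig <-]; exists (compT delta g f); first exact: (ideal_precomp idI).
by rewrite rep_compM.
Qed.

Lemma in_ideal_tens z i j A :
  in_ideal i j A -> in_ideal (z + i) (z + j) (idM z *t[z, z] A).
Proof.
case=> f If <-; exists (tensT (idT K z) f); first exact: (ideal_tensor idI).
by rewrite rep_tensM // rep_idM.
Qed.

Lemma ideal_scale i j c (f : TLhom K i j) : I f -> I (c *: f).
Proof.
move=> If; suff -> : c *: f = compT delta (c *: idT K j) f by apply: (ideal_postcomp idI).
apply: (rep_injM q0); rewrite rep_compM //; apply: wmatrixP => s t.
rewrite repZ -{1}(mdi (hom_rep q f)) /mulM mulr_sumr; apply: eq_bigr => u _.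
by rewrite repZ rep_idM // mulrCA.
Qed.

Lemma ideal_add i j (f g : TLhom K i j) : I f -> I g -> I (f + g).
Proof.
move=> If Ig; rewrite -[g]opprK; apply: (ideal_sub idI) => //.
by rewrite -scaleN1r; apply: ideal_scale.
Qed.

Lemma scalar_hom (f : TLhom K 0 0) : f = rep f [::] [::] *: idT K 0.
Proof.
apply: (rep_injM q0); apply: wmatrixP => s t; rewrite repZ rep_id //.
case: s => [|b s]; last by rewrite mulr0 rep_size.
by case: t => [|b t]; rewrite ?mulr1 // mulr0 rep_size.
Qed.

Lemma ideal_full : I (idT K 0) -> same_ideal I (@full_ideal K).
Proof.
move=> I0 i j f; split=> // _; apply/in_ideal_rep.
rewrite -(mid (hom_rep q f)); apply: in_ideal_mulr (hom_rep q f).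
have := in_ideal_tens i (proj2 (in_ideal_rep _) I0).
by rewrite rep_idM // tensM_id addn0.
Qed.

(** A proper tensor ideal contains no nonzero scalar, so everything that can be
    closed up to a scalar out of one of its members vanishes. *)
Lemma proper_annihilated : ~ I (idT K 0) ->
  forall i j (f : TLhom K i j), I f -> annihilated f.
Proof.
move=> nI i j f /in_ideal_rep If z X Y hX hY.
have := in_ideal_mulr (in_ideal_mull hY (in_ideal_tens z If)) hX.
case=> g Ig <-; apply/eqP; apply: contraT => c0; case: nI.
by rewrite -[idT K 0]scale1r -(mulVf c0) -scalerA -scalar_hom; apply: ideal_scale.
Qed.

End OneIdeal.

(** Bending the lower dots of a morphism to the upper line. *)
Definition bend (i : nat) A : wmatrix K := co i *[i + i] (idM i *t[i, i] A).

Definition unbend (i j : nat) B : wmatrix K :=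
  (idM i *t[i, i] B) *[i + (i + j)] (ev i *t[i + i, 0] idM j).

Lemma hom_bend i j A : TLmx i j A -> TLmx 0 (i + j) (bend i A).
Proof.
by move=> hA; apply: hom_mul => //; [exact: hom_rep | apply: hom_tens => //; exact: hom_id].
Qed.

Lemma hom_cap_id i j : TLmx (i + (i + j)) j (ev i *t[i + i, 0] idM j).
Proof. by rewrite addnA; apply: (hom_tens q0 (hom_rep q (evT K i)) (hom_id q0 j)). Qed.

Lemma bendK i j A : TLmx i j A -> unbend i j (bend i A) = A.
Proof.
move=> hA; rewrite /unbend /bend tens_id_mul mulMA tens_id_id.
rewrite [(i + (i + j))%N]addnA (tens_slide' (hom_rep q (evT K i)) hA).
rewrite -(tens_slide (hom_rep q (evT K i)) hA) tensM_id0 -mulMA.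
by rewrite [(i + (i + i))%N]addnA zigzag_l // (mid hA).
Qed.

(** Closing up a morphism only depends on its bent form. *)
Lemma bend_annihilated i j (f : TLhom K i j) :
  (forall X, TLmx (i + j) 0 X -> (bend i (rep f) *[i + j] X) [::] [::] = 0) ->
  annihilated f.
Proof.
move=> H z X Y hX hY.
have hf := hom_rep q f; have hB := hom_bend hf.
rewrite -(bendK hf) /unbend tens_id_mul -mulMA tens_id_id.
have -> : Y *[z + i] (idM (z + i) *t[z + i, z + i] bend i (rep f)) =
          bend i (rep f) *[i + j] (Y *t[0, z + i] idM (i + j)).
  have e1 := tens_slide hY hB; rewrite (tens_idM0 q0 hY) in e1.
  have e2 := tens_slide' hY hB; rewrite tensM_id0 in e2.
  by rewrite e2 -e1 addn0.
move: (bend i (rep f)) H {hB} => b H.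
rewrite !mulMA; apply: H; apply: (hom_mul q0 (j := (z + (i + (i + j)))%N)).
  have := hom_tens q0 hY (hom_id q0 (i + j)); by rewrite -addnA.
apply: (hom_mul q0 (j := (z + j)%N)) => //.
by apply: hom_tens => //; [exact: hom_id | exact: hom_cap_id].
Qed.

(** A functional on bent morphisms from i to j, read as a morphism from j to i. *)
Definition open_functional (i j : nat) eta X : wmatrix K :=
  (eta *t[0, i + i] idM j) *[i + i + j] (idM i *t[i, i] X).

Lemma hom_open i j eta X : TLmx 0 (i + i) eta -> TLmx (i + j) 0 X ->
  TLmx j i (open_functional i j eta X).
Proof.
move=> heta hX; apply: (hom_mul q0 (hom_tens q0 heta (hom_id q0 j))).
by have := hom_tens q0 (hom_id q0 i) hX; rewrite addn0 addnA.
Qed.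

(** Every functional is the closure of a morphism, because eta inverts eps. *)
Lemma open_close i j eps eta X : TLmx (i + i) 0 eps -> TLmx 0 (i + i) eta ->
    (idM i *t[i, i] eta) *[i + i + i] (eps *t[i + i, 0] idM i) = idM i ->
    TLmx (i + j) 0 X ->
  (idM i *t[i, i] open_functional i j eta X) *[i + i] eps = X.
Proof.
move=> heps heta zz hX; have hj := hom_id q0 j.
rewrite /open_functional tens_id_mul tens_id_id mulMA.
have -> : (idM (i + i) *t[i + i, i + i] X) *[i + i] eps =
    (eps *t[i + i, 0] idM (i + j)) *[i + j] X.
  have e1 := tens_slide heps hX; rewrite tensM_id0 in e1.
  have e2 := tens_slide' heps hX; rewrite (tens_idM0 q0 heps) addn0 in e2.
  by rewrite e1.
rewrite -mulMA -tensMA -tensM_id -(tensMA (i + i) 0 i i).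
rewrite [(i + (i + i + j))%N]addnA -[(i + i + i)%N]addnA tensM_mul (mid hj).
by rewrite addnA zz addn0 tensM_id (mid hX).
Qed.

End Ideals.

(** * Negligible morphisms of a braiding *)

Section Braiding.

Variables (K : fieldType) (q : K).
Hypothesis q0 : q != 0.

Local Notation delta := (- q - q^-1).
Local Notation idM := (@id_wmatrix K).
Local Notation "A *[ n ] B" := (mulM n A B) (at level 40, left associativity).
Local Notation "A *t[ i , j ] B" := (tensM i j A B) (at level 39, left associativity).
Local Notation TLmx := (@TL_matrix K q).
Local Notation rep := (@state_sum K q _ _).
Local Notation ev n := (rep (evT K n)).
Local Notation co n := (rep (coT K n)).
Implicit Types A B X Y : wmatrix K.

Let mid i j A (hA : TLmx i j A) := mul_idM q0 hA.
Let mdi i j A (hA : TLmx i j A) := mulM_id q0 hA.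

Variable gam : forall m n : nat, TLhom K (m + n) (n + m).
Hypothesis br : is_braiding delta gam.

Definition braid_matrix m n : wmatrix K := rep (gam m n).
Local Notation G := braid_matrix.

Let hG m n : TLmx (m + n) (n + m) (G m n).
Proof. exact: hom_rep. Qed.

Lemma braiding_inv m n : exists2 G', TLmx (n + m) (m + n) G' &
  G m n *[n + m] G' = idM (m + n) /\ G' *[m + n] G m n = idM (n + m).
Proof.
have [g [E1 E2]] := braiding_iso br m n; exists (rep g); first exact: hom_rep.
by rewrite -!rep_compM // E1 E2 !rep_idM.
Qed.

Lemma braiding_nat i i' j j' A B : TLmx i i' A -> TLmx j j' B ->
  (A *t[i, i'] B) *[i' + j'] G i' j' = G i j *[j + i] (B *t[j, j'] A).
Proof.
case=> f <- [g <-]; have := f_equal (fun h => rep h) (braiding_natural br f g).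
by rewrite !rep_compM // !rep_tensM.
Qed.

Lemma braiding_split_r x y z :
  G x (y + z) = (G x y *t[x + y, y + x] idM z) *[y + (x + z)] (idM y *t[y, y] G x z).
Proof.
have := f_equal (fun h => rep h) (braiding_hexagon_r br x y z).
by rewrite !rep_compM // !rep_castM !rep_tensM // !rep_idM.
Qed.

Lemma braiding_split_l x y z :
  G (x + y) z = (idM x *t[x, x] G y z) *[x + z + y] (G x z *t[x + z, z + x] idM y).
Proof.
have := f_equal (fun h => rep h) (braiding_hexagon_l br x y z).
by rewrite !rep_compM // !rep_castM !rep_tensM // !rep_idM.
Qed.

(** The hexagon at the unit says that this automorphism is its own square. *)
Lemma braiding_unit_r n : G n 0 = idM n.
Proof.
have [G' hG' [E1 E2]] := braiding_inv n 0; rewrite addn0 add0n in E1 E2.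
have hG0 := hG n 0; rewrite addn0 add0n in hG0.
have := braiding_split_r n 0 0; rewrite !add0n addn0 tensM_id0 (tens_idM0 q0 hG0).
by move=> /(f_equal (mulM n G')); rewrite -mulMA E2 (mid hG0) => <-.
Qed.

Lemma braiding_unit_l n : G 0 n = idM n.
Proof.
have [G' hG' [E1 E2]] := braiding_inv 0 n; rewrite addn0 add0n in E1 E2.
have hG0 := hG 0 n; rewrite addn0 add0n in hG0.
have := braiding_split_l 0 0 n; rewrite !add0n !addn0 tensM_id0 (tens_idM0 q0 hG0).
by move=> /(f_equal (mulM n G')); rewrite -mulMA E2 (mid hG0) => <-.
Qed.

(** The braided evaluation is again a nondegenerate pairing: together with the
    inverse braiding of the coevaluation it satisfies the zigzag equation. The
    braiding is moved around the loop by naturality and the two hexagons. *)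
Lemma braided_zigzag n : exists2 eta, TLmx 0 (n + n) eta &
  (idM n *t[n, n] eta) *[n + n + n]
    ((G n n *[n + n] ev n) *t[n + n, 0] idM n) = idM n.
Proof.
have [G' hG' [E1 E2]] := braiding_inv n n.
have hco := hom_rep q (coT K n); have hev := hom_rep q (evT K n).
have hi := hom_id q0 n.
have heta : TLmx 0 (n + n) (co n *[n + n] G') := hom_mul q0 hco hG'.
exists (co n *[n + n] G') => //.
have a3 : (n + n + n = n + (n + n))%N by rewrite addnA.
have split : G n n *t[n + n, n + n] idM n =
    G n (n + n) *[n + (n + n)] (idM n *t[n, n] G').
  have hX := hom_tens q0 (hG n n) hi; rewrite -{2}addnA in hX.
  by rewrite braiding_split_r mulMA -(tens_id_mul q0) E1 tensM_id (mdi hX).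
have past_eta : (idM n *t[n, n] (co n *[n + n] G')) *[n + (n + n)] G n (n + n) =
    (co n *t[0, n + n] idM n) *[n + (n + n)] (G' *t[n + n, n + n] idM n).
  rewrite (braiding_nat hi heta) braiding_unit_r (mid (hom_tens q0 heta hi)).
  by rewrite -a3 tensM_mul (mid hi).
have past_ev : ev n *t[n + n, 0] idM n =
    G (n + n) n *[n + (n + n)] (idM n *t[n, n] ev n).
  have hX : TLmx (n + n + n) n (ev n *t[n + n, 0] idM n).
    exact: (hom_tens q0 hev hi).
  by rewrite -(braiding_nat hev hi) braiding_unit_l (mdi hX).
have inv3 : (G' *t[n + n, n + n] idM n) *[n + (n + n)] (idM n *t[n, n] G')
    *[n + (n + n)] G (n + n) n = idM (n + (n + n)).
  rewrite braiding_split_l a3 mulMA -[(idM n *t[n, n] G') *[_] _]mulMA.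
  rewrite -(tens_id_mul q0) E2 tensM_id.
  have hX := hom_tens q0 (hG n n) hi; rewrite a3 in hX.
  by rewrite (mid hX) -a3 tensM_mul E2 (mid hi) tensM_id.
have -> : (G n n *[n + n] ev n) *t[n + n, 0] idM n =
    (G n n *t[n + n, n + n] idM n) *[n + n + n] (ev n *t[n + n, 0] idM n).
  by rewrite tensM_mul (mid hi).
have regroup m A B C D E : A *[m] B *[m] C = idM m ->
    D *[m] A *[m] B *[m] (C *[m] E) = D *[m] (idM m *[m] E).
  by move=> <-; rewrite !mulMA.
rewrite split a3 -!mulMA past_eta past_ev (regroup _ _ _ _ _ _ inv3).
have h1 : TLmx (n + (n + n)) n (idM n *t[n, n] ev n).
  by have := hom_tens q0 hi hev; rewrite addn0.
by rewrite (mid h1) -a3 zigzag_r.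
Qed.

(** Since the braided evaluation is nondegenerate, negligible morphisms do not
    depend on the braiding. *)
Lemma negligible_annihilated i j (f : TLhom K i j) :
  annihilated q f <-> negligible delta gam f.
Proof.
split=> [Af g|Nf].
  apply: (rep_injM q0); apply: wmatrixP => s t; rewrite rep0.
  have [/andP[/nilP-> /nilP->]|] := boolP ((size s == 0%N) && (size t == 0%N)); last exact: rep_size.
  rewrite /traceT !rep_compM // rep_tensM // rep_compM // rep_idM // (tens_id_mul q0).
  rewrite -/(G i i) !mulMA -mulMA.
  apply: Af; last exact: hom_rep.
  apply: (hom_mul q0 (j := (i + i)%N)).
    by apply: hom_tens => //; [exact: hom_id | exact: hom_rep].
  exact: (hom_mul q0 (hG i i) (hom_rep q (evT K i))).
apply: bend_annihilated => // X hX.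
have [eta heta zz] := braided_zigzag i.
have [g Eg] := hom_open q0 heta hX.
have := f_equal (fun h => rep h [::] [::]) (Nf g); rewrite rep0 => <-.
rewrite /traceT !rep_compM // rep_tensM // rep_compM // rep_idM // (tens_id_mul q0).
rewrite Eg -/(G i i) /bend !mulMA; congr (mulM _ _ (mulM _ _ _) _ _).
by rewrite (open_close q0 _ heta zz) //; exact: (hom_mul q0 (hG i i) (hom_rep q (evT K i))).
Qed.

End Braiding.

Local Notation ones := (count id).
Local Notation zeros := (count negb).

(** * Words and Gaussian binomial coefficients *)

Fixpoint inversions (w : seq bool) : nat :=
  if w is b :: w' then ((if b then zeros w' else 0) + inversions w')%N else 0%N.

(** The sum of the positions of the letters false. *)
Fixpoint zero_positions (w : seq bool) : nat :=
  if w is b :: w' then (zeros w' + zero_positions w')%N else 0%N.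

Lemma ones_zeros w : (ones w + zeros w = size w)%N.
Proof. exact: count_predC. Qed.

Lemma zero_positions_cat w1 w2 :
  zero_positions (w1 ++ w2) =
  (zero_positions w1 + zero_positions w2 + size w1 * zeros w2)%N.
Proof. by elim: w1 => [|b w IH] /=; rewrite ?addn0 // count_cat IH; lia. Qed.

Lemma inversions_cat w1 w2 :
  inversions (w1 ++ w2) = (inversions w1 + inversions w2 + ones w1 * zeros w2)%N.
Proof. by elim: w1 => [|b w IH] /=; rewrite ?addn0 // count_cat IH; case: b; lia. Qed.

Lemma zero_positionsE w : zero_positions w = (inversions w + 'C(zeros w, 2))%N.
Proof.
elim: w => //= b w ->; case: b; rewrite /= ?add0n ?add1n; first by lia.
by rewrite binS bin1; lia.
Qed.

Section Gauss.

Variables (K : fieldType) (z : K).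

(** The elementary symmetric function of degree r of 1, z, ..., z^(b-1), that
    is a Gaussian binomial coefficient times z^(r(r-1)/2). *)
Definition gauss (b r : nat) : K :=
  \sum_(w <- words b) (zeros w == r)%:R * z ^+ zero_positions w.

(** The generating function in r is the product of 1 + z^i X over i < b; this is
    the coefficient of a product of two of them. *)
Lemma gauss_cat b1 b2 r : gauss (b1 + b2) r =
  \sum_(r1 < r.+1) gauss b1 r1 * z ^+ (b1 * (r - r1)) * gauss b2 (r - r1).
Proof.
rewrite /gauss sum_words_cat.
under [RHS]eq_bigr do rewrite -mulrA mulr_suml; rewrite [RHS]exchange_big.
apply: eq_words => w1 s1; under [RHS]eq_bigr do rewrite !mulr_sumr.
rewrite [RHS]exchange_big; apply: eq_words => w2 s2 /=.
rewrite zero_positions_cat count_cat s1 !exprD.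
have [E|NE] := eqVneq (zeros w1 + zeros w2)%N r.
  have lt : (zeros w1 < r.+1)%N by rewrite -E ltnS leq_addr.
  rewrite (bigD1 (Ordinal lt)) //= big1 => [|r1 nr].
    by rewrite -E addKn !eqxx addr0 /=; ring.
  rewrite (_ : zeros w1 == r1 = false) ?mul0r //.
  by apply: contraNF nr => /eqP nr; apply/eqP/val_inj.
rewrite big1 ?mul0r // => r1 _; have [E1|_] := eqVneq (zeros w1) r1; last by rewrite !mul0r.
rewrite (_ : zeros w2 == _ = false) ?(mul0r, mulr0) //.
by apply: contraNF NE => /eqP->; rewrite E1 subnKC // -ltnS.
Qed.

Lemma gauss_small b r : (b < r)%N -> gauss b r = 0.
Proof.
move=> br; transitivity (\sum_(w <- words b) (0 : K)); last by rewrite big1.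
apply: eq_words => w sw; rewrite (_ : zeros w == r = false) ?mul0r //.
by apply: contraTF br => /eqP <-; rewrite -leqNgt -sw count_size.
Qed.

Lemma gauss0r r : gauss 0 r = (r == 0%N)%:R.
Proof. by rewrite /gauss sum_words0 /= mulr1 eq_sym. Qed.

Lemma gauss1r r : gauss 1 r = (r <= 1)%:R.
Proof.
rewrite /gauss sum_wordsS sum_words0 big_bool /= !expr0.
by case: r => [|[|r]]; rewrite /= ?mulr1 ?mulr0 ?addr0 ?add0r.
Qed.

Lemma gauss_r0 b : gauss b 0 = 1.
Proof.
elim: b => [|b IH]; first by rewrite gauss0r.
rewrite -add1n gauss_cat big_ord1 IH gauss1r /= muln0 expr0; ring.
Qed.

Lemma gauss_head b r : gauss b.+1 r.+1 = z ^+ r.+1 * gauss b r.+1 + z ^+ r * gauss b r.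
Proof.
rewrite -add1n gauss_cat 2!big_ord_recl big1 => [|i _]; last first.
  by rewrite gauss1r /= !mul0r.
by rewrite !gauss1r /= /bump /= !mul1n subn0 subn1 /= !mul1r addr0.
Qed.

Lemma gauss_tail b r : gauss b.+1 r.+1 = gauss b r.+1 + z ^+ b * gauss b r.
Proof.
rewrite -addn1 gauss_cat 2!big_ord_recr big1 => [|i _]; last first.
  rewrite gauss1r (_ : _ <= 1 = false)%N ?mulr0 //.
  by have := ltn_ord i => /= ?; lia.
rewrite !gauss1r /= subnn subSn // subnn muln0 muln1 expr0 add0r.
by rewrite ltnS leqnn /= !mulr1 addrC [z ^+ b * _]mulrC.
Qed.

(** Comparing the two Pascal recursions. *)
Lemma gauss_ratio b r :
  (z ^+ r.+1 - 1) * gauss b r.+1 = (z ^+ b - z ^+ r) * gauss b r.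
Proof.
apply/eqP; rewrite -subr_eq0; apply/eqP.
have := gauss_head b r; rewrite gauss_tail => /eqP; rewrite -subr_eq0 => /eqP E.
by rewrite -[RHS]oppr0 -E; ring.
Qed.

Lemma gauss_diag b : z != 0 -> gauss b b != 0.
Proof.
move=> z0; elim: b => [|b IH]; first by rewrite gauss0r oner_eq0.
by rewrite gauss_tail gauss_small // add0r mulf_neq0 // expf_neq0.
Qed.

Section RootOfUnity.

Variables (l : nat).
Hypothesis prim : l.-primitive_root z.

(** The product of 1 + z^i X over a period is 1 - (-X)^l. *)
Lemma gauss_period r : (0 < r < l)%N -> gauss l r = 0.
Proof.
elim: r => // r IH /andP[_ rl]; have := gauss_ratio l r.
have zr : z ^+ r.+1 - 1 != 0.
  rewrite subr_eq0 -(prim_order_dvd prim); apply: contraTN rl => /dvdn_leq.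
  by rewrite -leqNgt; apply.
rewrite (prim_expr_order prim) => E; apply: (mulfI zr); rewrite E mulr0.
case: r {zr E} IH rl => [|r] IH rl; first by rewrite subrr mul0r.
by rewrite IH ?mulr0 //= ltnW.
Qed.

(** The coefficient of X^l in the m-th power of the product over one period. *)
Lemma gauss_multiple m : gauss (m * l) l = m%:R * gauss l l.
Proof.
have l0 := prim_order_gt0 prim.
elim: m => [|m IH].
  by rewrite mul0n gauss0r mul0r; case: (l) l0.
rewrite mulSn gauss_cat big_ord_recr /= (bigD1 (Ordinal l0)) //= subn0 subnn muln0.
rewrite big1 => [|i i0]; last first.
  have il : (0 < i < l)%N.
    by rewrite ltn_ord andbT lt0n; apply: contraNneq i0 => E; apply/eqP/val_inj.
  by rewrite gauss_period ?mul0r.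
rewrite expr0 !gauss_r0 IH exprM (prim_expr_order prim) expr1n -[m.+1]addn1 natrD.
ring.
Qed.

End RootOfUnity.

End Gauss.

(** * Adjacent arcs *)

Section AdjacentArcs.

Variables (X : finType) (R : X -> nat).
Hypothesis injR : injective R.

(** An arc between the ends of which some dot lies has a shorter arc inside. *)
Lemma innermost_arc (a : X -> X) : planar_involution R a ->
    (forall x r, (R x < r < R (a x))%N -> exists z, R z = r) ->
  forall x, (R x < R (a x))%N ->
  exists y, [/\ (R x <= R y)%N, R (a y) = (R y).+1 & (R (a y) <= R (a x))%N].
Proof.
move=> pa surj x; move: {2}(R (a x) - R x)%N (leqnn (R (a x) - R x)) => k.
elim: k x => [|k IH] x xk lt; first by lia.
have [E|ne] := eqVneq (R (a x)) (R x).+1; first by exists x; rewrite E.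
have lt1 : (R x < (R x).+1 < R (a x))%N by lia.
have [z Rz] := surj _ _ lt1.
have lt2 : (R x < R z < R (a x))%N by rewrite Rz.
have := planar_nested pa lt2 => /andP[z1 z2].
have zz : R (a z) != R z by rewrite (inj_eq injR) (planar_fixfree pa).
have [||y [y1 y2 y3]] := IH z; try lia.
by exists y; split=> //; lia.
Qed.

Variables (K : fieldType) (q : K).

Lemma weight_arc (a : X -> X) s x : planar_involution R a -> (R x < R (a x))%N ->
  weight q R predT a s = arc_weight q (s x) (s (a x)) *
    \prod_(z | (z != x) && (z != a x))
      (if (R z < R (a z))%N then arc_weight q (s z) (s (a z)) else 1).
Proof.
move=> pa lt; rewrite /weight (bigD1 x) //= lt (bigD1 (a x)) ?(planar_fixfree pa) //=.
by rewrite (planar_invol pa) ltnNge ltnW //= mul1r.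
Qed.

Lemma weight_arc_eq (a : X -> X) s x : planar_involution R a ->
  s x = s (a x) -> weight q R predT a s = 0.
Proof.
move=> pa; have [lt|] := ltnP (R x) (R (a x)) => [E|].
  by rewrite (weight_arc _ pa lt) E /arc_weight addbb mul0r.
rewrite leq_eqVlt (inj_eq injR) (negPf (planar_fixfree pa _)) /= => lt E.
have lt' : (R (a x) < R (a (a x)))%N by rewrite (planar_invol pa).
by rewrite (weight_arc _ pa lt') (planar_invol pa) E /arc_weight addbb mul0r.
Qed.

Lemma weight_arc_swap (a : X -> X) (s s' : X -> bool) x : planar_involution R a ->
    (R x < R (a x))%N -> ~~ s x -> s (a x) -> s' x -> ~~ s' (a x) ->
    (forall z, z != x -> z != a x -> s' z = s z) ->
  weight q R predT a s' = - q^-1 * weight q R predT a s.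
Proof.
move=> pa lt /negPf s1 s2 s3 /negPf s4 E; rewrite !(weight_arc _ pa lt).
rewrite s1 s2 s3 s4 /arc_weight /= mul1r; congr (_ * _).
apply: eq_bigr => z /andP[zx zax]; case: ifP => // _.
have aK := planar_invol pa.
by rewrite !E // ?(inj_eq (inv_inj aK)) // (inv_eq aK).
Qed.

End AdjacentArcs.

Section DiagramArcs.

Variables (i j : nat).

Lemma rank_surj r : (r < i + j)%N -> exists z : dots i j, rank z = r.
Proof.
move=> rij; have [ri|ir] := ltnP r i; first by exists (inl (Ordinal ri)).
have rj : (i + j - r.+1 < j)%N by lia.
by exists (inr (Ordinal rj)) => /=; lia.
Qed.

Lemma rank_lt (z : dots i j) : (rank z < i + j)%N.
Proof. by case: z => a /=; have := ltn_ord a; lia. Qed.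

Variable p : pairing i j.
Hypothesis pl : planar p.

Lemma innermost_dot x : (rank x < rank (p x))%N ->
  exists y, [/\ (rank x <= rank y)%N, rank (p y) = (rank y).+1
               & (rank (p y) <= rank (p x))%N].
Proof.
apply: (innermost_arc (@rank_inj i j) (elimT (planarP _) pl)) => {}x r /andP[_ h].
exact: rank_surj (ltn_trans h (rank_lt _)).
Qed.

Lemma adjacent_cup (b b' : 'I_j) : p (inr b) = inr b' -> (b < b')%N ->
  exists c c' : 'I_j, [/\ p (inr c) = inr c', c' = c.+1 :> nat, (b <= c)%N & (c' <= b')%N].
Proof.
move=> pb bb'; have pK := planar_invol (elimT (planarP _) pl).
have pb' : p (inr b') = inr b by rewrite -pb pK.
have [|y] := @innermost_dot (inr b'); first by rewrite pb' /=; have := ltn_ord b'; lia.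
rewrite pb' /= => -[h1 h2 h3].
case: y h1 h2 h3 => [a|c'] /= h1 h2 h3.
  by have := ltn_ord a; have := ltn_ord b'; lia.
case E: (p (inr c')) h2 h3 => [a|c] /= h2 h3.
  by have := ltn_ord a; have := ltn_ord c'; lia.
have lt := @ltn_ord j; exists c, c'; split.
- by rewrite -E pK.
- by have := lt c; have := lt c'; lia.
- by have := lt c; have := lt b; lia.
by have := lt c'; have := lt b'; lia.
Qed.

Lemma adjacent_cap (a a' : 'I_i) : p (inl a) = inl a' -> (a < a')%N ->
  exists c c' : 'I_i, p (inl c) = inl c' /\ c' = c.+1 :> nat.
Proof.
move=> pa aa'; have [|y] := @innermost_dot (inl a); first by rewrite pa.
rewrite pa /= => -[h1 h2 h3].
case E: (p y) h2 h3 => [c'|c'] /= h2 h3; last by have := ltn_ord a'; lia.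
case: y E h1 h2 => [c|c] /= E h1 h2; last by have := ltn_ord a'; lia.
by exists c, c'.
Qed.

Variables (K : fieldType) (q : K).
Hypothesis q0 : q != 0.

Let pp : planar_involution (@rank i j) p := elimT (planarP _) pl.

Lemma nth_mid (t1 t2 : seq bool) x y c : nth false (t1 ++ [:: x; y] ++ t2) c =
  if c == size t1 then x else if c == (size t1).+1 then y
  else nth false (t1 ++ t2) (if (c < size t1)%N then c else c.-2).
Proof.
rewrite !nth_cat; case: ltngtP => [lt|gt|->] /=; rewrite ?subnn //.
- by case: eqP => [E|_]; [lia | rewrite lt].
- case: eqP => [->|ne]; first by rewrite subSnn.
  have -> : (c.-2 < size t1)%N = false by lia.
  have -> : (c - size t1 < 2)%N = false by lia.
  by congr (nth _ _ _); lia.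
Qed.

Lemma entry_cup (c c' : 'I_j) s t1 t2 :
    p (inr c) = inr c' -> c' = c.+1 :> nat -> size t1 = c ->
  (forall b, pairing_entry q p s (t1 ++ [:: b; b] ++ t2) = 0) /\
  pairing_entry q p s (t1 ++ [:: false; true] ++ t2) =
  - q * pairing_entry q p s (t1 ++ [:: true; false] ++ t2).
Proof.
move=> pc cc' s1; have pc' : p (inr c') = inr c by rewrite -pc (planar_invol pp).
split=> [b|].
  rewrite /pairing_entry (weight_arc_eq (@rank_inj i j) (x := inr c) _ pp) ?mulr0 //.
  by rewrite pc /= !nth_mid s1 cc' eqxx (_ : c.+1 == c = false) ?eqxx //; lia.
rewrite /pairing_entry.
rewrite (_ : ones (t1 ++ [:: false; true] ++ t2) = ones (t1 ++ [:: true; false] ++ t2));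
  last by rewrite !count_cat.
rewrite (weight_arc_swap (x := inr c') (s := dot_state s (t1 ++ [:: false; true] ++ t2))
  (s' := dot_state s (t1 ++ [:: true; false] ++ t2)) _ pp).
- by field.
- by rewrite pc' /=; have := ltn_ord c'; lia.
- by rewrite /= nth_mid s1 cc' eqxx (_ : c.+1 == c = false) //; lia.
- by rewrite pc' /= nth_mid s1 eqxx.
- by rewrite /= nth_mid s1 cc' eqxx (_ : c.+1 == c = false) //; lia.
- by rewrite pc' /= nth_mid s1 eqxx.
rewrite pc' => -[a|b] //= nc' nc; rewrite !nth_mid s1 -cc'.
have -> : b == c :> nat = false by apply: contraNF nc => /eqP/val_inj->.
by have -> : b == c' :> nat = false by apply: contraNF nc' => /eqP/val_inj->.
Qed.

Lemma entry_cap (c c' : 'I_i) s1 s2 t :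
    p (inl c) = inl c' -> c' = c.+1 :> nat -> size s1 = c ->
  (forall b, pairing_entry q p (s1 ++ [:: b; b] ++ s2) t = 0) /\
  pairing_entry q p (s1 ++ [:: true; false] ++ s2) t =
  - q^-1 * pairing_entry q p (s1 ++ [:: false; true] ++ s2) t.
Proof.
move=> pc cc' e1; have pc' : p (inl c') = inl c by rewrite -pc (planar_invol pp).
split=> [b|].
  rewrite /pairing_entry (weight_arc_eq (@rank_inj i j) (x := inl c) _ pp) ?mulr0 //.
  by rewrite pc /= !nth_mid e1 cc' eqxx (_ : c.+1 == c = false) ?eqxx //; lia.
rewrite /pairing_entry mulrCA; congr (_ * _).
apply: (weight_arc_swap (x := inl c) _ pp); rewrite ?pc.
- by rewrite /= cc'.
- by rewrite /= nth_mid e1 eqxx.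
- by rewrite /= nth_mid e1 cc' eqxx (_ : c.+1 == c = false) //; lia.
- by rewrite /= nth_mid e1 eqxx.
- by rewrite /= nth_mid e1 cc' eqxx (_ : c.+1 == c = false) //; lia.
move=> [b|b] //= nc nc'; rewrite !nth_mid e1 -cc'.
have -> : b == c :> nat = false by apply: contraNF nc => /eqP/val_inj->.
by have -> : b == c' :> nat = false by apply: contraNF nc' => /eqP/val_inj->.
Qed.

End DiagramArcs.

(** * Vectors killed by caps *)

Section Invariants.

Variables (K : fieldType) (q : K).
Hypothesis q0 : q != 0.

Local Notation rep := (@state_sum K q _ _).

Lemma sum_words2 (F : seq bool -> K) : \sum_(w <- words 2) F w =
  F [:: true; true] + F [:: true; false] + F [:: false; true] + F [:: false; false].
Proof. by rewrite !sum_wordsS sum_words0 !big_bool /=; ring. Qed.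

(** By counting, the dots of the block cannot all be joined to dots outside. *)
Lemma arc_in_block n x b (p : pairing 0 n) : planar p ->
    (x + b <= n)%N -> (n < b + b)%N ->
  exists c c' : 'I_n, [/\ p (inr c) = inr c', c' = c.+1 :> nat, (x <= c)%N & (c' < x + b)%N].
Proof.
move=> pl xbn nbb; have pp := elimT (planarP _) pl; have pK := planar_invol pp.
have bn (c : 'I_b) : (x + c < n)%N by have := ltn_ord c; lia.
pose d (c : 'I_b) : dots 0 n := inr (Ordinal (bn c)).
have [c [c' [E lt]]] : exists c c' : 'I_b, p (d c) = d c' /\ (c < c')%N.
  have [/existsP[c /existsP[c' /eqP E]]|] := boolP [exists c, exists c', p (d c) == d c'].
    case: (ltngtP c c') => [lt|gt|cc']; first by exists c, c'.
      by exists c', c; rewrite -E pK.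
    by have := planar_fixfree pp (d c); rewrite E (val_inj cc') eqxx.
  rewrite negb_exists => /forallP H.
  (* Otherwise the dots of the block and their partners are 2b > n distinct dots. *)
  pose h (z : 'I_b + 'I_b) : dots 0 n := match z with inl c => d c | inr c => p (d c) end.
  have dI : injective d by move=> c c' [/addnI/val_inj].
  have hI : injective h.
    move=> [c|c] [c'|c'] /= E.
    - by rewrite (dI _ _ E).
    - by have := H c'; rewrite negb_exists => /forallP/(_ c); rewrite -E eqxx.
    - by have := H c; rewrite negb_exists => /forallP/(_ c'); rewrite E eqxx.
    by rewrite (dI _ _ (inv_inj pK E)).
  have := leq_card h hI; rewrite !card_sum !card_ord add0n.
  by rewrite leqNgt nbb.
have [|c1 [c1' [h1 h2 h3 h4]]] := adjacent_cup pl E; first by rewrite ltn_add2l.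
exists c1, c1'; split=> //; rewrite /= in h3 h4; first by lia.
by have := ltn_ord c'; lia.
Qed.

Definition block_sum (v : seq bool -> K) (u : seq bool) (b : nat) (u' : seq bool)
    (r : nat) : K :=
  \sum_(w <- words b) (zeros w == r)%:R * q ^+ zero_positions w * v (u ++ w ++ u').

(** More than half of the dots lie in the block, so every diagram has an adjacent
    pair joined inside of it; exchanging the two letters there changes the sign
    of the summand. This is the action of a divided power of the lowering
    operator of quantum sl2, which kills the invariant vectors. *)
Lemma block_sum0 n (V : TLhom K 0 n) u b u' r :
    (size u + b + size u' = n)%N -> (n < b + b)%N ->
  block_sum (rep V [::]) u b u' r = 0.
Proof.
move=> sn nb; have sw w : size w = b -> size (u ++ w ++ u') = n.
  by move=> s; rewrite !size_cat s; lia.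
transitivity (\sum_d V d * block_sum (pairing_entry q (val d) [::]) u b u' r).
  rewrite /block_sum; under [RHS]eq_bigr do rewrite mulr_sumr.
  rewrite [RHS]exchange_big; apply: eq_words => w ws.
  rewrite /state_sum sw //= eqxx mulr_sumr; apply: eq_bigr => d _; ring.
rewrite big1 // => d _; apply/eqP; rewrite mulf_eq0; apply/orP; right; apply/eqP.
have := valP d; move: (val d) => p pl.
have [|c [c' [pc cc' h1 h2]]] := arc_in_block (x := size u) pl _ nb; first by lia.
have bE : b = ((c - size u) + (2 + (b - (c - size u) - 2)))%N by lia.
rewrite /block_sum bE; move: (b - _ - 2)%N => e.
have {bE} [f Ef] : exists f, (c - size u = f)%N by eexists.
rewrite Ef sum_words_cat; apply: big1_seq => w1 /andP[_]; rewrite mem_words => /eqP s1.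
rewrite sum_words_cat exchange_big; apply: big1_seq => w3 /andP[_]; rewrite mem_words => /eqP s3.
have su1 : size (u ++ w1) = c by rewrite size_cat s1; lia.
have [E1 E2] := entry_cup pl q0 [::] (w3 ++ u') pc cc' su1.
have assoc w : u ++ (w1 ++ w ++ w3) ++ u' = (u ++ w1) ++ w ++ w3 ++ u' by rewrite -!catA.
under eq_bigr do rewrite assoc.
rewrite sum_words2 !E1 E2 !mulr0 !(zero_positions_cat, count_cat) /= !addn0 !add0n.
by rewrite !exprD expr1; ring.
Qed.

Lemma count_sum n (a : pred bool) t : size t = n ->
  (count a t = \sum_(b < n) a (nth false t b))%N.
Proof.
move=> st; rewrite -sum1_count big_mkcond (big_nth false) st big_mkord.
by apply: eq_bigr => b _; case: (a _).
Qed.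

(** A diagram joins a letter true to a letter false. *)
Lemma balanced n (V : TLhom K 0 n) t : ones t != zeros t -> rep V [::] t = 0.
Proof.
move=> nb; have [/eqP st|nst] := boolP (size t == n); last by rewrite rep_size.
rewrite /state_sum st eqxx /=; apply: big1 => d _; apply/eqP; rewrite mulf_eq0.
apply/orP; right; rewrite /pairing_entry mulf_eq0; apply/orP; right.
have pp := elimT (planarP _) (valP d); apply: contraNT nb.
move=> /(weight_neq0 q0 _ (@rank_inj 0 n) pp) H.
have E : (\sum_(x : dots 0 n) dot_state [::] t x = \sum_(x : dots 0 n) ~~ dot_state [::] t x)%N.
  rewrite [LHS](reindex_inj (inv_inj (planar_invol pp))) /=.
  by apply: eq_bigr => x _; rewrite H.
move: E; rewrite !big_sumType /= !big_ord0 !add0n.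
rewrite (count_sum negb st) (count_sum id st) => ->.
by apply/eqP/eq_bigr => b _; rewrite negbK.
Qed.

(** What it means for v to be killed by the cap at the positions c and c + 1. *)
Definition swap_at (v : seq bool -> K) (n c : nat) : Prop :=
  forall t1 t2, size t1 = c -> (size t1 + 2 + size t2 = n)%N ->
    v (t1 ++ [:: true; false] ++ t2) = q * v (t1 ++ [:: false; true] ++ t2).

Definition sorted_word (w : seq bool) : seq bool :=
  nseq (zeros w) false ++ nseq (ones w) true.

Lemma size_sorted w : size (sorted_word w) = size w.
Proof. by rewrite size_cat !size_nseq addnC ones_zeros. Qed.

Lemma sort_block v n u w u' : (size u + size w + size u' = n)%N ->
    (forall c, (size u <= c)%N -> (c.+1 < size u + size w)%N -> swap_at v n c) ->
  v (u ++ w ++ u') = q ^+ inversions w * v (u ++ sorted_word w ++ u').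
Proof.
have bubble a (u1 u2 : seq bool) : (size u1 + a.+1 + size u2 = n)%N ->
    (forall c, (size u1 <= c)%N -> (c < size u1 + a)%N -> swap_at v n c) ->
    v (u1 ++ true :: nseq a false ++ u2) = q ^+ a * v (u1 ++ nseq a false ++ true :: u2).
  elim: a u1 => [|a IH] u1 sn sw; first by rewrite mul1r.
  rewrite /= (sw (size u1) _ _ u1 (nseq a false ++ u2)) ?leqnn //; try lia.
    rewrite /= -cat_rcons IH ?size_rcons; try lia.
      by rewrite cat_rcons exprS mulrA.
    by move=> c h1 h2; apply: sw; lia.
  by rewrite size_cat size_nseq; lia.
elim: w u => [|b w IH] u sn sw; first by rewrite mul1r.
rewrite /= -cat_rcons IH ?size_rcons; [|by rewrite -sn /=; lia|]; last first.
  by move=> c h1 h2; apply: sw => //=; lia.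
rewrite cat_rcons /sorted_word; case: b sn sw => /= sn sw; last by rewrite !add0n.
rewrite add0n -catA bubble.
- by rewrite add0n mulrA -exprD addnC -!catA.
- by have := ones_zeros w; rewrite size_cat size_nseq; lia.
by move=> c h1 h2; apply: sw => //; have := ones_zeros w; lia.
Qed.

Definition cap_free (v : seq bool -> K) (n : nat) : Prop :=
  forall c, (c.+1 < n)%N -> swap_at v n c.

Section CapFree.

Variables (k : nat) (V : TLhom K 0 (k + k)).
Hypothesis free : cap_free (rep V [::]) (k + k).

Local Notation v := (rep V [::]).
Let v0 := v (nseq k false ++ nseq k true).

Lemma cap_free_entry t : size t = (k + k)%N -> ones t = k ->
  v t = q ^+ inversions t * v0.
Proof.
move=> st ot; have zt : zeros t = k by have := ones_zeros t; lia.
have := @sort_block v (k + k) [::] t [::]; rewrite !cats0 /= add0n addn0.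
by rewrite /sorted_word zt ot; apply=> // c _; rewrite st; apply: free.
Qed.

Lemma cap_free_neq0 : V != 0 -> v0 != 0.
Proof.
apply: contra => /eqP z; apply/eqP/(rep_inj q0) => s t.
have [/andP[/nilP-> /eqP st]|] := boolP ((size s == 0%N) && (size t == k + k)%N); last exact: rep_size.
have [/eqP ot|nt] := boolP (ones t == k); first by rewrite cap_free_entry // z mulr0.
by apply: balanced; have := ones_zeros t; lia.
Qed.

(** The entries of a vector killed by all caps are known up to a scalar, so the
    block sum of block_sum0 becomes a Gaussian binomial coefficient. *)
Lemma cap_free_gauss u b r : (size u + b = k + k)%N -> (k < b)%N ->
  (ones u + b = k + r)%N -> v0 * gauss (q ^+ 2) b r = 0.
Proof.
move=> su kb ou; have B : block_sum v u b [::] r = 0.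
  by apply: block_sum0; rewrite ?addn0 //; lia.
have E : q ^+ 'C(r, 2) * block_sum v u b [::] r =
    q ^+ (inversions u + ones u * r) * (v0 * gauss (q ^+ 2) b r).
  rewrite /block_sum /gauss !mulr_sumr; apply: eq_words => w sw.
  case: eqP => [zw|_]; last by rewrite !mul0r !mulr0.
  rewrite cats0 cap_free_entry ?size_cat ?sw //; last first.
    by rewrite count_cat; have := ones_zeros w; lia.
  rewrite inversions_cat zw -exprM mul2n -addnn {2}zero_positionsE zw !exprD /=.
  ring.
move: E; rewrite B mulr0 => /esym/eqP.
by rewrite mulf_eq0 expf_eq0 (negPf q0) andbF => /eqP.
Qed.

End CapFree.

End Invariants.

Section Degree.

Variables (K : fieldType) (q : K).
Hypothesis charK0 : [pchar K] =i pred0.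
Hypothesis q0 : q != 0.
Variable l : nat.
Hypothesis l_gt1 : (1 < l)%N.
Hypothesis prim : l.-primitive_root (q ^+ 2).

Local Notation rep := (@state_sum K q _ _).
Local Notation z := (q ^+ 2).

Lemma ones_nseq m b : ones (nseq m b) = (b * m)%N.
Proof. by rewrite count_nseq; case: b. Qed.

Lemma root_dvd m : (z ^+ m - 1 == 0) = (l %| m)%N.
Proof. by rewrite subr_eq0 -(prim_order_dvd prim). Qed.

(** Write n = 2k. The block of length k + 1 with one letter false gives
    z^(k+1) = 1, that is k + 1 = ml. If m > 1, the same block with l letters false,
    after a word with l - 1 letters true, gives m = 0 by gauss_multiple. *)
Theorem cap_free_degree n (V : TLhom K 0 n) : V != 0 -> (0 < n)%N ->
  cap_free q (rep V [::]) n -> n = (l.-1 + l.-1)%N.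
Proof.
move=> nV n0 fV.
have [k nk] : exists k, n = (k + k)%N.
  exists (n./2); rewrite addnn; have [on|en] := boolP (odd n); last by rewrite even_halfK.
  case/eqP: nV; apply: (rep_inj q0) => s t.
  have [/andP[/nilP-> /eqP st]|] := boolP ((size s == 0%N) && (size t == n)); last exact: rep_size.
  apply: balanced => //; apply: contraTN on => /eqP E.
  by rewrite -st -(ones_zeros t) E addnn odd_double.
move: V nV fV n0; rewrite nk => V nV fV k0.
have v0 := cap_free_neq0 q0 fV nV.
have g0 u b r : (size u + b = k + k)%N -> (k < b)%N -> (ones u + b = k + r)%N ->
    gauss z b r = 0.
  move=> h1 h2 h3; have /eqP := @cap_free_gauss K q q0 k V fV u b r h1 h2 h3.
  by rewrite mulf_eq0 (negPf v0) => /eqP.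
have lk : (l %| k.+1)%N.
  rewrite -root_dvd; have := gauss_ratio z k.+1 0.
  rewrite (g0 (nseq k.-1 false)) ?mulr0 ?gauss_r0 ?mulr1 ?expr0 => [<- //|||].
  - by rewrite size_nseq; lia.
  - by [].
  - by rewrite ones_nseq; lia.
have [m km] := dvdnP lk.
have [m1|m1] := leqP m 1; first by case: m km m1 => [|[|//]] km _; lia.
have lm : (l * 2 <= m * l)%N by rewrite mulnC leq_mul2r m1 orbT.
(* The l - 1 letters true make up for the l letters false of the block, so that
   the words that occur are balanced. *)
have := g0 (nseq (k.-1 - l.-1) false ++ nseq l.-1 true) (m * l)%N l.
rewrite size_cat !size_nseq count_cat !ones_nseq gauss_multiple //.
move=> /(_ ltac:(lia) ltac:(lia) ltac:(lia)) /eqP.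
rewrite mulf_eq0 (negPf (gauss_diag l _)) ?expf_neq0 // orbF (iffLR (pcharf0P K) charK0) => /eqP m0.
by rewrite m0 in m1.
Qed.

(** When all caps but the middle one kill a vector of length 2(l-1), its entries
    are determined on each half up to one scalar for each number of letters true
    on the left. The invariance under the lowering operator relates these
    scalars, with the same ratio as if the middle cap killed the vector too. *)
Lemma cap_free_middle (V : TLhom K 0 (l.-1 + l.-1)) :
    (forall c, c.+1 != l.-1 -> (c.+1 < l.-1 + l.-1)%N ->
       swap_at q (rep V [::]) (l.-1 + l.-1) c) ->
  cap_free q (rep V [::]) (l.-1 + l.-1).
Proof.
set a := l.-1; set v := rep V [::]; move=> sw c cn.
have [ca|] := eqVneq c.+1 a; last by move=> h; apply: sw.
have sort2 w1 w2 : size w1 = a -> size w2 = a ->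
    v (w1 ++ w2) = q ^+ (inversions w1 + inversions w2) * v (sorted_word w1 ++ sorted_word w2).
  move=> s1 s2.
  have := @sort_block K q q0 v (a + a) [::] w1 w2; rewrite /= add0n s1 s2 => ->//; last first.
    by move=> d _ h; apply: sw; lia.
  have := @sort_block K q q0 v (a + a) (sorted_word w1) w2 [::].
  rewrite !cats0 size_sorted s1 s2 addn0 => ->//; first by rewrite exprD mulrA.
  by move=> d h1 h2; apply: sw; lia.
(* Sorted on both halves, with j letters true on the left: the scalars on which
   the entries of v depend. *)
pose mu j := v ((nseq (a - j) false ++ nseq j true) ++ (nseq j false ++ nseq (a - j) true)).
have vmu w1 w2 j : size w1 = a -> size w2 = a -> ones w1 = j -> ones w2 = (a - j)%N ->
    v (w1 ++ w2) = q ^+ (inversions w1 + inversions w2) * mu j.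
  move=> s1 s2 o1 o2; rewrite sort2 // /sorted_word /mu.
  have := ones_zeros w1; have := ones_zeros w2; rewrite o1 o2 s1 s2 => z2 z1.
  have -> : zeros w1 = (a - j)%N by lia.
  by have -> : zeros w2 = j by lia.
(* The block of length l that ends at letter a + a - (j - 1) straddles the middle:
   its single letter false is on the left or on the right of it. *)
have ratio j : (0 < j <= a)%N -> mu j = q ^+ (j * 2).-1 * mu j.-1.
  move=> /andP[j0 ja]; set u := nseq (a - j) false; set u' := nseq j.-1 false.
  have B : block_sum q v u a.+1 u' 1 = 0.
    by apply: block_sum0; rewrite ?size_nseq; lia.
  have su : size u = (a - j)%N by rewrite size_nseq.
  have su' : size u' = j.-1 by rewrite size_nseq.
  have inv0 m : inversions (nseq m false) = 0%N by elim: m.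
  pose c1 := q ^+ ((a.+1 - j) * j.-1) * mu j.-1.
  pose c2 := q ^+ (j + (a - j) * j.-1) * mu j.
  have E : block_sum q v u a.+1 u' 1 =
      gauss z j 1 * gauss z (a.+1 - j) 0 * c1 + gauss z j 0 * gauss z (a.+1 - j) 1 * c2.
    rewrite /block_sum (_ : words a.+1 = words (j + (a.+1 - j))); last by congr words; lia.
    rewrite sum_words_cat /gauss !mulr_suml -big_split; apply: eq_words => w1 h1 /=.
    rewrite !mulr_sumr !mulr_suml -big_split; apply: eq_words => w2 h2 /=.
    have o1 := ones_zeros w1; have o2 := ones_zeros w2.
    have -> : u ++ (w1 ++ w2) ++ u' = (u ++ w1) ++ (w2 ++ u') by rewrite -!catA.
    rewrite count_cat zero_positions_cat h1.
    have [/andP[/eqP z1 /eqP z2]|n1] := boolP ((zeros w1 == 1%N) && (zeros w2 == 0%N)).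
      rewrite z1 z2 /= (vmu _ _ j.-1) ?size_cat ?count_cat ?ones_nseq; try lia.
      rewrite !inversions_cat !inv0 ones_nseq /c1 (zero_positionsE w1) (zero_positionsE w2).
      rewrite z1 z2 /= (_ : ones w2 = (a.+1 - j)%N); last by lia.
      rewrite (_ : zeros u' = j.-1) ?count_nseq ?mul1n // -!exprM !mul2n -!addnn.
      by rewrite !exprD ?muln0 ?mul0n ?expr0; ring.
    have [/andP[/eqP z1 /eqP z2]|n2] := boolP ((zeros w1 == 0%N) && (zeros w2 == 1%N)).
      rewrite z1 z2 /= (vmu _ _ j) ?size_cat ?count_cat ?ones_nseq; try lia.
      rewrite !inversions_cat !inv0 ones_nseq /c2 (zero_positionsE w1) (zero_positionsE w2).
      rewrite z1 z2 /= (_ : ones w2 = (a - j)%N); last by lia.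
      rewrite (_ : zeros u' = j.-1) ?count_nseq ?mul1n // -!exprM !mul2n -!addnn.
      by rewrite !exprD ?muln0 ?mul0n ?muln1 ?expr0; ring.
    have -> : (zeros w1 + zeros w2 == 1)%N = false by lia.
    move: n1 n2; case: (zeros w1 == 1%N); case: (zeros w2 == 0%N);
      case: (zeros w1 == 0%N); case: (zeros w2 == 1%N) => //= _ _;
      by rewrite ?(mul0r, mulr0, addr0).
  have zb b : (z - 1) * gauss z b 1 = z ^+ b - 1.
    by have := gauss_ratio z b 0; rewrite gauss_r0 mulr1 expr0 expr1.
  have zj : z ^+ j - 1 != 0.
    rewrite root_dvd; apply/negP => /dvdn_leq -/(_ j0); lia.
  (* Since z ^+ l = 1, both terms carry the factor z ^+ j - 1, which cancels as
     j < l. *)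
  have zlj : z ^+ j * (z ^+ (a.+1 - j) - 1) = 1 - z ^+ j.
    rewrite mulrBr mulr1 -exprD subnKC; last by lia.
    by rewrite (_ : a.+1 = l) ?(prim_expr_order prim) // /a prednK // ltnW.
  move: E; rewrite B !gauss_r0 mulr1 mul1r => /esym /(f_equal (fun x => z ^+ j * ((z - 1) * x))).
  rewrite !mulr0 mulrDr ![(z - 1) * (_ * _)]mulrA !zb mulrDr [X in _ + X]mulrA zlj => E.
  have {}E : (z ^+ j - 1) * (z ^+ j * c1 - c2) = 0 by rewrite -E; ring.
  move/eqP: E; rewrite mulf_eq0 (negPf zj) /= subr_eq0 /c1 /c2 => /eqP E.
  have qk : q ^+ (j + (a - j) * j.-1) != 0 by rewrite expf_neq0.
  apply: (mulfI qk); rewrite -E !mulrA; congr (_ * _); rewrite -exprM -!exprD.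
  congr (_ ^+ _); have -> : (a.+1 - j = (a - j).+1)%N by lia.
  rewrite mulSn; lia.
move=> t1 t2 s1 s2.
have s1' : size t1 = a.-1 by lia.
have s2' : size t2 = a.-1 by lia.
have r1 b b' : t1 ++ [:: b; b'] ++ t2 = (t1 ++ [:: b]) ++ (b' :: t2) by rewrite -catA.
have [E|NE] := eqVneq (ones t1 + ones t2)%N a.-1; last first.
  rewrite /v !balanced ?mulr0 //.
    by rewrite !count_cat /=; have := ones_zeros t1; have := ones_zeros t2; lia.
  by rewrite !count_cat /=; have := ones_zeros t1; have := ones_zeros t2; lia.
rewrite !r1 (vmu _ _ (ones t1).+1) ?size_cat ?count_cat /=; try lia.
rewrite ratio; last by lia.
rewrite (vmu _ _ (ones t1)) ?size_cat ?count_cat /=; try lia.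
rewrite mulrA -exprD mulrA -exprS; congr (_ ^+ _ * _).
rewrite !inversions_cat /=; have := ones_zeros t2; lia.
Qed.

End Degree.

(** * Diagrams with cups and caps *)

Section Endomorphisms.

Variable n : nat.

Lemma increasing_id (h : 'I_n -> 'I_n) :
  (forall a b : 'I_n, (a < b)%N -> (h a < h b)%N) -> h =1 id.
Proof.
move=> inc.
have lo k (a : 'I_n) : a = k :> nat -> (k <= h a)%N.
  elim: k a => // k IH a ak; have kn : (k < n)%N by have := ltn_ord a; lia.
  by have := IH (Ordinal kn) erefl; have := inc (Ordinal kn) a; rewrite /= ak; lia.
have hi k (a : 'I_n) : (a + k).+1 = n -> (h a + k < n)%N.
  elim: k a => [|k IH] a ak; first by rewrite addn0.
  have kn : (a.+1 < n)%N by lia.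
  have := inc a (Ordinal kn); have := IH (Ordinal kn); rewrite /=; lia.
move=> a; apply/val_inj/eqP; rewrite eqn_leq lo // andbT.
have := hi (n - a.+1)%N a; have := ltn_ord a => /= h1 h2.
by have := h2 ltac:(lia); lia.
Qed.

Variable p : pairing n n.
Hypothesis pl : planar p.

Let pp : planar_involution (@rank n n) p := elimT (planarP _) pl.

(** Without caps the lower dots go injectively up, and in increasing order. *)
Lemma no_cap_id : (forall a a', p (inl a) != inl a') -> p = id_pairing n.
Proof.
move=> nc; have pK := planar_invol pp.
have hP a : {b | p (inl a) = inr b}.
  case E: (p (inl a)) => [a'|b]; last by exists b.
  by move: (nc a a'); rewrite E eqxx.
pose h a := sval (hP a); have hE a : p (inl a) = inr (h a) by rewrite /h; case: (hP a).
have inc (a b : 'I_n) : (a < b)%N -> (h a < h b)%N.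
  move=> ab; have := @planar_nested _ _ _ pp (inl a) (inl b).
  rewrite !hE /= ab; have := ltn_ord b; have := ltn_ord (h a); have := ltn_ord (h b).
  move=> h1 h2 h3 H; have := H ltac:(lia); lia.
have hid := increasing_id inc; apply/ffunP => -[a|b]; rewrite ffunE.
  by rewrite hE hid.
by rewrite -[inr b](_ : p (inl b) = _) ?pK // hE hid.
Qed.

Lemma no_cup_id : (forall b b', p (inr b) != inr b') -> p = id_pairing n.
Proof.
move=> nc; apply: no_cap_id => a a'; apply/negP => /eqP E; have pK := planar_invol pp.
have hP b : {a | p (inr b) = inl a}.
  case E': (p (inr b)) => [c|b']; first by exists c.
  by move: (nc b b'); rewrite E' eqxx.
pose h b := sval (hP b); have hE b : p (inr b) = inl (h b) by rewrite /h; case: (hP b).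
have hI : injective h.
  by move=> b b' hb; have := hE b; rewrite hb -hE => /(inv_inj pK) [].
have := injF_onto hI a => /codomP[b ab].
by have := hE b; rewrite -ab => /(f_equal p); rewrite pK E.
Qed.

Lemma not_id_has_cap : p != id_pairing n ->
  exists c c' : 'I_n, p (inl c) = inl c' /\ c' = c.+1 :> nat.
Proof.
move=> ni; have [/existsP[a /existsP[a' /eqP E]]|H] := boolP [exists a, exists a', p (inl a) == inl a'].
  case: (ltngtP a a') => [lt|gt|aa'].
  - exact: (adjacent_cap pl E lt).
  - by apply: (adjacent_cap pl _ gt); rewrite -E (planar_invol pp).
  by have := planar_fixfree pp (inl a); rewrite E (val_inj aa') eqxx.
case/eqP: ni; apply: no_cap_id => a a'; apply: contra H => E.
by apply/existsP; exists a; apply/existsP; exists a'.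
Qed.

Lemma not_id_has_cup : p != id_pairing n ->
  exists c c' : 'I_n, p (inr c) = inr c' /\ c' = c.+1 :> nat.
Proof.
move=> ni; have [/existsP[a /existsP[a' /eqP E]]|H] := boolP [exists a, exists a', p (inr a) == inr a'].
  case: (ltngtP a a') => [lt|gt|aa'].
  - by have [c [c' [? ? _ _]]] := adjacent_cup pl E lt; exists c, c'.
  - have E' : p (inr a') = inr a by rewrite -E (planar_invol pp).
    by have [c [c' [? ? _ _]]] := adjacent_cup pl E' gt; exists c, c'.
  by have := planar_fixfree pp (inr a); rewrite E (val_inj aa') eqxx.
case/eqP: ni; apply: no_cup_id => a a'; apply: contra H => E.
by apply/existsP; exists a; apply/existsP; exists a'.
Qed.

Lemma has_arc_not_id (d : diagram n n) : has_cup d || has_cap d -> val d != id_pairing n.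
Proof.
case/orP=> /existsP[a /existsP[a' /eqP E]]; apply/eqP => E'; move: E;
by rewrite E' ffunE.
Qed.

End Endomorphisms.

Definition identity_diagram n : diagram n n := exist _ (id_pairing n) (id_planar n).

Section Caps.

Variables (K : fieldType) (q : K).
Hypothesis q0 : q != 0.

Local Notation delta := (- q - q^-1).
Local Notation idM := (@id_wmatrix K).
Local Notation "A *[ n ] B" := (mulM n A B) (at level 40, left associativity).
Local Notation "A *t[ i , j ] B" := (tensM i j A B) (at level 39, left associativity).
Local Notation TLmx := (@TL_matrix K q).
Local Notation rep := (@state_sum K q _ _).
Local Notation ev n := (rep (evT K n)).
Local Notation co n := (rep (coT K n)).
Implicit Types A B X Y : wmatrix K.

Lemma ev1 b c : ev 1 [:: b; c] [::] = arc_weight q b c.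
Proof.
rewrite -cat1s rep_ev // /dual_word /arc_weight.
by case: b; case: c; rewrite /= ?eqxx /= ?mul0r // mul1r ?expr0 ?invr1 // expr1 invrN.
Qed.

Lemma co1 b c : co 1 [::] [:: b; c] = - q * arc_weight q b c.
Proof.
rewrite -cat1s rep_co // /dual_word /arc_weight.
case: b; case: c; rewrite /= ?eqxx /= ?mul0r ?mulr0 // mul1r ?expr0 ?expr1 ?mulr1 //.
by rewrite mulrNN divff.
Qed.

Definition capM (x e : nat) : wmatrix K := idM x *t[x, x] (ev 1 *t[2, 0] idM e).
Definition cupM (x e : nat) : wmatrix K := idM x *t[x, x] (co 1 *t[0, 2] idM e).

Lemma hom_cap x e : TLmx (x + (2 + e)) (x + e) (capM x e).
Proof.
apply: hom_tens => //; first exact: hom_id.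
exact: (hom_tens q0 (hom_rep q (evT K 1)) (hom_id q0 e)).
Qed.

Lemma hom_cup x e : TLmx (x + e) (x + (2 + e)) (cupM x e).
Proof.
apply: hom_tens => //; first exact: hom_id.
exact: (hom_tens q0 (hom_rep q (coT K 1)) (hom_id q0 e)).
Qed.

Lemma capM_entry x e s1 b c s2 w : size s1 = x -> size s2 = e ->
  capM x e (s1 ++ [:: b; c] ++ s2) w = arc_weight q b c * (s1 ++ s2 == w)%:R.
Proof.
move=> h1 h2; have [/eqP sw|nw] := boolP (size w == x + e)%N; last first.
  rewrite (hom_out (hom_cap x e)) ?(negPf nw) ?andbF //.
  rewrite (_ : _ == w = false) ?mulr0 //; apply: contraNF nw => /eqP <-.
  by rewrite size_cat h1 h2.
rewrite /capM /tensM take_size_cat // drop_size_cat // take0 drop0.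
rewrite take_size_cat // drop_size_cat // ev1 /id_wmatrix h1 h2 !eqxx /=.
rewrite mulrCA -natrM mulnb -[w in RHS](cat_take_drop x) eqseq_cat //.
by rewrite size_take sw h1; case: ltnP => //; lia.
Qed.

Lemma cupM_entry x e w s1 b c s2 : size s1 = x -> size s2 = e ->
  cupM x e w (s1 ++ [:: b; c] ++ s2) = - q * arc_weight q b c * (s1 ++ s2 == w)%:R.
Proof.
move=> h1 h2; have [/eqP sw|nw] := boolP (size w == x + e)%N; last first.
  rewrite (hom_out (hom_cup x e)) ?(negPf nw) //.
  rewrite (_ : _ == w = false) ?mulr0 //; apply: contraNF nw => /eqP <-.
  by rewrite size_cat h1 h2.
rewrite /cupM /tensM take_size_cat // drop_size_cat // take0 drop0.
rewrite take_size_cat // drop_size_cat // co1 /id_wmatrix.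
have st : size (take x w) = x by rewrite size_take sw; case: ltnP => //; lia.
have sd : size (drop x w) = e by rewrite size_drop sw addKn.
rewrite st sd !eqxx /= mulrCA -natrM mulnb -[w in RHS](cat_take_drop x) [in RHS]eq_sym.
by rewrite eqseq_cat // st h1.
Qed.

Lemma sum_words_mid x e (F : seq bool -> K) :
  \sum_(w <- words (x + (2 + e))) F w =
  \sum_(w1 <- words x) \sum_(w2 <- words e) \sum_(w <- words 2) F (w1 ++ w ++ w2).
Proof.
by rewrite sum_words_cat; apply: eq_bigr => w1 _; rewrite sum_words_cat exchange_big.
Qed.

Lemma mul_cap x e A s t1 t2 : size t1 = x -> size t2 = e ->
  (A *[x + (2 + e)] capM x e) s (t1 ++ t2) =
  A s (t1 ++ [:: false; true] ++ t2) - q^-1 * A s (t1 ++ [:: true; false] ++ t2).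
Proof.
move=> h1 h2; rewrite /mulM sum_words_mid.
transitivity (\sum_(w1 <- words x) (t1 == w1)%:R * (\sum_(w2 <- words e) (t2 == w2)%:R *
   (A s (w1 ++ [:: false; true] ++ w2) - q^-1 * A s (w1 ++ [:: true; false] ++ w2)))).
  apply: eq_words => w1 s1; rewrite mulr_sumr; apply: eq_words => w2 s2.
  rewrite sum_words2 !capM_entry // /arc_weight /=.
  rewrite eqseq_cat ?s1 ?h1 // [w1 == _]eq_sym [w2 == _]eq_sym -mulnb natrM.
  by ring.
by rewrite !sum_words_delta.
Qed.

Lemma swap_at_cap n c A : (c.+1 < n)%N ->
    A *[c + (2 + (n - c - 2))] capM c (n - c - 2) = (fun _ _ => 0) ->
  swap_at q (A [::]) n c.
Proof.
move=> cn E t1 t2 s1 s2.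
have := f_equal (fun B => B [::] (t1 ++ t2)) E; rewrite mul_cap //; last by lia.
by move=> /eqP; rewrite subr_eq0 => /eqP ->; rewrite mulVKf.
Qed.

Lemma cap_mul_eq x e s1 b s2 Y : size s1 = x -> size s2 = e ->
  (capM x e *[x + e] Y) (s1 ++ [:: b; b] ++ s2) [::] = 0.
Proof.
move=> h1 h2; rewrite /mulM big1 // => w _.
by rewrite capM_entry // /arc_weight addbb !mul0r.
Qed.

Lemma split_mid x e (s : seq bool) : size s = (x + (2 + e))%N ->
  exists s1 b c s2, [/\ s = s1 ++ [:: b; c] ++ s2, size s1 = x & size s2 = e].
Proof.
move=> ss; have := size_drop x s; rewrite ss addKn.
have st : size (take x s) = x by rewrite size_take ss; case: ltnP => //; lia.
case E : (drop x s) => [|b [|c s2]] //= [se].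
by exists (take x s), b, c, s2; rewrite -[s in LHS](cat_take_drop x) E.
Qed.

Lemma mul_cap_left x e (s1 : seq bool) b c s2 Y t : size s1 = x -> size s2 = e ->
  (capM x e *[x + e] Y) (s1 ++ [:: b; c] ++ s2) t = arc_weight q b c * Y (s1 ++ s2) t.
Proof.
move=> h1 h2.
transitivity (\sum_(w <- words (x + e)) (s1 ++ s2 == w)%:R * (arc_weight q b c * Y w t)).
  by apply: eq_bigr => w _; rewrite capM_entry // mulrAC mulrC.
by rewrite sum_words_delta // size_cat h1 h2.
Qed.

Lemma mul_cup_left x e (s1 s2 : seq bool) Y t : size s1 = x -> size s2 = e ->
  (cupM x e *[x + (2 + e)] Y) (s1 ++ s2) t =
  Y (s1 ++ [:: true; false] ++ s2) t - q * Y (s1 ++ [:: false; true] ++ s2) t.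
Proof.
move=> h1 h2; rewrite /mulM sum_words_mid.
transitivity (\sum_(w1 <- words x) (s1 == w1)%:R * (\sum_(w2 <- words e) (s2 == w2)%:R *
   (Y (w1 ++ [:: true; false] ++ w2) t - q * Y (w1 ++ [:: false; true] ++ w2) t))).
  apply: eq_words => w1 e1; rewrite mulr_sumr; apply: eq_words => w2 e2.
  rewrite sum_words2 !cupM_entry // /arc_weight /=.
  rewrite eqseq_cat ?e1 ?h1 // [w1 == _]eq_sym [w2 == _]eq_sym -mulnb natrM.
  by field.
by rewrite !sum_words_delta.
Qed.

(** A diagram with a cap factors through that cap: closing the cap off with a cup
    produces a loop, of value delta. *)
Lemma cap_factor i j (x e : nat) (p : pairing i j) (c c' : 'I_i) :
    delta != 0 -> planar p -> p (inl c) = inl c' -> c' = c.+1 :> nat ->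
    x = c -> (x + (2 + e) = i)%N ->
  exists2 B, TLmx (x + e) j B & rep (dvec K p) = capM x e *[x + e] B.
Proof.
move=> d0 pl pc cc' xc ie.
have hp := hom_rep q (dvec K p).
exists (cupM x e *[i] rep (delta^-1 *: dvec K p)).
  have hcu := hom_cup x e; rewrite {1}ie in hcu; exact: (hom_mul q0 hcu (hom_rep q _)).
have hB : TLmx (x + e) j (cupM x e *[i] rep (delta^-1 *: dvec K p)).
  have hcu := hom_cup x e; rewrite {1}ie in hcu; exact: (hom_mul q0 hcu (hom_rep q _)).
have hcp := hom_cap x e; rewrite {1}ie in hcp.
apply: (eq_hom hp (hom_mul q0 hcp hB)) => s t ss st.
have [s1 [b [b' [s2 [-> h1 h2]]]]] := split_mid (etrans ss (esym ie)).
have M := mul_cup_left (rep (delta^-1 *: dvec K p)) t h1 h2; rewrite {1}ie in M.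
rewrite mul_cap_left // M !repZ.
have sz w : size w = 2 -> size (s1 ++ w ++ s2) = i.
  by move=> sw; rewrite !size_cat sw h1 h2.
rewrite !rep_dvec ?sz //.
have [E1 E2] := entry_cap pl q0 s2 t pc cc' (etrans h1 xc).
have key y : delta^-1 * (- q^-1 * y) - q * (delta^-1 * y) = y.
  by rewrite -[RHS](mulKf d0); move: (_^-1) => r; ring.
rewrite E2 key /arc_weight.
by case: b; case: b'; rewrite ?E1 ?E2 /= ?mul0r ?mul1r.
Qed.

End Caps.

(** * Vectors in proper ideals *)

Section CappedVectors.

Variables (K : fieldType) (q : K).
Hypothesis q0 : q != 0.

Local Notation delta := (- q - q^-1).
Local Notation idM := (@id_wmatrix K).
Local Notation "A *[ n ] B" := (mulM n A B) (at level 40, left associativity).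
Local Notation "A *t[ i , j ] B" := (tensM i j A B) (at level 39, left associativity).
Local Notation TLmx := (@TL_matrix K q).
Local Notation rep := (@state_sum K q _ _).
Local Notation ev n := (rep (evT K n)).
Local Notation co n := (rep (coT K n)).
Local Notation J := (@annihilated K q).
Implicit Types A B X Y : wmatrix K.

Lemma diagram_expansion i j (f : TLhom K i j) : f = \sum_d f d *: dvec K (val d).
Proof.
apply/ffunP => d; rewrite sum_ffunE (bigD1 d) //= big1 => [|e ed].
  by rewrite !ffunE eqxx addr0 [_ *: _]mulr1.
by rewrite !ffunE val_eqE eq_sym (negPf ed) [_ *: _]mulr0.
Qed.

Lemma rep_eq0 i j (f : TLhom K i j) : rep f = (fun _ _ => 0) -> f = 0.
Proof. by move=> E; apply: (rep_inj q0) => s t; rewrite E. Qed.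

Lemma capped_zero n c (V : TLhom K 0 n) : (c.+1 < n)%N ->
    (forall g : TLhom K 0 (c + (n - c - 2)),
       rep g = rep V *[c + (2 + (n - c - 2))] capM q c (n - c - 2) -> g = 0) ->
  swap_at q (rep V [::]) n c.
Proof.
move=> cn H; apply: swap_at_cap => //.
have hV := hom_rep q V; have en : n = (c + (2 + (n - c - 2)))%N by lia.
rewrite {1}en in hV; have [g Eg] := hom_mul q0 hV (hom_cap q0 c (n - c - 2)).
rewrite -Eg (H g Eg); apply: wmatrixP => s t; exact: rep0.
Qed.

Lemma annihilated_vector n (W : TLhom K 0 n) :
    (forall Y, TLmx n 0 Y -> (rep W *[n] Y) [::] [::] = 0) -> J W.
Proof.
move=> H; apply: bend_annihilated => // X hX; suff -> : bend q 0 (rep W) = rep W by exact: H.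
rewrite /bend tensM_id0; have -> : co 0 = idM 0.
  apply: (eq_hom (hom_rep q (coT K 0)) (hom_id q0 0)) => s t /size0nil-> /size0nil->.
  by have := rep_co q0 (erefl (size [::])) (erefl (size [::])); rewrite /= mulr1 => ->.
exact: (mul_idM q0 (hom_rep q W)).
Qed.

Section OneIdeal.

Variable I : forall i j : nat, TLhom K i j -> Prop.
Hypothesis idI : tensor_ideal delta I.

Lemma ideal_capped n c (V : TLhom K 0 n) (g : TLhom K 0 (c + (n - c - 2))) :
    (c.+1 < n)%N -> I V ->
    rep g = rep V *[c + (2 + (n - c - 2))] capM q c (n - c - 2) -> I g.
Proof.
move=> cn IV Eg; apply/(in_ideal_rep q0); rewrite Eg.
have en : n = (c + (2 + (n - c - 2)))%N by lia.
have IV' := proj2 (in_ideal_rep q0 I V) IV; rewrite {1}en in IV'.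
exact: (in_ideal_mulr q0 idI IV' (hom_cap q0 _ _)).
Qed.

Hypothesis proper : ~ I (idT K 0).

Lemma proper_scalar (V : TLhom K 0 0) : I V -> V = 0.
Proof.
move=> IV; have [//|nV] := eqVneq V 0; case: proper.
rewrite (scalar_hom q0 V) in IV nV; set c := rep V _ _ in IV nV.
have c0 : c != 0 by apply: contraNneq nV => ->; rewrite scale0r.
by rewrite -[idT K 0]scale1r -(mulVf c0) -scalerA; apply: (ideal_scale q0 idI).
Qed.

End OneIdeal.

End CappedVectors.

(** * The trace pairing on endomorphisms *)

Section ClosingPairing.

Variables (K : fieldType) (q : K).
Hypothesis q0 : q != 0.
Variable n : nat.

Local Notation idM := (@id_wmatrix K).
Local Notation "A *[ n ] B" := (mulM n A B) (at level 40, left associativity).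
Local Notation "A *t[ i , j ] B" := (tensM i j A B) (at level 39, left associativity).
Local Notation rep := (@state_sum K q _ _).
Local Notation ev n := (rep (evT K n)).
Implicit Types X : wmatrix K.

Definition close_bent (f : TLhom K n n) X : K := (bend q n (rep f) *[n + n] X) [::] [::].

Lemma close_bentD f g X : close_bent (f + g) X = close_bent f X + close_bent g X.
Proof.
rewrite /close_bent /bend /mulM -big_split; apply: eq_bigr => u _ /=.
rewrite -mulrDl -big_split; congr (_ * _); apply: eq_bigr => v _ /=.
by rewrite /tensM repD; ring.
Qed.

Lemma close_bentZ c f X : close_bent (c *: f) X = c * close_bent f X.
Proof.
rewrite /close_bent /bend /mulM mulr_sumr; apply: eq_bigr => u _ /=.
rewrite mulrA; congr (_ * _); rewrite mulr_sumr; apply: eq_bigr => v _ /=.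
by rewrite /tensM repZ; ring.
Qed.

(** By open_close every functional on bent endomorphisms is of this form. *)
Definition closing (g : TLhom K n n) : wmatrix K := (idM n *t[n, n] rep g) *[n + n] ev n.

Lemma closing_entry g s u : size s = n -> size u = n ->
  closing g (s ++ u) [::] = rep g u (dual_word s) * (- q) ^- ones s.
Proof.
move=> ss su; rewrite /closing /mulM sum_words_cat.
transitivity (\sum_(s' <- words n) (s == s')%:R * (\sum_(w <- words n)
   (dual_word s == w)%:R * (rep g u w * (- q) ^- ones s))).
  apply: eq_words => s' hs'; rewrite mulr_sumr; apply: eq_words => w hw.
  rewrite /tensM !take_size_cat // !drop_size_cat // rep_ev // /id_wmatrix ss eqxx /=.
  by case: eqP => [<-|_]; rewrite ?mul0r // -(inv_eq dual_wordK); ring.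
by rewrite sum_words_delta // sum_words_delta // size_dual.
Qed.

Lemma bend_entry (f : TLhom K n n) s u : size s = n -> size u = n ->
  bend q n (rep f) [::] (s ++ u) = (- q) ^+ zeros s * rep f (dual_word s) u.
Proof.
move=> ss su; rewrite /bend /mulM sum_words_cat.
transitivity (\sum_(s' <- words n) (s == s')%:R * (\sum_(w <- words n)
   (dual_word s == w)%:R * ((- q) ^+ zeros s * rep f w u))).
  apply: eq_words => s' hs'; rewrite mulr_sumr; apply: eq_words => w hw.
  rewrite /tensM !take_size_cat // !drop_size_cat // rep_co // /id_wmatrix hs' eqxx /=.
  rewrite [s' == s]eq_sym (inv_eq dual_wordK).
  case: (eqVneq s s') => [<-|_]; last by rewrite !(mul0r, mulr0).
  case: (eqVneq s (dual_word w)) => [->|_]; last by rewrite !(mul0r, mulr0).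
  have -> : zeros (dual_word w) = ones w.
    by rewrite /dual_word count_rev count_map; apply: eq_count => b /=; rewrite negbK.
  by rewrite /= !mul1r.
by rewrite sum_words_delta // sum_words_delta // size_dual.
Qed.

(** A diagram other than the identity has a cap, which joins two equal letters
    here. *)
Lemma entry_all_false (p : pairing n n) : planar p -> p != id_pairing n ->
  pairing_entry q p (nseq n false) (nseq n false) = 0.
Proof.
move=> pl ni; have [c [c' [pc _]]] := not_id_has_cap pl ni.
have pp := elimT (planarP _) pl.
rewrite /pairing_entry (weight_arc_eq (@rank_inj n n) (x := inl c) _ pp) ?mulr0 //.
by rewrite pc /= !nth_nseq !ltn_ord.
Qed.

Lemma id_coefficient (g : TLhom K n n) :
  g (identity_diagram n) = rep g (nseq n false) (nseq n false).
Proof.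
rewrite /state_sum !size_nseq !eqxx /= (bigD1 (identity_diagram n)) //= big1 => [|d nd].
  rewrite addr0 -(rep_dvec q (id_planar n)) ?size_nseq //.
  by rewrite -/(idT K n) rep_id // size_nseq !eqxx mulr1.
rewrite entry_all_false ?mulr0 ?(valP d) //.
Qed.

(** There is one condition less than there are coefficients. *)
Lemma exists_orthogonal : exists2 f : TLhom K n n, f != 0 &
  forall d : diagram n n, val d != id_pairing n ->
    close_bent f (closing (dvec K (val d))) = 0.
Proof.
pose D := diagram n n : finType.
(* The trace form with the column of the identity replaced by 0; an element of
   the left kernel of this singular matrix gives f. *)
pose M := \matrix_(i < #|D|, j < #|D|)
  (if enum_val j == (identity_diagram n) then 0
   else close_bent (dvec K (val (enum_val i : D))) (closing (dvec K (val (enum_val j : D))))).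
have detM : \det M == 0.
  rewrite (expand_det_col _ (enum_rank (identity_diagram n))) big1 // => i _.
  by rewrite mxE enum_rankK eqxx mul0r.
have /det0P[v nv vM] := detM.
pose f : TLhom K n n := [ffun d => v 0 (enum_rank d)].
exists f.
  apply: contraNneq nv => f0; apply/eqP/rowP => i; rewrite mxE.
  by have /ffunP/(_ (enum_val i)) := f0; rewrite !ffunE enum_valK.
move=> d nd; rewrite [f]diagram_expansion.
rewrite (big_morph (fun g => close_bent g _) (fun g h => close_bentD g h _) (_ : _ = 0)); last first.
  by rewrite -(scale0r 0) close_bentZ mul0r.
have /rowP/(_ (enum_rank d)) := vM; rewrite !mxE => E.
rewrite -[RHS]E (reindex_onto (@enum_val D predT) (@enum_rank D)) /=; last by move=> *; rewrite enum_rankK.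
apply: eq_big => [i|i _]; first by rewrite enum_valK eqxx.
rewrite mxE enum_rankK close_bentZ ffunE enum_valK ifN //.
Qed.

End ClosingPairing.

Section RootOfUnity.

Variables (K : fieldType) (q : K).
Hypothesis charK0 : [pchar K] =i pred0.
Hypothesis q0 : q != 0.
Variable l : nat.
Hypothesis l_gt1 : (1 < l)%N.
Hypothesis prim : l.-primitive_root (q ^+ 2).

Local Notation delta := (- q - q^-1).
Local Notation idM := (@id_wmatrix K).
Local Notation "A *[ n ] B" := (mulM n A B) (at level 40, left associativity).
Local Notation "A *t[ i , j ] B" := (tensM i j A B) (at level 39, left associativity).
Local Notation TLmx := (@TL_matrix K q).
Local Notation rep := (@state_sum K q _ _).
Local Notation ev n := (rep (evT K n)).
Local Notation co n := (rep (coT K n)).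
Local Notation J := (@annihilated K q).
Local Notation a := l.-1.
Implicit Types A B X Y : wmatrix K.

Section ProperIdeal.

Variable I : forall i j : nat, TLhom K i j -> Prop.
Hypothesis idI : tensor_ideal delta I.

Hypothesis proper : ~ I (idT K 0).

(** A vector of minimal length in a proper ideal is killed by all caps. *)
Lemma proper_low_degree n (V : TLhom K 0 n) : I V -> (n < a + a)%N -> V = 0.
Proof.
elim/ltn_ind: n V => n IH V IV na.
have [n0|n0] := posnP n.
  by move: V IV {IH na}; rewrite n0; apply: (proper_scalar q0 idI proper).
have [//|nV] := eqVneq V 0.
have fV : cap_free q (rep V [::]) n.
  move=> c cn; apply: (capped_zero q0) => // g Eg.
  by apply: IH; [lia | exact: (ideal_capped q0 idI cn IV Eg) | lia].
have := cap_free_degree charK0 q0 l_gt1 prim nV n0 fV; lia.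
Qed.

End ProperIdeal.

End RootOfUnity.

(** * The generator *)

Section Generator.

Variables (K : fieldType) (q : K).
Hypothesis charK0 : [pchar K] =i pred0.
Hypothesis q0 : q != 0.
Variable l : nat.
Hypothesis l_gt1 : (1 < l)%N.
Hypothesis prim : l.-primitive_root (q ^+ 2).

Local Notation delta := (- q - q^-1).
Local Notation idM := (@id_wmatrix K).
Local Notation "A *[ n ] B" := (mulM n A B) (at level 40, left associativity).
Local Notation "A *t[ i , j ] B" := (tensM i j A B) (at level 39, left associativity).
Local Notation TLmx := (@TL_matrix K q).
Local Notation rep := (@state_sum K q _ _).
Local Notation ev n := (rep (evT K n)).
Local Notation co n := (rep (coT K n)).
Local Notation J := (@annihilated K q).
Local Notation a := l.-1.
Implicit Types A B X Y : wmatrix K.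

Lemma closingD (f g h : TLhom K a a) :
  close_bent q f (closing q (g + h)) = close_bent q f (closing q g) + close_bent q f (closing q h).
Proof.
rewrite /close_bent /closing /mulM -big_split; apply: eq_bigr => u _ /=.
rewrite -mulrDr -big_split; congr (_ * _); apply: eq_bigr => v _ /=.
by rewrite /tensM repD; ring.
Qed.

Lemma closingZ (f : TLhom K a a) c (g : TLhom K a a) :
  close_bent q f (closing q (c *: g)) = c * close_bent q f (closing q g).
Proof.
rewrite /close_bent /closing /mulM mulr_sumr; apply: eq_bigr => u _ /=.
rewrite mulrCA; congr (_ * _); rewrite mulr_sumr; apply: eq_bigr => v _ /=.
by rewrite /tensM repZ; ring.
Qed.

Lemma a_gt0 : (0 < a)%N. Proof. by rewrite -ltnS prednK // ltnW. Qed.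

Variable f : TLhom K a a.
Hypothesis orth : forall d : diagram a a, val d != id_pairing a ->
  close_bent q f (closing q (dvec K (val d))) = 0.

(** Such a functional is the closing of an endomorphism, whose coefficient at the
    identity is the given entry, hence 0. *)
Lemma orthogonal_functional X : TLmx (a + a) 0 X ->
  X (nseq a true ++ nseq a false) [::] = 0 -> close_bent q f X = 0.
Proof.
move=> hX X0; have hev := hom_rep q (evT K a); have hco := hom_rep q (coT K a).
have [g Eg] := hom_open q0 hco hX.
have E : closing q g = X.
  by rewrite /closing Eg (open_close q0 hev hco (zigzag_l q0 a) hX).
have gid : g (identity_diagram a) = 0.
  have := closing_entry q0 g (size_nseq a true) (size_nseq a false).
  rewrite E X0 (id_coefficient q0) /dual_word map_nseq rev_nseq /= => /esym/eqP.
  by rewrite mulf_eq0 invr_eq0 expf_eq0 oppr_eq0 (negPf q0) andbF orbF => /eqP.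
rewrite -E [g]diagram_expansion.
rewrite (big_morph (fun g => close_bent q f (closing q g)) (closingD f) (_ : _ = 0)); last first.
  by rewrite -(scale0r 0) closingZ mul0r.
apply: big1 => d _; rewrite closingZ.
have [ed|nd] := eqVneq (val d) (id_pairing a); last by rewrite orth ?mulr0.
by rewrite (_ : d = (identity_diagram a)) ?gid ?mul0r //; apply: val_inj.
Qed.

Variable V : TLhom K 0 (a + a).
Hypothesis bendV : rep V = bend q a (rep f).

(** After a cap which is not the middle one, the bent f is killed by all
    functionals; as it is then too short to lie in a proper ideal, it is 0. *)
Lemma generator_cap_free : cap_free q (rep V [::]) (a + a).
Proof.
apply: (cap_free_middle q0 l_gt1 prim) => c ca cn.
apply: (capped_zero q0) => // g Eg.
apply: (proper_low_degree charK0 q0 l_gt1 prim (I := J)); last by lia.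
- exact: annihilated_ideal.
- exact: id0_not_annihilated.
apply: (annihilated_vector q0) => Y hY; rewrite Eg mulMA.
have ea : (c + (2 + (a + a - c - 2)) = a + a)%N by lia.
have hX := hom_mul q0 (hom_cap q0 c (a + a - c - 2)) hY; rewrite ea in hX *.
rewrite bendV; apply: (orthogonal_functional hX).
have split2 b m k : (k.+1 < m)%N ->
    nseq m b = nseq k b ++ [:: b; b] ++ nseq (m - k - 2) b.
  by move=> km; rewrite -[[:: b; b]]/(nseq 2 b) -!nseqD; congr nseq; lia.
have [lt|ge] := ltnP c.+1 a.
  rewrite (@split2 _ true a c lt) -!catA; apply: cap_mul_eq => //.
    by rewrite size_nseq.
  by rewrite size_cat !size_nseq; lia.
rewrite (@split2 _ false a (c - a)%N) ?catA -?catA; last by lia.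
rewrite catA; apply: cap_mul_eq => //; last by rewrite size_nseq; lia.
by rewrite size_cat !size_nseq; lia.
Qed.

Lemma generator_entry s u : size s = a -> size u = a ->
  rep f s u = (- q) ^- zeros (dual_word s) * rep V [::] (dual_word s ++ u).
Proof.
move=> ss su; rewrite bendV (bend_entry q0) ?size_dual // dual_wordK mulKf //.
by rewrite expf_neq0 // oppr_eq0.
Qed.

Lemma generator_up s t1 t2 : size s = a -> (size t1 + 2 + size t2 = a)%N ->
  rep f s (t1 ++ [:: true; false] ++ t2) = q * rep f s (t1 ++ [:: false; true] ++ t2).
Proof.
move=> ss st; rewrite !generator_entry ?size_cat //=; try lia.
rewrite mulrCA; congr (_ * _); rewrite !(catA (dual_word s)).
apply: (generator_cap_free (c := (a + size t1)%N)); rewrite ?size_cat ?size_dual ?ss //; lia.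
Qed.

Lemma generator_low s1 s2 t : size t = a -> (size s1 + 2 + size s2 = a)%N ->
  rep f (s1 ++ [:: true; false] ++ s2) t = q * rep f (s1 ++ [:: false; true] ++ s2) t.
Proof.
move=> st ss; rewrite !generator_entry ?size_cat //=; try lia.
have dual_cat b c : dual_word (s1 ++ [:: b; c] ++ s2) =
    dual_word s2 ++ [:: ~~ c; ~~ b] ++ dual_word s1.
  by rewrite /dual_word !map_cat !rev_cat -catA.
rewrite !(dual_cat, count_cat) /= mulrCA; congr (_ * _).
have := generator_cap_free (c := size s2) _ (size_dual s2) (t2 := dual_word s1 ++ t).
by rewrite -!catA; apply; rewrite ?size_cat ?size_dual; lia.
Qed.

(** A diagram from n to 0 has an adjacent cap. *)
Lemma cap_free_pairing n (W : TLhom K 0 n) X : (0 < n)%N ->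
  cap_free q (rep W [::]) n -> TLmx n 0 X -> (rep W *[n] X) [::] [::] = 0.
Proof.
move=> n0 fW [x <-]; rewrite [x]diagram_expansion /mulM.
under eq_bigr do rewrite rep_sum mulr_sumr.
rewrite exchange_big big1 // => d _.
under eq_bigr do rewrite repZ mulrCA.
rewrite -mulr_sumr; apply/eqP; rewrite mulf_eq0; apply/orP; right; apply/eqP.
have pl := valP d; move: (val d) pl => p pl; have pp := elimT (planarP _) pl.
have [c [c' [pc cc']]] : exists c c' : 'I_n, p (inl c) = inl c' /\ c' = c.+1 :> nat.
  case E: (p (inl (Ordinal n0))) => [b|[]//]; apply: (adjacent_cap pl E).
  rewrite lt0n; apply/eqP => b0; have := planar_fixfree pp (inl (Ordinal n0)).
  by rewrite E (_ : b = Ordinal n0) ?eqxx //; apply: val_inj.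
have cn : (c.+1 < n)%N by rewrite -cc'.
have en : n = (c + (2 + (n - c - 2)))%N by lia.
rewrite {1}en sum_words_mid; apply: big1_seq => w1 /andP[_]; rewrite mem_words => /eqP s1.
apply: big1_seq => w2 /andP[_]; rewrite mem_words => /eqP s2.
have [E1 E2] := entry_cap pl q0 w2 [::] pc cc' s1.
rewrite sum_words2 !rep_dvec ?size_cat ?s1 ?s2 //=; try lia.
have h : (size w1 + 2 + size w2 = n)%N by rewrite s1 s2; lia.
have := fW c cn w1 w2 s1 h; rewrite (E1 true) (E1 false) E2 /= => ->.
by rewrite !mulr0 add0r addr0; field.
Qed.

Lemma generator_annihilated : J f.
Proof.
apply: bend_annihilated => // X hX; rewrite -bendV.
by apply: cap_free_pairing => //; [rewrite addn_gt0 a_gt0 | exact: generator_cap_free].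
Qed.

Lemma generator_mul_diagram (p : pairing a a) : planar p -> p != id_pairing a ->
  compT delta f (dvec K p) = 0 /\ compT delta (dvec K p) f = 0.
Proof.
move=> pl ni; split; apply: (rep_inj q0) => s t.
  have [/andP[/eqP ss /eqP st]|ns] := boolP ((size s == a) && (size t == a)); last exact: rep_size.
  have [c [c' [pc cc']]] := not_id_has_cup pl ni.
  have cn : (c.+1 < a)%N by rewrite -cc'.
  have en : a = (c + (2 + (a - c - 2)))%N by lia.
  rewrite rep_comp // {1}en sum_words_mid.
  apply: big1_seq => w1 /andP[_]; rewrite mem_words => /eqP s1.
  apply: big1_seq => w2 /andP[_]; rewrite mem_words => /eqP s2.
  have [E1 E2] := entry_cup pl q0 s w2 pc cc' s1.
  rewrite sum_words2 !rep_dvec ?size_cat ?s1 ?s2 //=; try lia.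
  have h : (size w1 + 2 + size w2 = a)%N by rewrite s1 s2; lia.
  have := generator_low st h; rewrite (E1 true) (E1 false) E2 /= => ->.
  by rewrite !mul0r add0r addr0; ring.
have [/andP[/eqP ss /eqP st]|ns] := boolP ((size s == a) && (size t == a)); last exact: rep_size.
have [c [c' [pc cc']]] := not_id_has_cap pl ni.
have cn : (c.+1 < a)%N by rewrite -cc'.
have en : a = (c + (2 + (a - c - 2)))%N by lia.
rewrite rep_comp // {1}en sum_words_mid.
apply: big1_seq => w1 /andP[_]; rewrite mem_words => /eqP s1.
apply: big1_seq => w2 /andP[_]; rewrite mem_words => /eqP s2.
have [E1 E2] := entry_cap pl q0 w2 t pc cc' s1.
rewrite sum_words2 !rep_dvec ?size_cat ?s1 ?s2 //=; try lia.
have h : (size w1 + 2 + size w2 = a)%N by rewrite s1 s2; lia.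
have := generator_up ss h; rewrite (E1 true) (E1 false) E2 /= => ->.
by rewrite !mulr0 add0r addr0; field.
Qed.

(** The identity is the only diagram that f does not annihilate. *)
Lemma generator_mul g :
  compT delta f g = g (identity_diagram a) *: f /\ compT delta g f = g (identity_diagram a) *: f.
Proof.
have id_l : compT delta f (idT K a) = f.
  by apply: (rep_injM q0); rewrite rep_compM // rep_idM // (mul_idM q0 (hom_rep q f)).
have id_r : compT delta (idT K a) f = f.
  by apply: (rep_injM q0); rewrite rep_compM // rep_idM // (mulM_id q0 (hom_rep q f)).
have expand (F : TLhom K a a -> TLhom K a a) :
    (forall g h, F (g + h) = F g + F h) -> (forall c g, F (c *: g) = c *: F g) ->
    F (idT K a) = f -> (forall d : diagram a a, val d != id_pairing a -> F (dvec K (val d)) = 0) ->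
    F g = g (identity_diagram a) *: f.
  move=> FD FZ Fid Fd; rewrite {1}[g]diagram_expansion.
  have F0 : F 0 = 0 by have := FZ 0 0; rewrite !scale0r.
  rewrite (big_morph F FD F0).
  rewrite (bigD1 (identity_diagram a)) //= big1 => [|d nd].
    by rewrite addr0 FZ [dvec K _]/(idT K a) Fid.
  by rewrite FZ Fd ?scaler0 //; apply: contraNneq nd => E; apply/eqP/val_inj.
have repE (F G : TLhom K a a) : (forall s t, rep F s t = rep G s t) -> F = G.
  by move=> E; apply: (rep_injM q0); apply: wmatrixP.
split; [apply: (expand (fun h => compT delta f h)) | apply: (expand (fun h => compT delta h f))];
  rewrite //.
- move=> g' h; apply: repE => s t; rewrite repD !rep_comp // -big_split; apply: eq_bigr => u _.
  by rewrite repD mulrDl.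
- move=> c g'; apply: repE => s t; rewrite repZ !rep_comp // mulr_sumr; apply: eq_bigr => u _.
  by rewrite repZ mulrA.
- by move=> d nd; have [] := generator_mul_diagram (valP d) nd.
- move=> g' h; apply: repE => s t; rewrite repD !rep_comp // -big_split; apply: eq_bigr => u _.
  by rewrite repD mulrDr.
- move=> c g'; apply: repE => s t; rewrite repZ !rep_comp // mulr_sumr; apply: eq_bigr => u _.
  by rewrite repZ mulrCA.
by move=> d nd; have [] := generator_mul_diagram (valP d) nd.
Qed.

Hypothesis nf : f != 0.

Lemma generator_vector_neq0 : V != 0.
Proof.
apply: contraNneq nf => V0; apply/eqP/(rep_eq0 q0).
rewrite -(bendK q0 (hom_rep q f)) -bendV V0; apply: wmatrixP => s t.
rewrite /unbend /mulM big1 // => u _.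
by rewrite /tensM rep0 mulr0 mul0r.
Qed.

Lemma generator_coefficient : f (identity_diagram a) != 0.
Proof.
have := cap_free_neq0 q0 generator_cap_free generator_vector_neq0.
rewrite (id_coefficient q0) => v0.
have := bend_entry q0 f (size_nseq a true) (size_nseq a false).
rewrite -bendV /dual_word map_nseq rev_nseq /= !count_nseq /= mul0n expr0 mul1r => <-.
rewrite (cap_free_entry q0 generator_cap_free) ?size_cat ?size_nseq //.
  by rewrite mulf_neq0 // expf_neq0.
by rewrite count_cat !count_nseq /= mul1n mul0n addn0.
Qed.

End Generator.

(** * Classification of the ideals *)

Section Classification.

Variables (K : fieldType) (q : K).
Hypothesis charK0 : [pchar K] =i pred0.
Hypothesis q0 : q != 0.
Variable l : nat.
Hypothesis l_gt1 : (1 < l)%N.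
Hypothesis prim : l.-primitive_root (q ^+ 2).

Local Notation delta := (- q - q^-1).
Local Notation idM := (@id_wmatrix K).
Local Notation "A *[ n ] B" := (mulM n A B) (at level 40, left associativity).
Local Notation "A *t[ i , j ] B" := (tensM i j A B) (at level 39, left associativity).
Local Notation TLmx := (@TL_matrix K q).
Local Notation rep := (@state_sum K q _ _).
Local Notation ev n := (rep (evT K n)).
Local Notation co n := (rep (coT K n)).
Local Notation J := (@annihilated K q).
Local Notation a := l.-1.
Implicit Types A B X Y : wmatrix K.

Section Bending.

Variable I : forall i j : nat, TLhom K i j -> Prop.
Hypothesis idI : tensor_ideal delta I.

Lemma in_ideal_bend i j A :
  in_ideal q I i j A -> in_ideal q I 0 (i + j) (bend q i A).
Proof.
move=> IA; apply: (in_ideal_mull q0 idI (hom_rep q (coT K i))).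
exact: (in_ideal_tens q0 idI i IA).
Qed.

Lemma in_ideal_unbend i j B :
  in_ideal q I 0 (i + j) B -> in_ideal q I i j (unbend q i j B).
Proof.
move=> IB; have := in_ideal_tens q0 idI i IB; rewrite addn0 => IB'.
exact: (in_ideal_mulr q0 idI IB' (hom_cap_id q0 i j)).
Qed.

Lemma ideal_from_bend i j (f : TLhom K i j) (V : TLhom K 0 (i + j)) :
  rep V = bend q i (rep f) -> I V -> I f.
Proof.
move=> EV IV; apply/(in_ideal_rep q0); rewrite -(bendK q0 (hom_rep q f)) -EV.
by apply: in_ideal_unbend; apply/(in_ideal_rep q0).
Qed.

Lemma ideal_to_bend i j (f : TLhom K i j) : I f ->
  exists2 V : TLhom K 0 (i + j), I V & rep V = bend q i (rep f).
Proof. by move=> /(in_ideal_rep q0)/in_ideal_bend [V IV <-]; exists V. Qed.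

End Bending.

Lemma generated_tensor_ideal n n' (f : TLhom K n n') :
  tensor_ideal delta (fun i j => @generated_ideal K delta n n' f i j).
Proof.
split.
- by move=> i j I idI _; apply: (ideal_zero idI).
- by move=> i j g h Ig Ih I idI If; apply: (ideal_sub idI); [apply: Ig|apply: Ih].
- by move=> i j m g h Ig I idI If; apply: (ideal_postcomp idI); apply: Ig.
- by move=> i j m g h Ig I idI If; apply: (ideal_precomp idI); apply: Ig.
by move=> z i j g Ig I idI If; apply: (ideal_tensor idI); apply: Ig.
Qed.

(** The loop value vanishes only for l = 2, when T(a, a) has no cups or caps. *)
Lemma delta_neq0 : (1 < a)%N -> delta != 0.
Proof.
move=> a1; apply/eqP => d0; have z1 : q ^+ 2 = -1.
  apply: (mulfI (x := q^-1)); first by rewrite invr_neq0.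
  rewrite expr2 mulKf // mulrN1; apply/eqP; rewrite -subr_eq0 opprK.
  by rewrite -oppr_eq0 opprD d0.
have : (l %| 2)%N by rewrite (prim_order_dvd prim) z1 -signr_odd expr0.
by move/dvdn_leq => /(_ isT); lia.
Qed.

Section Generated.

Variable f : TLhom K a a.
Hypothesis fid : f (identity_diagram l.-1) != 0.

Variable I : forall i j : nat, TLhom K i j -> Prop.
Hypothesis idI : tensor_ideal delta I.
Hypothesis If : I f.

(** Induction on the length: on the last strands the identity is a combination
    of f and of diagrams with a cap, which shortens the vector. *)
Lemma annihilated_vector_sub n (W : TLhom K 0 n) : J W -> I W.
Proof.
elim/ltn_ind: n W => n IH W JW.
have idJ := annihilated_ideal q0.
have [na|an] := ltnP n (a + a).
  rewrite (proper_low_degree charK0 q0 l_gt1 prim idJ (id0_not_annihilated q0) JW na).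
  exact: (ideal_zero idI).
have ee : (n - a + a = n)%N by lia.
pose e := (n - a)%N.
pose act (h : TLhom K a a) : TLhom K 0 n :=
  compT delta (castT ee ee (tensT (idT K e) h)) W.
have rep_act h : rep (act h) = rep W *[n] (idM e *t[e, e] rep h).
  by rewrite /act rep_compM // rep_castM rep_tensM // rep_idM.
have repE (F G : TLhom K 0 n) : (forall s t, rep F s t = rep G s t) -> F = G.
  by move=> E; apply: (rep_injM q0); apply: wmatrixP.
have actD g h : act (g + h) = act g + act h.
  apply: repE => s t; rewrite repD !rep_act -big_split; apply: eq_bigr => u _ /=.
  by rewrite -mulrDr /tensM repD; ring.
have actZ c h : act (c *: h) = c *: act h.
  apply: repE => s t; rewrite repZ !rep_act mulr_sumr; apply: eq_bigr => u _ /=.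
  by rewrite /tensM repZ; ring.
have act0 : act 0 = 0 by have := actZ 0 0; rewrite !scale0r.
have act_id : act (idT K a) = W.
  apply: (rep_injM q0); rewrite rep_act rep_idM // tensM_id ee.
  exact: (mulM_id q0 (hom_rep q W)).
have act_f : I (act f).
  have If' := in_ideal_tens q0 idI e (proj2 (in_ideal_rep q0 I f) If).
  rewrite [(e + a)%N]ee in If'.
  by apply/(in_ideal_rep q0); rewrite rep_act; apply: (in_ideal_mull q0 idI (hom_rep q W)).
have act_d (d : diagram a a) : val d != id_pairing a -> I (act (dvec K (val d))).
  (* The cap of d, shifted by e, shortens W to g by two; what remains of d puts
     the ideal element g back to length n. *)
  move=> nd; have [c [c' [pc cc']]] := not_id_has_cap (valP d) nd.
  have ca : (c.+1 < a)%N by rewrite -cc'.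
  have d0 : delta != 0 by apply: delta_neq0; lia.
  have ie : (c + (2 + (n - (e + c) - 2)) = a)%N by rewrite /e; lia.
  have [B hB EB] := cap_factor q0 d0 (valP d) pc cc' erefl ie.
  apply/(in_ideal_rep q0); rewrite rep_act EB (tens_id_mul q0).
  have -> : idM e *t[e, e] capM q c (n - (e + c) - 2) = capM q (e + c) (n - (e + c) - 2).
    by rewrite /capM tens_id_id.
  have ecn : ((e + c).+1 < n)%N by rewrite /e; lia.
  have en : n = (e + c + (2 + (n - (e + c) - 2)))%N by lia.
  have hW := hom_rep q W; rewrite {1}en in hW.
  have [g Eg] := hom_mul q0 hW (hom_cap q0 (e + c) (n - (e + c) - 2)).
  have Ig : I g.
    by apply: IH; [lia | exact: (ideal_capped q0 idJ ecn JW Eg)].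
  rewrite -en in Eg; rewrite -mulMA -Eg [(e + (c + _))%N]addnA.
  apply: (in_ideal_mulr q0 idI (proj2 (in_ideal_rep q0 I g) Ig)).
  have := hom_tens q0 (hom_id q0 e) hB.
  by rewrite addnA [(e + a)%N]ee.
rewrite -act_id.
have : I (f (identity_diagram l.-1) *: act (idT K a)).
  have := act_f; rewrite {1}[f]diagram_expansion (big_morph act actD act0).
  rewrite (bigD1 (identity_diagram l.-1)) //= actZ => Isum.
  rewrite -[f _ *: _](addrK (\sum_(d | d != (identity_diagram l.-1)) act (f d *: dvec K (val d)))).
  apply: (ideal_sub idI) => //.
  apply: (big_ind (fun w => I w)); [exact: (ideal_zero idI) | by move=> *; apply: (ideal_add q0 idI) |].
  move=> d nd; rewrite actZ; apply: (ideal_scale q0 idI); apply: act_d.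
  by apply: contraNneq nd => E'; apply/eqP; exact: (val_inj (E' : val d = val (identity_diagram l.-1))).
move=> /(ideal_scale q0 idI (f (identity_diagram l.-1))^-1).
by rewrite scalerA mulVf // scale1r.
Qed.

Lemma annihilated_sub i j (g : TLhom K i j) : J g -> I g.
Proof.
move=> /(ideal_to_bend (annihilated_ideal q0)) [V JV EV].
exact: (ideal_from_bend idI EV (annihilated_vector_sub JV)).
Qed.

End Generated.

Section Uniqueness.

Variable I : forall i j : nat, TLhom K i j -> Prop.
Hypothesis idI : tensor_ideal delta I.

(** A proper nonzero ideal contains a nonzero vector, hence one killed by all caps,
    and up to scalars there is only one. *)
Lemma proper_contains_generator (f : TLhom K a a) (V : TLhom K 0 (a + a)) :
    cap_free q (rep V [::]) (a + a) -> rep V = bend q a (rep f) ->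
    ~ I (idT K 0) -> ~ same_ideal I (@zero_ideal K) -> I f.
Proof.
move=> fV bV proper nz.
(* Capping a nonzero vector of I as long as some cap does not kill it. *)
have main n (W : TLhom K 0 n) : I W -> W != 0 -> I f.
  elim/ltn_ind: n W => n IH W IW nW; apply: NNPP => nf.
  have n0 : (0 < n)%N.
    rewrite lt0n; apply: contraNneq nW => n0; move: W IW; rewrite n0 => W IW.
    by rewrite (proper_scalar q0 idI proper IW).
  have fW : cap_free q (rep W [::]) n.
    move=> c cn; apply: (capped_zero q0) => // g Eg; apply/eqP; apply: contraT => ng.
    case: nf; apply: (IH _ _ g) ng; first by lia.
    exact: (ideal_capped q0 idI cn IW Eg).
  have en := cap_free_degree charK0 q0 l_gt1 prim nW n0 fW.
  move: W IW nW fW {IH n0}; rewrite en => W IW nW fW; apply: nf.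
  apply: (ideal_from_bend idI bV).
  set v := rep V [::] (nseq a false ++ nseq a true).
  set w := rep W [::] (nseq a false ++ nseq a true).
  suff -> : V = (v / w) *: W by apply: (ideal_scale q0 idI).
  have w0 : w != 0 := cap_free_neq0 q0 fW nW.
  apply: (rep_injM q0); apply: wmatrixP => s t; rewrite repZ.
  have [/andP[/nilP-> /eqP st]|ns] := boolP ((size s == 0%N) && (size t == a + a)%N); last first.
    by rewrite !rep_size ?mulr0.
  have [/eqP ot|nt] := boolP (ones t == a).
    rewrite (cap_free_entry q0 fV) // (cap_free_entry q0 fW) // -/v -/w.
    by rewrite mulrCA divfK.
  by rewrite !balanced ?mulr0 //; have := ones_zeros t; lia.
have [i [j [g [Ig ng]]]] : exists i j (g : TLhom K i j), I g /\ g != 0.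
  apply: NNPP => H; apply: nz => i j g; split=> [Ig|->]; last exact: (ideal_zero idI).
  by apply/eqP; apply: contraT => ng; case: H; exists i, j, g.
have [W IW EW] := ideal_to_bend idI Ig.
apply: (main _ W IW); apply: contraNneq ng => W0; apply/eqP/(rep_eq0 q0).
rewrite -(bendK q0 (hom_rep q g)) -EW W0; apply: wmatrixP => s t.
by rewrite /unbend /mulM big1 // => u _; rewrite /tensM rep0 mulr0 mul0r.
Qed.

End Uniqueness.

End Classification.

Theorem corollary3p3p3 (K : closedFieldType) (charK0 : [pchar K] =i pred0)
    (q : K) (q_neq0 : q != 0) (l : nat) (l_gt1 : (1 < l)%N)
    (ord_q2 : l.-primitive_root (q ^+ 2))
    (delta : K) (def_delta : delta = - q - q^-1) :
  exists (J : forall i j : nat, TLhom K i j -> Prop) (f : TLhom K l.-1 l.-1),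
    (* (i) *)
    [/\ nontrivial_ideal delta J,
        forall I : forall i j : nat, TLhom K i j -> Prop,
          nontrivial_ideal delta I -> same_ideal I J,
        forall gam : forall m n : nat, TLhom K (m + n) (n + m),
          is_braiding delta gam -> same_ideal J (@negligible K delta gam),
        quasi_idempotent delta f &
        same_ideal J (@generated_ideal K delta l.-1 l.-1 f)]
    (* (ii) *)
    /\ (forall d : diagram l.-1 l.-1, has_cup d || has_cap d ->
          compT delta f (dvec K (val d)) = 0
          /\ compT delta (dvec K (val d)) f = 0)
    /\ (forall g : TLhom K l.-1 l.-1, compT delta f g = compT delta g f).
Proof.
have [f nf orth] := exists_orthogonal q l.-1.
have [V bV] := hom_bend q_neq0 (hom_rep q f).
have fV := generator_cap_free charK0 q_neq0 l_gt1 ord_q2 orth bV.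
have fid := generator_coefficient charK0 q_neq0 l_gt1 ord_q2 orth bV nf.
have Jf := generator_annihilated charK0 q_neq0 l_gt1 ord_q2 orth bV.
have idJ := annihilated_ideal q_neq0; have Jid := id0_not_annihilated q_neq0.
have mulf := generator_mul charK0 q_neq0 l_gt1 ord_q2 orth bV.
have sub I (idI : tensor_ideal (- q - q^-1) I) (If : I l.-1 l.-1 f) :=
  annihilated_sub charK0 q_neq0 l_gt1 ord_q2 fid idI If.
rewrite def_delta; exists (@annihilated K q), f; split; first split.
- split=> // [H|H]; first by case/eqP: nf; apply/(H l.-1 l.-1 f).
  by apply: Jid; apply/(H 0%N 0%N (idT K 0)).
- move=> I [idI nzI nfI].
  have Iid : ~ I 0%N 0%N (idT K 0) by move=> I0; apply: nfI; apply: (ideal_full q_neq0 idI I0).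
  have If := proper_contains_generator charK0 q_neq0 l_gt1 ord_q2 idI fV bV Iid nzI.
  move=> i j g; split; [exact: (proper_annihilated q_neq0 idI Iid)|exact: (sub I idI If)].
- by move=> gam br i j g; apply: negligible_annihilated.
- by exists (f (identity_diagram l.-1)); have [-> _] := mulf f.
- move=> i j g; split=> [Jg I idI If|]; first exact: (sub I idI If).
  by move/(_ _ idJ Jf).
split=> [d hd|g]; last by have [-> ->] := mulf g.
have nd := has_arc_not_id hd.
exact: (generator_mul_diagram charK0 q_neq0 l_gt1 ord_q2 orth bV (valP d) nd).
Qed.
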